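(* Let $\kappa\in\mathbb R$ and consider the equation $$u_{yy}=u_{tx}+\left(\tfrac12(\kappa+1)u_x^2+u_y\right)u_{xx}+\kappa\,u_x\,u_{xy},$$ with the forms $\theta_0,\theta_2,\theta_3,\theta_{22},\xi^1,\xi^2,\xi^3,\eta_1$ and invariants $U,V$ (for $\kappa\neq-1$), respectively $\theta_0,\theta_2,\theta_3,\theta_{22},\xi^1,\xi^2,\xi^3,\eta_1,\eta_2$ and invariant $U$ (for $\kappa=-1$), given in the context. The following are, up to a contact equivalence, the solutions $\omega_0$ of the systems below (with unknown 1-forms $\omega_0,\omega_1$ and, in 2)–4), an unknown function $W$). 1) Let $\kappa\ne-1$. The equation $$d\omega_0=\Big(\omega_1+\tfrac12(\eta_1+\theta_{22})+\tfrac14V\xi^1+\tfrac1{16}(8U+\kappa+12)\xi^3\Big)\wedge\omega_0+\omega_1\wedge\xi^2+\theta_2\wedge\xi^3-\Big(\tfrac18(\kappa-4)\theta_0-\theta_3\Big)\wedge\xi^1$$ yields $$\omega_0=\frac{u_{xxx}}{u_{xx}v_x}\Big(dv-\big(\tfrac12(\kappa+1)u_x^2-u_y\big)v_x\,dt-v_x\,dx+u_xv_x\,dy\Big).$$ 2) Let $\kappa\neq-1$. Integrating the system $$\begin{aligned}d\omega_0={}&\Big(\omega_1+\tfrac12(\eta_1+\theta_{22})+\tfrac14\big(V-2W(W-2)\big)\xi^1+\tfrac1{16}\big(8(U-W)+\kappa+12\big)\xi^3\Big)\wedge\omega_0\\&+\Big(W^2\omega_1-\tfrac18(\kappa-4)\theta_0+W\theta_2+\theta_3\Big)\wedge\xi^1+\omega_1\wedge\xi^2+(W\omega_1+\theta_2)\wedge\xi^3,\\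 dW={}&\tfrac1{16}W\Big(8\big(\eta_1-\theta_{22}-\kappa\,\omega_0-(\kappa+1)\,\omega_1\big)-4\big(V-2W(W-2(\kappa+1))\big)\xi^1-\big(8(U-W)+5(3\kappa+4)\big)\xi^3\Big)\end{aligned}$$ yields: when $\kappa\notin\{-2,-\frac32,-1\}$, $$\begin{aligned}\omega_0=\frac{u_{xxx}}{u_{xx}v_x}\Big(&dv-\Big((2\kappa+3)^{-1}v_x^{2(\kappa+1)}-u_xv_x^{\kappa+1}+\tfrac12(\kappa+1)u_x^2-u_y\Big)v_x\,dt\\&-v_x\,dx-\big((\kappa+2)^{-1}v_x^{\kappa+1}-u_x\big)v_x\,dy\Big);\end{aligned}$$ when $\kappa=-2$, $$\omega_0=\frac{u_{xxx}}{u_{xx}v_x}\Big(dv+\big(v_x^{-1}+u_x+(\tfrac12u_x^2+u_y)v_x\big)dt-\big(\ln|v_x|-u_xv_x\big)dy-v_x\,dx\Big);$$ when $\kappa=-\frac32$, $$\omega_0=\frac{u_{xxx}}{u_{xx}v_x}\Big(dv+\big((\tfrac14u_x^2+u_y)v_x+u_x\sqrt{|v_x|}-\ln|v_x|\big)dt+\big(u_xv_x-2\sqrt{|v_x|}\big)dy-v_x\,dx\Big).$$ 3) Let $\kappa=-3$. The system $$\begin{aligned}d\omega_0={}&\Big(\omega_1+\tfrac12(\eta_1+\theta_{22})+\tfrac14V\xi^1+\tfrac32\xi^2+\tfrac1{16}\big(8(U+2W)+9\big)\xi^3\Big)\wedge\omega_0\\&+\Big(\big(W+\tfrac78\big)\theta_0+\theta_3\Big)\wedge\xi^1+\omega_1\wedge\xi^2+\theta_2\wedge\xi^3,\\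 dW={}&W\Big(\omega_1-\theta_{22}-\tfrac12VW\,\xi^1-(U-W-1)\xi^3\Big)\end{aligned}$$ yields $$\omega_0=\frac{u_{xxx}}{u_{xx}v_x}\Big(dv+\big(u+(u_x^2+u_y)v_x\big)dt-v_x\,dx+(v_xu_x+x)\,dy\Big).$$ 4) Let $\kappa=-1$. The system $$\begin{aligned}d\omega_0={}&\Big(\omega_1+\tfrac12\big(\eta_1+\theta_{22}-W(W-2)\xi^1\big)-\tfrac18(4W-7)\xi^3\Big)\wedge\omega_0\\&+\Big(W^2\omega_1+\tfrac58\theta_0+W\theta_2+\theta_3\Big)\wedge\xi^1+\omega_1\wedge\xi^2+(W\omega_1+\theta_2)\wedge\xi^3,\\ dW={}&\eta_2+UW\,\xi^1+\tfrac12W\Big(\eta_1-\theta_{22}-(W+1)\xi^2+(2U-W)\xi^3\Big)\end{aligned}$$ yields $$\omega_0=\frac{u_{xxx}}{u_{xx}v_x}\Big(dv+v_x(u_y+\lambda u_x-\lambda^2)\,dt-v_x\,dx+v_x(u_x-\lambda)\,dy\Big),\qquad\lambda\in\mathbb R.$$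
   Context: Independent variables $t,x,y$, dependent variable $u$; everything is local, where the displayed expressions are defined (in particular $u_{xx}u_{xxx}\ne0$). $v$ and $v_x$ are new independent local coordinates (fibre coordinates of the extended space), $v_x\neq0$. A 1-form $\omega_0$ is a solution of a displayed system if there are a 1-form $\omega_1$ (and a function $W$, where it occurs) satisfying it. ''Up to a contact equivalence'' means up to local changes of the new coordinates and contact symmetries of the equation (i.e. local diffeomorphisms of the extended space covering transformations preserving the forms $\theta,\xi,\eta$), together with the freedom in $\omega_0,\omega_1$ and $W$ preserving the system. Contact forms on the equation: $\vartheta_0=du-u_tdt-u_xdx-u_ydy$, $\vartheta_2=du_x-u_{tx}dt-u_{xx}dx-u_{xy}dy$, $\vartheta_3=du_y-u_{ty}dt-u_{xy}dx-\big(u_{tx}+(\frac12(\kappa+1)u_x^2+u_y)u_{xx}+\kappa u_xu_{xy}\big)dy$, $\vartheta_{22}=du_{xx}-u_{txx}dt-u_{xxx}dx-u_{xxy}dy$. Case $\kappa\ne-1$ (Maurer–Cartan forms and invariants of the contact symmetry pseudo-group of the equation): $$U=\frac{u_{xxy}+u_xu_{xxx}}{u_{xx}^2},\qquad V=\frac{u_{xxx}\big(2u_{txx}+((\kappa+3)u_x^2+2u_y)u_{xxx}+2(\kappa+2)(u_x(u_{xxy}+u_{xx}^2)+u_{xx}u_{xy})\big)}{u_{xx}^4},$$ $\theta_0=\frac{u_{xxx}^2}{u_{xx}^3}\vartheta_0$, $\theta_2=\frac{u_{xxx}}{u_{xx}^2}\vartheta_2$, $\theta_3=\frac{u_{xxx}^2}{u_{xx}^4}\big(\frac18(\kappa-4)u_{xx}\vartheta_0+u_x\vartheta_2+\vartheta_3\big)$,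 $\theta_{22}=\frac1{u_{xx}}\vartheta_{22}$, $\xi^1=\frac{u_{xx}^3}{u_{xxx}}dt$, $\xi^2=\frac{u_{xxx}}{u_{xx}}\big((\frac12(\kappa+1)u_x^2-u_y)dt+dx-u_xdy\big)$, $\xi^3=-(\kappa+2)u_xu_{xx}dt+u_{xx}dy$, $\eta_1=2\frac{du_{xxx}}{u_{xxx}}-3(\theta_{22}+\xi^2)-\frac1{2u_{xx}^3}\big(3Vu_{xx}^3-4(\kappa+3)(u_xu_{xx}+u_{xy})u_{xxx}\big)\xi^1-\big(3U+\frac18(\kappa-4)\big)\xi^3$. Case $\kappa=-1$ (Maurer–Cartan forms and invariant of the contact symmetry pseudo-group of the equation): $$U=\frac{u_{xxx}(u_xu_{xxy}-u_{txx}-u_yu_{xxx}-u_{xy}u_{xx})+u_{xxy}(u_{xxy}+u_{xx}^2)}{u_{xx}^4}-\frac{33}{64},$$ $\theta_0=\frac{u_{xxx}^2}{u_{xx}^3}\vartheta_0$, $\theta_2=\frac{u_{xxx}}{u_{xx}^2}\vartheta_2$, $\theta_3=\frac{u_{xxx}}{8u_{xx}^4}\big(8u_{xxx}\vartheta_3-5u_{xx}u_{xxx}\vartheta_0-(8u_{xxy}-3u_{xx}^2)\vartheta_2\big)$, $\theta_{22}=\frac1{u_{xx}}\vartheta_{22}$, $\xi^1=\frac{u_{xx}^3}{u_{xxx}}dt$, $\xi^2=\frac1{u_{xx}u_{xxx}}\big(u_{xxy}(u_{xxy}-\frac34u_{xx}^2)+u_{xxx}(u_xu_{xxy}-u_yu_{xxx})-\frac3{64}u_{xx}^2(8u_xu_{xxx}-3u_{xx}^2)\big)dt+\frac{u_{xxx}}{u_{xx}}dx+\frac{8u_{xxy}-3u_{xx}^2}{8u_{xx}}dy$,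 $\xi^3=\frac{u_{xx}}{4u_{xxx}}(8u_{xxy}+4u_xu_{xxx}-3u_{xx}^2)dt+u_{xx}dy$, $\eta_1=2\frac{du_{xxx}}{u_{xxx}}-3(\theta_{22}+\xi^2)+\frac1{2u_{xx}^3}\big((4U+3)u_{xx}^3+8(u_{xy}u_{xxx}-u_{xx}u_{xxy})\big)\xi^1-\frac12\xi^3$, and $\eta_2$ is the 1-form entering the structure equations $$d\xi^2=-\tfrac18(5\theta_0+8\theta_3)\wedge\xi^1+\tfrac18\big(4(\eta_1+\theta_{22})+3\xi^3\big)\wedge\xi^2-(\eta_2+\theta_2)\wedge\xi^3,$$ $$d\xi^3=-(2\eta_2+\theta_2)\wedge\xi^1+(\theta_{22}+U\xi^1+\xi^2)\wedge\xi^3 .$$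
   Formalization: In dW: 2) has 2(κ+1)ω1 for (κ+1)ω1; 3) has −½Vξ¹ for −½VWξ¹; 4) ends in ½(W(η1−θ22)−(W+1)ξ²+(2U−W)ξ³). In 2), 3) W≠0. In 2) v_x>0 for κ=−3/2 and for non-integer κ. ω0, ω1 are taken independent along the fibres (v, v_x). *)

(* Defs.v *)
From HB Require Import structures.
From mathcomp Require Import all_boot all_order all_algebra.
From mathcomp Require Import all_classical all_reals all_analysis.

Set Implicit Arguments.
Unset Strict Implicit.
Unset Printing Implicit Defensive.

Import Order.TTheory GRing.Theory Num.Theory.
Import numFieldNormedType.Exports.

Local Open Scope classical_set_scope.
Local Open Scope ring_scope.

(** * Local exterior calculus in coordinates

    Functions, forms and maps on an open subset [N] of [R^m] are total objects
    of which only the values on [N] matter. *)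

Section ExteriorCalculus.
Context {R : realType}.
Implicit Types m n k : nat.

Definition partial m (i : 'I_m) (f : 'rV[R]_m -> R) (q : 'rV[R]_m) : R :=
  'D_(delta_mx 0 i) f q.

Fixpoint class_C k m (N : set 'rV[R]_m) (f : 'rV[R]_m -> R) : Prop :=
  (forall q, N q -> {for q, continuous f}) /\
  if k is k'.+1 then
    forall i, (forall q, N q -> derivable f q (delta_mx 0 i)) /\
              class_C k' N (partial i f)
  else True.

(* C^infinity on the open set N *)
Definition smooth m (N : set 'rV[R]_m) (f : 'rV[R]_m -> R) : Prop :=
  forall k, class_C k N f.

Definition smooth_map m n (N : set 'rV[R]_m) (f : 'rV[R]_m -> 'rV[R]_n) : Prop :=
  forall j, smooth N (fun q => f q 0 j).

(* A 1-form is given by its row of coefficients in dx_0, ..., dx_(m-1); a 2-form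
   by the antisymmetric matrix of its values on the coordinate vector fields. *)
Definition form1 m := 'rV[R]_m -> 'rV[R]_m.

Definition wedge m (a b : 'rV[R]_m) : 'M[R]_m := a^T *m b - b^T *m a.

Definition grad m (f : 'rV[R]_m -> R) : form1 m := fun q => \row_i partial i f q.

Definition dext m (w : form1 m) (q : 'rV[R]_m) : 'M[R]_m :=
  \matrix_(i, j) (partial i (fun x => w x 0 j) q - partial j (fun x => w x 0 i) q).

Definition pullback m (F : 'rV[R]_m -> 'rV[R]_m) (w : form1 m) : form1 m :=
  fun q => \row_i \sum_j w (F q) 0 j * partial i (fun x => F x 0 j) q.

(* F restricts to a diffeomorphism from the open set A onto the open set B *)
Definition diffeo m (A B : set 'rV[R]_m) (F : 'rV[R]_m -> 'rV[R]_m) : Prop :=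
  [/\ open A, open B, F @` A = B, smooth_map A F &
      exists G : 'rV[R]_m -> 'rV[R]_m,
        smooth_map B G /\ (forall q, A q -> G (F q) = q)].

End ExteriorCalculus.

Notation "a ⋀ b" := (wedge a b)
  (at level 40, left associativity) : ring_scope.

(** * The equation, its jets and the extended space *)

Section Equation.
Context {R : realType}.

(* Third order jets of solutions of
     u_yy = u_tx + ((kappa + 1) / 2 * u_x ^ 2 + u_y) * u_xx + kappa * u_x * u_xy
   are parametrized by t, x, y, u and the 15 derivatives of u up to order 3
   with at most one differentiation in y.  The extended space has the two further
   fibre coordinates v, v_x. *)
Notation base := 'rV[R]_19.
Notation space := 'rV[R]_(19 + 2).
Notation covector := 'rV[R]_(19 + 2).
Notation oneform := (@form1 R (19 + 2)).

Definition projb (q : space) : base := lsubmx q.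

Definition i_t    : 'I_(19 + 2) := @Ordinal 21 0 isT.
Definition i_x    : 'I_(19 + 2) := @Ordinal 21 1 isT.
Definition i_y    : 'I_(19 + 2) := @Ordinal 21 2 isT.
Definition i_u    : 'I_(19 + 2) := @Ordinal 21 3 isT.
Definition i_ut   : 'I_(19 + 2) := @Ordinal 21 4 isT.
Definition i_ux   : 'I_(19 + 2) := @Ordinal 21 5 isT.
Definition i_uy   : 'I_(19 + 2) := @Ordinal 21 6 isT.
Definition i_utt  : 'I_(19 + 2) := @Ordinal 21 7 isT.
Definition i_utx  : 'I_(19 + 2) := @Ordinal 21 8 isT.
Definition i_uty  : 'I_(19 + 2) := @Ordinal 21 9 isT.
Definition i_uxx  : 'I_(19 + 2) := @Ordinal 21 10 isT.
Definition i_uxy  : 'I_(19 + 2) := @Ordinal 21 11 isT.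
Definition i_uttt : 'I_(19 + 2) := @Ordinal 21 12 isT.
Definition i_uttx : 'I_(19 + 2) := @Ordinal 21 13 isT.
Definition i_utty : 'I_(19 + 2) := @Ordinal 21 14 isT.
Definition i_utxx : 'I_(19 + 2) := @Ordinal 21 15 isT.
Definition i_utxy : 'I_(19 + 2) := @Ordinal 21 16 isT.
Definition i_uxxx : 'I_(19 + 2) := @Ordinal 21 17 isT.
Definition i_uxxy : 'I_(19 + 2) := @Ordinal 21 18 isT.
Definition i_v    : 'I_(19 + 2) := @Ordinal 21 19 isT.
Definition i_vx   : 'I_(19 + 2) := @Ordinal 21 20 isT.

Notation x_ q := (q ord0 i_x).
Notation u_ q := (q ord0 i_u).
Notation ut q := (q ord0 i_ut).
Notation ux q := (q ord0 i_ux).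
Notation uy q := (q ord0 i_uy).
Notation utx q := (q ord0 i_utx).
Notation uty q := (q ord0 i_uty).
Notation uxx q := (q ord0 i_uxx).
Notation uxy q := (q ord0 i_uxy).
Notation utxx q := (q ord0 i_utxx).
Notation uxxx q := (q ord0 i_uxxx).
Notation uxxy q := (q ord0 i_uxxy).
Notation vx q := (q ord0 i_vx).

(* the coordinate differentials; [d_ i_ux] is du_x *)
Notation d_ i := (delta_mx ord0 i : covector).

(* the right-hand side of the equation *)
Definition uyy (k : R) (q : space) : R :=
  utx q + (2^-1 * (k + 1) * ux q ^+ 2 + uy q) * uxx q + k * ux q * uxy q.

Definition vtheta0 : oneform := fun q =>
  d_ i_u - ut q *: d_ i_t - ux q *: d_ i_x - uy q *: d_ i_y.

Definition vtheta2 : oneform := fun q =>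
  d_ i_ux - utx q *: d_ i_t - uxx q *: d_ i_x - uxy q *: d_ i_y.

Definition vtheta3 (k : R) : oneform := fun q =>
  d_ i_uy - uty q *: d_ i_t - uxy q *: d_ i_x - uyy k q *: d_ i_y.

Definition vtheta22 : oneform := fun q =>
  d_ i_uxx - utxx q *: d_ i_t - uxxx q *: d_ i_x - uxxy q *: d_ i_y.

Definition generic : set space := [set q | uxx q != 0 /\ uxxx q != 0].

(** ** Forms common to all kappa *)

Definition theta0 : oneform := fun q => (uxxx q ^+ 2 / uxx q ^+ 3) *: vtheta0 q.
Definition theta2 : oneform := fun q => (uxxx q / uxx q ^+ 2) *: vtheta2 q.
Definition theta22 : oneform := fun q => (uxx q)^-1 *: vtheta22 q.
Definition xi1 : oneform := fun q => (uxx q ^+ 3 / uxxx q) *: d_ i_t.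

(** ** Forms and invariants for kappa <> -1 *)

Definition invU (q : space) : R := (uxxy q + ux q * uxxx q) / uxx q ^+ 2.

Definition invV (k : R) (q : space) : R :=
  uxxx q *
  (2 * utxx q + ((k + 3) * ux q ^+ 2 + 2 * uy q) * uxxx q
   + 2 * (k + 2) * (ux q * (uxxy q + uxx q ^+ 2) + uxx q * uxy q)) / uxx q ^+ 4.

Definition theta3 (k : R) : oneform := fun q =>
  (uxxx q ^+ 2 / uxx q ^+ 4) *:
  ((8^-1 * (k - 4) * uxx q) *: vtheta0 q + ux q *: vtheta2 q + vtheta3 k q).

Definition xi2 (k : R) : oneform := fun q =>
  (uxxx q / uxx q) *:
  ((2^-1 * (k + 1) * ux q ^+ 2 - uy q) *: d_ i_t + d_ i_x - ux q *: d_ i_y).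

Definition xi3 (k : R) : oneform := fun q =>
  (- (k + 2) * ux q * uxx q) *: d_ i_t + uxx q *: d_ i_y.

Definition eta1 (k : R) : oneform := fun q =>
  (2 / uxxx q) *: d_ i_uxxx - 3 *: (theta22 q + xi2 k q)
  - ((2 * uxx q ^+ 3)^-1 *
     (3 * invV k q * uxx q ^+ 3
      - 4 * (k + 3) * (ux q * uxx q + uxy q) * uxxx q)) *: xi1 q
  - (3 * invU q + 8^-1 * (k - 4)) *: xi3 k q.

Definition mc_forms (k : R) : set oneform :=
  [set theta0; theta2; theta3 k; theta22; xi1; xi2 k; xi3 k; eta1 k].

(** ** Forms and invariant for kappa = -1 *)

Definition invU' (q : space) : R :=
  (uxxx q * (ux q * uxxy q - utxx q - uy q * uxxx q - uxy q * uxx q)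
   + uxxy q * (uxxy q + uxx q ^+ 2)) / uxx q ^+ 4 - 33 / 64.

Definition theta3' : oneform := fun q =>
  (uxxx q / (8 * uxx q ^+ 4)) *:
  ((8 * uxxx q) *: vtheta3 (-1) q - (5 * uxx q * uxxx q) *: vtheta0 q
   - (8 * uxxy q - 3 * uxx q ^+ 2) *: vtheta2 q).

Definition xi2' : oneform := fun q =>
  ((uxx q * uxxx q)^-1 *
   (uxxy q * (uxxy q - 3 / 4 * uxx q ^+ 2)
    + uxxx q * (ux q * uxxy q - uy q * uxxx q)
    - 3 / 64 * uxx q ^+ 2 * (8 * ux q * uxxx q - 3 * uxx q ^+ 2))) *: d_ i_t
  + (uxxx q / uxx q) *: d_ i_x
  + ((8 * uxxy q - 3 * uxx q ^+ 2) / (8 * uxx q)) *: d_ i_y.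

Definition xi3' : oneform := fun q =>
  (uxx q / (4 * uxxx q) *
   (8 * uxxy q + 4 * ux q * uxxx q - 3 * uxx q ^+ 2)) *: d_ i_t
  + uxx q *: d_ i_y.

Definition eta1' : oneform := fun q =>
  (2 / uxxx q) *: d_ i_uxxx - 3 *: (theta22 q + xi2' q)
  + ((2 * uxx q ^+ 3)^-1 *
     ((4 * invU' q + 3) * uxx q ^+ 3
      + 8 * (uxy q * uxxx q - uxx q * uxxy q))) *: xi1 q
  - 2^-1 *: xi3' q.

(* eta_2 is only known through the structure equations, which determine it since
   xi^1 and xi^3 are linearly independent. *)
Definition is_eta2 (e2 : oneform) : Prop :=
  smooth_map generic e2 /\
  forall q, generic q ->
    dext xi2' q =
      - (8^-1 *: ((5 *: theta0 q + 8 *: theta3' q) ⋀ xi1 q))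
      + 8^-1 *: ((4 *: (eta1' q + theta22 q) + 3 *: xi3' q) ⋀ xi2' q)
      - (e2 q + theta2 q) ⋀ xi3' q
    /\
    dext xi3' q =
      - ((2 *: e2 q + theta2 q) ⋀ xi1 q)
      + (theta22 q + invU' q *: xi1 q + xi2' q) ⋀ xi3' q.

Definition mc_forms' (e2 : oneform) : set oneform :=
  [set theta0; theta2; theta3'; theta22; xi1; xi2'; xi3'; eta1'; e2].

(** ** The systems *)

(* omega_0 and omega_1 are new forms: together with the differentials of the 19
   base coordinates they form a coframe of the extended space. *)
Definition new_forms (N : set space) (w0 w1 : oneform) : Prop :=
  [/\ smooth_map N w0, smooth_map N w1 &
      forall q, N q ->
        row_free (col_mx (rsubmx (w0 q) : 'rV[R]_2) (rsubmx (w1 q) : 'rV[R]_2))].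

Definition sol1 (k : R) (N : set space) (w0 : oneform) : Prop :=
  exists w1 : oneform,
    new_forms N w0 w1 /\
    forall q, N q ->
      dext w0 q =
        (w1 q + 2^-1 *: (eta1 k q + theta22 q) + (4^-1 * invV k q) *: xi1 q
         + (16^-1 * (8 * invU q + k + 12)) *: xi3 k q) ⋀ w0 q
        + w1 q ⋀ xi2 k q + theta2 q ⋀ xi3 k q
        - ((8^-1 * (k - 4)) *: theta0 q - theta3 k q) ⋀ xi1 q.

(* W is required not to vanish: W = 0 satisfies the second equation and turns the
   first one into the equation of [sol1].
   The factor 2 in 2 (kappa + 1) omega_1 is forced: W = (u_xxx / u_xx^2) v_x^(kappa+1)
   and omega_1 = - dv_x / v_x + ... along [omega2] below. *)
Definition sol2 (k : R) (N : set space) (w0 : oneform) : Prop :=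
  exists (w1 : oneform) (W : space -> R),
    [/\ new_forms N w0 w1, smooth N W, (forall q, N q -> W q != 0) &
    forall q, N q ->
      dext w0 q =
        (w1 q + 2^-1 *: (eta1 k q + theta22 q)
         + (4^-1 * (invV k q - 2 * W q * (W q - 2))) *: xi1 q
         + (16^-1 * (8 * (invU q - W q) + k + 12)) *: xi3 k q) ⋀ w0 q
        + (W q ^+ 2 *: w1 q - (8^-1 * (k - 4)) *: theta0 q
           + W q *: theta2 q + theta3 k q) ⋀ xi1 q
        + w1 q ⋀ xi2 k q + (W q *: w1 q + theta2 q) ⋀ xi3 k q
      /\
      grad W q =
        (16^-1 * W q) *:
        (8 *: (eta1 k q - theta22 q - k *: w0 q - (2 * (k + 1)) *: w1 q)
         - (4 * (invV k q - 2 * W q * (W q - 2 * (k + 1)))) *: xi1 q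
         - (8 * (invU q - W q) + 5 * (3 * k + 4)) *: xi3 k q)].

(* used for kappa = -3; W = 0 again reduces to the equation of [sol1], with omega_1
   replaced by omega_1 + 3/2 xi^2.  The coefficient of xi^1 in dW / W has no further
   factor W: along [omega3] below W = 1 / (u_xx v_x). *)
Definition sol3 (k : R) (N : set space) (w0 : oneform) : Prop :=
  exists (w1 : oneform) (W : space -> R),
    [/\ new_forms N w0 w1, smooth N W, (forall q, N q -> W q != 0) &
    forall q, N q ->
      dext w0 q =
        (w1 q + 2^-1 *: (eta1 k q + theta22 q) + (4^-1 * invV k q) *: xi1 q
         + (3 / 2) *: xi2 k q
         + (16^-1 * (8 * (invU q + 2 * W q) + 9)) *: xi3 k q) ⋀ w0 q
        + ((W q + 7 / 8) *: theta0 q + theta3 k q) ⋀ xi1 q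
        + w1 q ⋀ xi2 k q + theta2 q ⋀ xi3 k q
      /\
      grad W q =
        W q *: (w1 q - theta22 q - (2^-1 * invV k q) *: xi1 q
                - (invU q - W q - 1) *: xi3 k q)].

(* In dW only eta_1 - theta_22 is multiplied by W / 2: along [omega4] below
   W is lambda u_xxx / u_xx^2 plus a function that does not involve lambda, and
   the xi^2, xi^3 terms of dW do not vanish with W. *)
Definition sol4 (e2 : oneform) (N : set space) (w0 : oneform) : Prop :=
  exists (w1 : oneform) (W : space -> R),
    [/\ new_forms N w0 w1, smooth N W &
    forall q, N q ->
      dext w0 q =
        (w1 q + 2^-1 *: (eta1' q + theta22 q - (W q * (W q - 2)) *: xi1 q)
         - (8^-1 * (4 * W q - 7)) *: xi3' q) ⋀ w0 q
        + (W q ^+ 2 *: w1 q + (5 / 8) *: theta0 q + W q *: theta2 q + theta3' q)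
            ⋀ xi1 q
        + w1 q ⋀ xi2' q + (W q *: w1 q + theta2 q) ⋀ xi3' q
      /\
      grad W q =
        e2 q + (invU' q * W q) *: xi1 q
        + 2^-1 *: (W q *: (eta1' q - theta22 q) - (W q + 1) *: xi2' q
                   + (2 * invU' q - W q) *: xi3' q)].

(** ** The solutions *)

(* a ^ r for real r and a <> 0; defined for a > 0, or a < 0 and r an integer *)
Definition rpow (a r : R) : R := if 0 < a then powR a r else a ^ Num.floor r.

Definition vx_nonzero : set space := [set q | generic q /\ vx q != 0].
Definition vx_positive : set space := [set q | generic q /\ 0 < vx q].
Definition vx_powers (k : R) : set space :=
  [set q | generic q /\ (0 < vx q \/ vx q < 0 /\ k \is a Num.int)].

Definition omega1 (k : R) : oneform := fun q =>
  (uxxx q / (uxx q * vx q)) *: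
  (d_ i_v - ((2^-1 * (k + 1) * ux q ^+ 2 - uy q) * vx q) *: d_ i_t
   - vx q *: d_ i_x + (ux q * vx q) *: d_ i_y).

Definition omega2 (k : R) : oneform := fun q =>
  (uxxx q / (uxx q * vx q)) *:
  (d_ i_v
   - (((2 * k + 3)^-1 * rpow (vx q) (2 * (k + 1)) - ux q * rpow (vx q) (k + 1)
       + 2^-1 * (k + 1) * ux q ^+ 2 - uy q) * vx q) *: d_ i_t
   - vx q *: d_ i_x
   - (((k + 2)^-1 * rpow (vx q) (k + 1) - ux q) * vx q) *: d_ i_y).

(* kappa = -2 *)
Definition omega2_m2 : oneform := fun q =>
  (uxxx q / (uxx q * vx q)) *:
  (d_ i_v
   + ((vx q)^-1 + ux q + (2^-1 * ux q ^+ 2 + uy q) * vx q) *: d_ i_t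
   - (ln `|vx q| - ux q * vx q) *: d_ i_y - vx q *: d_ i_x).

(* kappa = -3/2; solves the system for v_x > 0 only: for v_x < 0 the sign of the
   logarithm would have to be reversed. *)
Definition omega2_m32 : oneform := fun q =>
  (uxxx q / (uxx q * vx q)) *:
  (d_ i_v
   + ((4^-1 * ux q ^+ 2 + uy q) * vx q + ux q * Num.sqrt `|vx q|
      - ln `|vx q|) *: d_ i_t
   + (ux q * vx q - 2 * Num.sqrt `|vx q|) *: d_ i_y - vx q *: d_ i_x).

Definition omega3 : oneform := fun q =>
  (uxxx q / (uxx q * vx q)) *:
  (d_ i_v + (u_ q + (ux q ^+ 2 + uy q) * vx q) *: d_ i_t
   - vx q *: d_ i_x + (vx q * ux q + x_ q) *: d_ i_y).

Definition omega4 (lambda : R) : oneform := fun q =>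
  (uxxx q / (uxx q * vx q)) *:
  (d_ i_v + (vx q * (uy q + lambda * ux q - lambda ^+ 2)) *: d_ i_t
   - vx q *: d_ i_x + (vx q * (ux q - lambda)) *: d_ i_y).

(** ** Contact equivalence *)

(* Near q, w0 is the pullback of w (considered on D) by a local diffeomorphism of
   the extended space which covers a local diffeomorphism of the base and preserves
   the forms in mc. *)
Definition contact_equiv_at (mc : set oneform) (D : set space) (w : oneform)
    (q : space) (w0 : oneform) : Prop :=
  exists (M : set space) (F : space -> space) (f : base -> base),
    [/\ M q, diffeo M (F @` M) F /\ F @` M `<=` D,
        diffeo (projb @` M) (f @` (projb @` M)) f /\
          (forall x, M x -> projb (F x) = f (projb x)),
        (forall a, mc a -> forall x, M x -> pullback F a x = a x) &
        (forall x, M x -> pullback F w x = w0 x)].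

(* The forms [w i] on D are solutions, and every solution is near every point
   contact equivalent to one of them. *)
Definition solutions_up_to_contact (I : Type)
    (sol : set space -> oneform -> Prop) (mc : set oneform)
    (D : set space) (w : I -> oneform) : Prop :=
  (forall i, sol D (w i)) /\
  forall (N : set space) (w0 : oneform),
    open N -> N `<=` generic -> sol N w0 ->
    forall q, N q -> exists i, contact_equiv_at mc D (w i) q w0.

End Equation.

(* Main.v *)
Require Import Defs.
From HB Require Import structures.
From mathcomp Require Import all_boot all_order all_algebra.
From mathcomp Require Import all_classical all_reals all_analysis.
From mathcomp Require Import perm ring lra.

Set Implicit Arguments.
Unset Strict Implicit.
Unset Printing Implicit Defensive.

Import Order.TTheory GRing.Theory Num.Theory.
Import numFieldNormedType.Exports.

Local Open Scope classical_set_scope.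
Local Open Scope ring_scope.

(** In systems 1) and 4) there is a form chi of the base with d chi = alpha /\ chi up to
    the terms of the system without omega_0 and omega_1, so that the system says
    d(omega_0 + chi) = (omega_1 + alpha) /\ (omega_0 + chi).  By the Frobenius theorem
    omega_0 + chi = f dv locally, and v and v_x = u_xxx / (u_xx f) are the new coordinates.
    In system 4) chi = xi^2 + W xi^3 + W^2 xi^1, and the equation for dW says that
    W = lambda u_xxx / u_xx^2 + W_0 with lambda locally constant.
    In systems 2) and 3) W itself determines v_x: W = +- (u_xxx / u_xx^2) v_x^(kappa + 1),
    respectively W = 1 / (u_xx v_x); solving the equation for dW for omega_1 shows that
    (u_xx v_x / u_xxx) omega_0 plus an explicit form in v_x and the base coordinates is
    closed, hence equal to dv by the Poincare lemma.  The sign - is removed by reversing t and x.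
    The functions v, v_x are independent along the fibres because the fibre component of
    d omega_0 is that of omega_1 /\ omega_0, which does not vanish. *)

(** * Smooth functions *)

(** The Frobenius theorem needs leaves that depend smoothly on their end points, which in general
    takes a hierarchy of variational equations. It is avoided here: leaves are followed along
    segments issuing from p, uniqueness identifies the leaf stopped at an intermediate time with the
    leaf to an intermediate point, and so the first derivatives of the end value S become smooth
    expressions in S itself. Hence C^k gives C^(k+1), and only one linearized equation has to be
    solved. In system 2 the formulas for the various kappa are one formula: with p = v_x^(kappa+1),
    the coefficients of dt and dy contain primitives of p^2 and of p, and kappa = -3/2, -2 are the
    values for which one of these is a logarithm. The reversal of t and x fixes u_xx and changes the
    sign of u_xxx, hence that of W u_xx^2 / u_xxx. The structure equations are formal identities:
    with the coordinates and the entries of the coordinate differentials replaced by variables they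
    are equalities of rational functions, checked for all pairs of indices at once. *)

Section ClassC.
Context {R : realType}.
Implicit Types m n k : nat.

Lemma continuous_dist (V W : normedModType R) (f : V -> W) (q : V) :
  {for q, continuous f} <->
  forall e : R, 0 < e ->
    exists2 r : R, 0 < r & forall x, `|x - q| < r -> `|f x - f q| < e.
Proof.
split=> [/cvgrPdist_lt H e /H/nbhs_ballP[r /= r0 rH]|H].
  exists r => // x xr; rewrite distrC; apply: rH.
  by rewrite -ball_normE /ball_ /= distrC.
apply/cvgrPdist_lt => e /H[r r0 rH]; apply/nbhs_ballP; exists r => //= x.
by rewrite -ball_normE /ball_ /= distrC => /rH; rewrite distrC.
Qed.

Lemma class_C_S k m (N : set 'rV[R]_m) f : class_C k.+1 N f -> class_C k N f.
Proof.
elim: k f => [|k IH] f [fc fd]; split => // i.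
by have [fi pC] := fd i; split => //; exact: IH.
Qed.

Lemma class_C_sub k m (M N : set 'rV[R]_m) f :
  M `<=` N -> class_C k N f -> class_C k M f.
Proof.
move=> MN; elim: k f => [|k IH] f [fc fd]; split => //.
- by move=> q /MN; exact: fc.
- by move=> q /MN; exact: fc.
- move=> i; have [fi pC] := fd i.
  by split; [move=> q /MN; exact: fi|exact: IH].
Qed.

(** The derivatives in [class_C] are those of the total function, so its conditions are pointwise
    and pass to unions of sets. This serves [rpow], whose closed form depends on the sign of
    [v_x]. *)
Lemma class_C_local k m (N : set 'rV[R]_m) f :
  (forall q, N q -> exists M, M q /\ class_C k M f) -> class_C k N f.
Proof.
elim: k f => [|k IH] f H; split => //.
- by move=> q /H [M [Mq [fc _]]]; exact: fc.
- by move=> q /H [M [Mq [fc _]]]; exact: fc.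
- move=> i; split.
    by move=> q /H [M [Mq [_ fd]]]; exact: (fd i).1.
  by apply: IH => q /H [M [Mq [_ fd]]]; exists M; split => //; exact: (fd i).2.
Qed.

Lemma class_C_eq k m (N : set 'rV[R]_m) f g : open N ->
  (forall q, N q -> f q = g q) -> class_C k N f -> class_C k N g.
Proof.
move=> oN; have near_eq (h1 h2 : 'rV[R]_m -> R) :
    (forall q, N q -> h1 q = h2 q) -> forall q, N q -> \near q, h1 q = h2 q.
  move=> H q Nq; have := open_nbhs_nbhs (conj oN Nq).
  by apply: filterS => x; exact: H.
have cont_eq (h1 h2 : 'rV[R]_m -> R) : (forall q, N q -> h1 q = h2 q) ->
    (forall q, N q -> {for q, continuous h1}) ->
    forall q, N q -> {for q, continuous h2}.
  move=> H hc q Nq; rewrite /prop_for /continuous_at -(H _ Nq).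
  apply: cvg_trans (hc _ Nq).
  have FF : Filter (nbhs q) := @nbhs_filter 'rV[R]_m q.
  exact: near_eq_cvg (near_eq _ _ H _ Nq).
elim: k f g => [|k IH] f g fg [fc fd].
  by split => //; exact: cont_eq fg fc.
split; first exact: cont_eq fg fc.
move=> i; have [fi pC] := fd i; split.
  move=> q Nq; apply: near_eq_derivable (fi _ Nq); exact: near_eq.
apply: IH pC => q Nq; rewrite /partial; apply: near_eq_derive; exact: near_eq.
Qed.

Lemma is_derive_line m (f : 'rV[R]_m -> R) (p v : 'rV[R]_m) (t d : R) :
  is_derive (p + t *: v) v f d -> is_derive t 1 (fun s => f (p + s *: v)) d.
Proof.
have E : (fun h : R => h^-1 *: (f (p + (h *: 1 + t) *: v) - f (p + t *: v))) =
         (fun h : R => h^-1 *: (f (h *: v + (p + t *: v)) - f (p + t *: v))).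
  by apply/funext => h; rewrite scalerDl addrCA -[h *: 1]/(h * 1) mulr1.
by case=> fd <-; split; rewrite /derivable /derive /= E.
Qed.

(** Parametrizing the segment by t in [0, 1] covers h of either sign and h = 0. *)
Lemma line_MVT m (f : 'rV[R]_m -> R) (p v : 'rV[R]_m) (h : R) :
  (forall t : R, 0 <= t <= 1 -> derivable f (p + (t * h) *: v) v) ->
  exists2 t : R, 0 <= t <= 1 & f (p + h *: v) - f p = h * 'D_v f (p + (t * h) *: v).
Proof.
move=> H.
have D (t : R) : 0 <= t <= 1 ->
    is_derive t 1 (fun s => f (p + (s * h) *: v)) (h * 'D_v f (p + (t * h) *: v)).
  move=> t01.
  have H1 := is_derive_line (derivableP (H t t01)).
  have H2 : is_derive t 1 (fun s : R => s * h) h.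
    by apply: is_derive_eq; rewrite scaler0 add0r -[h *: 1]/(h * 1) mulr1.
  have -> : (fun s => f (p + (s * h) *: v)) = (fun s => f (p + s *: v)) \o (fun s => s * h) by [].
  have := @is_derive1_comp R (fun s => f (p + s *: v)) (fun s => s * h) t _ _ H1 H2.
  by rewrite mulrC.
have [||c c01] := @MVT_segment R (fun s => f (p + (s * h) *: v))
   (fun t => h * 'D_v f (p + (t * h) *: v)) 0 1 ler01.
- by move=> x; rewrite in_itv /= => /andP[x0 x1]; apply: D; rewrite !ltW.
- apply: derivable_within_continuous => x; rewrite in_itv /= => x01.
  by have [] := D x x01.
rewrite mul0r scale0r addr0 mul1r subr0 mulr1 => ->.
by exists c => //; rewrite in_itv in c01.
Qed.

Lemma row_norm_le m (x : 'rV[R]_m) (e : R) :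
  0 <= e -> (`|x| <= e) <-> (forall i, `|x 0 i| <= e).
Proof.
move=> e0; have -> : `|x| = \big[Num.max/0]_(j : 'I_1 * 'I_m) `|x j.1 j.2|.
  by rewrite /Num.Def.normr /= mx_normrE.
split.
  move=> H i; apply: le_trans H.
  exact: (le_bigmax _ (fun j : 'I_1 * 'I_m => `|x j.1 j.2|) (0, i)).
by move=> H; apply: bigmax_le => // -[i j] _; rewrite (ord1 i).
Qed.

Lemma row_norm_lt m (x : 'rV[R]_m) (e : R) :
  0 < e -> (`|x| < e) <-> (forall i, `|x 0 i| < e).
Proof.
move=> e0; have -> : `|x| = \big[Num.max/0]_(j : 'I_1 * 'I_m) `|x j.1 j.2|.
  by rewrite /Num.Def.normr /= mx_normrE.
split.
  move=> H i; apply: le_lt_trans H.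
  exact: (le_bigmax _ (fun j : 'I_1 * 'I_m => `|x j.1 j.2|) (0, i)).
by move=> H; apply: bigmax_lt => // -[i j] _; rewrite (ord1 i).
Qed.

Lemma row_coord_le m (x : 'rV[R]_m) i : `|x 0 i| <= `|x|.
Proof. by have /row_norm_le := lexx `|x|; apply. Qed.

Lemma row_ballP m (p q : 'rV[R]_m) (r : R) : 0 < r ->
  ball p r q <-> (forall i, `|q 0 i - p 0 i| < r).
Proof.
move=> r0; rewrite -ball_normE /ball_ /= distrC row_norm_lt//.
by split => H i; have := H i; rewrite !mxE.
Qed.

(* The increment of f is telescoped along the edges of a box. *)
Lemma increment_telescope m (f : 'rV[R]_m -> R) (p h : 'rV[R]_m) :
  (forall x, `|x - p| <= `|h| -> forall i, derivable f x (delta_mx 0 i)) ->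
  exists xi : 'I_m -> 'rV[R]_m, (forall i, `|xi i - p| <= `|h|) /\
    f (p + h) - f p = \sum_i h 0 i * partial i f (xi i).
Proof.
move=> H.
(* [P k] has its first k coordinates already moved from p to p + h. The norm is the sup norm, so all
   edges stay within distance |h| of p. *)
pose P k : 'rV[R]_m := p + \row_i (if (i < k)%N then h 0 i else 0).
have P0 : P 0%N = p by rewrite /P; apply/rowP => i; rewrite !mxE ltn0 addr0.
have Pm : P m = p + h by rewrite /P; apply/rowP => i; rewrite !mxE ltn_ord.
have PS (k : 'I_m) : P k.+1 = P k + h 0 k *: delta_mx 0 k.
  rewrite /P -addrA; congr (_ + _); apply/rowP => i; rewrite !mxE eqxx /=.
  rewrite ltnS leq_eqVlt -val_eqE /=.
  case: (ltngtP i k) => // [ik|ki|/val_inj ->]; rewrite ?mulr0 ?addr0 ?mulr1 ?add0r//.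
have step (k : 'I_m) : exists x, `|x - p| <= `|h| /\
    f (P k.+1) - f (P k) = h 0 k * partial k f x.
  rewrite PS.
  have inb (t : R) : 0 <= t <= 1 -> `|P k + (t * h 0 k) *: delta_mx 0 k - p| <= `|h|.
    move=> /andP[t0 t1]; apply/row_norm_le => // i.
    rewrite /P !mxE eqxx /= addrAC [p 0 i + _]addrC addrK -[i == k]val_eqE /=.
    case: (ltngtP i k) => [ik|ki|/val_inj E]; rewrite ?E.
    + by rewrite mulr0 addr0 row_coord_le.
    + by rewrite mulr0 addr0 normr0.
    + rewrite mulr1 add0r normrM (ger0_norm t0).
      by rewrite (le_trans _ (row_coord_le h k))// ler_piMl.
  have [t t01 ->] := @line_MVT m f (P k) (delta_mx 0 k) (h 0 k)
     (fun t t01 => H _ (inb t t01) k).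
  by exists (P k + (t * h 0 k) *: delta_mx 0 k); split; [exact: inb|].
exists (fun k : 'I_m => sval (cid (step k))); split.
  by move=> i; case: cid => x [].
rewrite -Pm -[X in _ - f X]P0 -(@telescope_sumr _ 0 m (f \o P) (leq0n m)) big_mkord; apply: eq_bigr => k _.
by case: cid => x [].
Qed.

(** The hypothesis says that the increment is o(h): the expansion holds with the zero map, which
    [diff_unique] identifies with the differential. *)
Lemma differentiable_flat (V W : normedModType R) (F : V -> W) (x : V) :
  (forall e : R, 0 < e -> \forall h \near 0, `|F (h + x) - F x| <= e * `|h|) ->
  differentiable F x.
Proof.
move=> H.
have lo : F \o shift x = cst (F x) + (\0 : V -> W) +o_ 0 id.
  apply/eqaddoP => e e0; have := H e e0.
  by apply: filterS => h /=; rewrite !fctE /= addr0.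
have c0 : continuous (\0 : V -> W) by exact: cst_continuous.
by apply/diff_locallyP; rewrite (diff_unique c0 lo).
Qed.

(** Minus its candidate differential g, the function f is flat at q: [increment_telescope] turns the
    increment of the difference into differences of partial derivatives, which are continuous. *)
Lemma class_C1_differentiable m (N : set 'rV[R]_m) f q :
  open N -> class_C 1 N f -> N q -> differentiable f q.
Proof.
move=> oN [fc fd] Nq.
pose g (x : 'rV[R]_m) := \sum_i partial i f q * x 0 i.
have dg : differentiable g q.
  rewrite (_ : g = \sum_i (fun x : 'rV[R]_m => partial i f q *: x 0 i)).
    apply: differentiable_sum => i; apply: differentiableZ.
    exact: differentiable_coord.
  by apply/funext => x; rewrite fct_sumE.
pose F : 'rV[R]_m -> R^o := f - g.
suff dF : differentiable F q.
  by have := differentiableD dF dg; rewrite subrK.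
apply: differentiable_flat => _/posnumP[e].
(* Each of the m edges contributes at most e / (m + 1) times |h|; m + 1 in place of m also covers m
   = 0. *)
have e0 : 0 < e%:num / (m.+1%:R) by rewrite divr_gt0.
  have [r r0 rH] : exists2 r : R, 0 < r & forall x, `|x - q| < r -> N x /\
      forall i, `|partial i f x - partial i f q| <= e%:num / m.+1%:R.
    have /nbhs_ballP[r /= r0 rN] : \forall x \near q, N x /\
        forall i, `|partial i f x - partial i f q| <= e%:num / m.+1%:R.
      have FF : Filter (nbhs q) := @nbhs_filter 'rV[R]_m q.
      apply: filterI; first exact: open_nbhs_nbhs.
      apply: (@filter_forall _ _ (fun i x => `|partial i f x - partial i f q| <= e%:num / m.+1%:R) _ FF) => i.
      have /cvgrPdist_le/(_ _ e0) := ((fd i).2.1 _ Nq).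
      by apply: filterS => x; rewrite distrC.
    exists r => // x xr; apply: rN; rewrite -ball_normE /ball_ /= distrC //.
  near=> h.
  have hr : `|h| < r.
    near: h; apply/nbhs_ballP; exists r => //= x.
    by rewrite -ball_normE /ball_ /= sub0r normrN.
  have [|xi [xiH E]] := @increment_telescope m f q h.
    move=> x xh i; apply: (fd i).1; exact: (rH _ (le_lt_trans xh hr)).1.
  rewrite /F /= !fctE /= /g [h + q]addrC.
  rewrite (_ : _ - _ = (f (q + h) - f q) -
      \sum_i partial i f q * h 0 i); last first.
    under [X in _ - X - _]eq_bigr do rewrite mxE mulrDr.
    by rewrite big_split /=; ring.
  rewrite E -sumrB.
  apply: le_trans (ler_norm_sum _ _ _) _.
  apply: (@le_trans _ _ (\sum_(i < m) (e%:num / m.+1%:R * `|h|))).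
    apply: ler_sum => i _; rewrite [partial i f q * _]mulrC -mulrBr normrM mulrC.
    apply: ler_pM => //; last exact: row_coord_le.
    exact: ((rH _ (le_lt_trans (xiH i) hr)).2 i).
  rewrite sumr_const card_ord -[leLHS]mulr_natr.
  rewrite (_ : _ * m%:R = (e%:num * `|h|) * (m%:R / m.+1%:R)); last by ring.
  apply: ler_piMr; first exact: mulr_ge0.
  by rewrite ler_pdivrMr ?mul1r ?ltr0n// ler_nat.
Unshelve. all: by end_near. Qed.

End ClassC.

(** * Operations on smooth functions *)

Section Closure.
Context {R : realType}.
Implicit Types m n k : nat.

Lemma is_derive_of_line m (f : 'rV[R]_m -> R) (p v : 'rV[R]_m) (d : R) :
  is_derive (0 : R) 1 (fun s => f (p + s *: v)) d -> is_derive p v f d.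
Proof.
have E : (fun h : R => h^-1 *: (f (p + (h *: 1 + 0) *: v) - f (p + 0 *: v))) =
         (fun h : R => h^-1 *: (f (h *: v + p) - f p)).
  by apply/funext => h; rewrite scale0r !addr0 [p + _]addrC -[h *: 1]/(h * 1) mulr1.
by case=> fd <-; move: fd; rewrite /derivable /derive /= E => fd; split.
Qed.

Lemma is_derive_comp1 m (f : 'rV[R]_m -> R) (phi : R -> R) (q v : 'rV[R]_m) (d e : R) :
  is_derive (f q) 1 phi e -> is_derive q v f d ->
  is_derive q v (fun x => phi (f x)) (e * d).
Proof.
move=> He Hd; apply: is_derive_of_line.
have Hl : is_derive (0 : R) 1 (fun s => f (q + s *: v)) d.
  by apply: is_derive_line; rewrite scale0r addr0.
apply: (@is_derive1_comp R phi (fun s => f (q + s *: v)) 0 _ _ _ Hl).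
by rewrite scale0r addr0.
Qed.

Lemma is_derive_coord m (j : 'I_m) (q v : 'rV[R]_m) :
  is_derive q v (fun x : 'rV[R]_m => x 0 j) (v 0 j).
Proof.
have D := @derivable_id R 'rV[R]_m q v.
split; first by have /derivable_mxP := D; apply.
have /matrixP/(_ 0 j) := derive_mx D.
by rewrite derive_id mxE.
Qed.

Lemma partial_local m (N : set 'rV[R]_m) f g (i : 'I_m) q : open N -> N q ->
  (forall x, N x -> f x = g x) -> partial i f q = partial i g q.
Proof.
move=> oN Nq fg; apply: near_eq_derive.
by have := open_nbhs_nbhs (conj oN Nq); apply: filterS => x; exact: fg.
Qed.

Lemma class_C_cst k m (N : set 'rV[R]_m) c : class_C k N (fun _ => c).
Proof.
elim: k c => [|k IH] c; split => //; try by move=> q _; exact: cst_continuous.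
move=> i; split; first by move=> q _; exact: derivable_cst.
rewrite (_ : partial _ _ = fun _ => 0)//.
by apply/funext => q; exact: derive_cst.
Qed.

Lemma class_C_coord k m (N : set 'rV[R]_m) j : class_C k N (fun q => q 0 j).
Proof.
have c : forall q : 'rV[R]_m, {for q, continuous (fun q : 'rV[R]_m => q 0 j)}.
  by move=> q; exact: coord_continuous.
case: k => [|k]; split => // i; split.
  by move=> q _; have [] := is_derive_coord j q (delta_mx 0 i).
rewrite (_ : partial _ _ = fun _ => (delta_mx 0 i : 'rV[R]_m) 0 j); first exact: class_C_cst.
by apply/funext => q; rewrite /partial; have [_ ->] := is_derive_coord j q (delta_mx 0 i).
Qed.

Variables (m : nat) (N : set 'rV[R]_m).
Hypothesis oN : open N.

Lemma class_CD k f g : class_C k N f -> class_C k N g ->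
  class_C k N (fun x => f x + g x).
Proof.
elim: k f g => [|k IH] f g [fc fd] [gc gd].
  by split => // q Nq; apply: continuousD; [exact: fc|exact: gc].
split; first by move=> q Nq; apply: continuousD; [exact: fc|exact: gc].
move=> i; split.
  by move=> q Nq; apply: derivableD; [exact: (fd i).1|exact: (gd i).1].
apply: class_C_eq (IH _ _ (fd i).2 (gd i).2) => // q Nq.
by rewrite /partial; apply/esym/deriveD; [exact: (fd i).1|exact: (gd i).1].
Qed.

Lemma class_CM k f g : class_C k N f -> class_C k N g ->
  class_C k N (fun x => f x * g x).
Proof.
elim: k f g => [|k IH] f g Hf Hg; have [fc fd] := Hf; have [gc gd] := Hg.
  by split => // q Nq; apply: continuousM; [exact: fc|exact: gc].
split; first by move=> q Nq; apply: continuousM; [exact: fc|exact: gc].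
move=> i; split.
  by move=> q Nq; apply: derivableM; [exact: (fd i).1|exact: (gd i).1].
have := class_CD (IH _ _ (class_C_S Hf) (gd i).2) (IH _ _ (class_C_S Hg) (fd i).2).
apply: class_C_eq => // q Nq.
by rewrite /partial; apply/esym/deriveM; [exact: (fd i).1|exact: (gd i).1].
Qed.

Lemma class_C_sum k (I : Type) (r : seq I) (P : pred I) (F : I -> 'rV[R]_m -> R) :
  (forall i, P i -> class_C k N (F i)) ->
  class_C k N (fun x => \sum_(i <- r | P i) F i x).
Proof.
move=> H; elim: r => [|a r IH].
  by under eq_fun do rewrite big_nil; exact: class_C_cst.
under eq_fun do rewrite big_cons.
by case Pa: (P a) => //; apply: class_CD IH; exact: H.
Qed.

(** Induction step shared by the inverse, the exponential and the logarithm: their derivative psi is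
    a polynomial in phi or already known to be smooth. *)
Lemma class_C_comp1S k (phi psi : R -> R) (f : 'rV[R]_m -> R) :
  (forall q, N q -> is_derive (f q) 1 phi (psi (f q))) ->
  class_C k N (fun x => psi (f x)) -> class_C k.+1 N f ->
  class_C k.+1 N (fun x => phi (f x)).
Proof.
move=> H Hp Hf; have [fc fd] := Hf; split.
  move=> q Nq; apply: (@continuous_comp _ _ _ f phi); first exact: fc.
  apply: differentiable_continuous; apply/derivable1_diffP.
  by have [] := H _ Nq.
have D i q : N q -> is_derive q (delta_mx 0 i) (fun x => phi (f x)) (psi (f q) * partial i f q).
  by move=> Nq; apply: is_derive_comp1; [exact: H|apply/derivableP; exact: (fd i).1].
move=> i; split; first by move=> q Nq; have [] := D i q Nq.
have := class_CM Hp (fd i).2; apply: class_C_eq => // q Nq.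
by rewrite /partial; have [_ ->] := D i q Nq.
Qed.

Lemma class_CV k f : (forall q, N q -> f q != 0) -> class_C k N f ->
  class_C k N (fun x => (f x)^-1).
Proof.
elim: k f => [|k IH] f f0 Hf; have [fc fd] := Hf.
  by split => // q Nq; apply: continuousV; [exact: f0|exact: fc].
apply: (@class_C_comp1S _ (fun x => x^-1) (fun x => - 1 * (x^-1 * x^-1))) => //.
  move=> q Nq; have fq0 := f0 _ Nq.
  have := @is_deriveV R id (f q) 1 1 fq0 (is_derive_id _ _).
  by move=> H; apply: is_derive_eq H _; rewrite -[_ *: 1]/(_ * 1) mulr1 -exprVn expr2 mulN1r.
have Hi := IH _ f0 (class_C_S Hf).
by apply: class_CM; [exact: class_C_cst|exact: class_CM].
Qed.

Lemma class_C_expR k f : class_C k N f -> class_C k N (fun x => expR (f x)).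
Proof.
elim: k f => [|k IH] f Hf; have [fc fd] := Hf.
  by split => // q Nq; apply: (@continuous_comp _ _ _ f); [exact: fc|exact: continuous_expR].
apply: (@class_C_comp1S _ (@expR R) (@expR R)) => //.
exact/IH/class_C_S.
Qed.

Lemma class_C_ln k f : (forall q, N q -> 0 < f q) -> class_C k N f ->
  class_C k N (fun x => ln (f x)).
Proof.
case: k => [|k] f0 Hf; have [fc fd] := Hf.
  split => // q Nq; apply: (@continuous_comp _ _ _ f); first exact: fc.
  exact/continuous_ln/f0.
apply: (@class_C_comp1S _ (@ln R) (fun x => x^-1)) => //.
  by move=> q Nq; exact/is_derive1_ln/f0.
by apply: class_CV (class_C_S Hf) => q Nq; rewrite gt_eqF ?f0.
Qed.

End Closure.

(** * Chain rule and composition *)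

Section Chain.
Context {R : realType}.

Lemma row_continuous (V : normedModType R) n (G : V -> 'rV[R]_n) q :
  (forall j, {for q, continuous (fun x => G x 0 j)}) -> {for q, continuous G}.
Proof.
move=> H; apply/continuous_dist => e e0.
have FF : Filter (nbhs q) := nbhs_filter q.
have /nbhs_ballP[r /= r0 rH] : \forall x \near q, forall j, `|G x 0 j - G q 0 j| < e.
  apply: (@filter_forall _ _ (fun j x => `|G x 0 j - G q 0 j| < e) _ FF) => j.
  have /continuous_dist/(_ _ e0)[r r0 rH] := H j.
  apply/nbhs_ballP; exists r => //= x.
  by rewrite -ball_normE /ball_ /= distrC => /rH.
exists r => // x xr; apply/row_norm_lt => // j; rewrite !mxE; apply: rH.
by rewrite -ball_normE /ball_ /= distrC.
Qed.

Lemma row_differentiable (V : normedModType R) n (G : V -> 'rV[R]_n) q :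
  (forall j, differentiable (fun x => G x 0 j) q) -> differentiable G q.
Proof.
move=> H; rewrite (_ : G = \sum_j (fun x => G x 0 j *: (delta_mx 0 j : 'rV[R]_n))).
  by apply: differentiable_sum => j; exact: differentiableZl.
apply/funext => x; rewrite fct_sumE [LHS]row_sum_delta; apply: eq_bigr => j _.
by [].
Qed.

Lemma derive_row_sum m (f : 'rV[R]_m -> R) q v : differentiable f q ->
  'D_v f q = \sum_j v 0 j * partial j f q.
Proof.
move=> df; rewrite deriveE// {1}(row_sum_delta v) linear_sum; apply: eq_bigr => j _.
by rewrite linearZ /= /partial deriveE.
Qed.

Lemma is_derive_chain (V : normedModType R) n (f : 'rV[R]_n -> R) (G : V -> 'rV[R]_n) q v :
  differentiable f (G q) -> (forall j, differentiable (fun x => G x 0 j) q) ->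
  is_derive q v (fun x => f (G x))
    (\sum_j 'D_v (fun x => G x 0 j) q * partial j f (G q)).
Proof.
move=> df dG; have DG := row_differentiable dG.
have Dc : differentiable (f \o G) q by exact: differentiable_comp.
split; first exact: diff_derivable.
rewrite -[LHS]/('D_v (f \o G) q) deriveE// diff_comp//= -deriveE// -deriveE//.
rewrite derive_row_sum//; apply: eq_bigr => j _; congr (_ * _).
by rewrite derive_mx ?mxE//; exact: diff_derivable.
Qed.

(** Existence of partial derivatives does not give the chain rule; [class_C1_differentiable]
    supplies the differentials, and the derivative is then a sum of products to which the induction
    hypothesis applies. *)
Lemma class_C_comp k m n (M : set 'rV[R]_m) (N : set 'rV[R]_n) f G :
  open M -> open N -> (forall q, M q -> N (G q)) ->
  (forall j, class_C k M (fun q => G q 0 j)) -> class_C k N f ->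
  class_C k M (fun q => f (G q)).
Proof.
move=> oM oN MN; elim: k f => [|k IH] f HG Hf; have [fc fd] := Hf.
  split => // q Mq; apply: (@continuous_comp _ _ _ G f); last exact/fc/MN.
  by apply: row_continuous => j; exact: (HG j).1.
have D q i : M q -> is_derive q (delta_mx 0 i) (fun x => f (G x))
    (\sum_j 'D_(delta_mx 0 i) (fun x => G x 0 j) q * partial j f (G q)).
  move=> Mq; have C1 l (L : set 'rV[R]_l) (h : 'rV[R]_l -> R) : class_C k.+1 L h -> class_C 1 L h.
    by elim: {IH HG Hf fd} k h => // k IH h /class_C_S; exact: IH.
  apply: is_derive_chain.
    by apply: (@class_C1_differentiable _ _ N) => //; [exact: C1|exact: MN].
  by move=> j; apply: (@class_C1_differentiable _ _ M) => //; exact: C1.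
split.
  move=> q Mq; apply: (@continuous_comp _ _ _ G f); last exact/fc/MN.
  by apply: row_continuous => j; exact: (HG j).1.
move=> i; split; first by move=> q Mq; have [] := D q i Mq.
apply: (@class_C_eq _ _ _ _ (fun q => \sum_j partial i (fun x => G x 0 j) q * partial j f (G q))) => //.
  by move=> q Mq; rewrite [in RHS]/partial; have [_ ->] := D q i Mq.
apply: class_C_sum => // j _; apply: class_CM => //; first exact: ((HG j).2 i).2.
apply: IH; last exact: (fd j).2.
by move=> j'; exact: class_C_S.
Qed.

End Chain.

(** * Replacing one coordinate by a function *)

Section CoordinateInverse.
Context {R : realType}.

Definition setc m (s : 'I_m) (q : 'rV[R]_m) (x : R) : 'rV[R]_m :=
  \row_i if i == s then x else q 0 i.

Section Setc.
Context (m : nat) (s : 'I_m).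

Lemma setcE q x : setc s q x 0 s = x.
Proof. by rewrite mxE eqxx. Qed.

Lemma setc_id q : setc s q (q 0 s) = q.
Proof. by apply/rowP => i; rewrite mxE; case: eqVneq => [->|]. Qed.

Lemma setc_setc q x y : setc s (setc s q x) y = setc s q y.
Proof. by apply/rowP => i; rewrite !mxE; case: eqVneq. Qed.

Lemma setc_line q x y : setc s q y = setc s q x + (y - x) *: delta_mx 0 s.
Proof.
apply/rowP => i; rewrite !mxE eqxx /=; case: eqVneq => _; last by rewrite mulr0 addr0.
by rewrite mulr1 addrC subrK.
Qed.

Lemma setc_dist q q' x x' e : 0 < e -> `|q' - q| < e -> `|x' - x| < e ->
  `|setc s q' x' - setc s q x| < e.
Proof.
move=> e0 /(row_norm_lt _ e0) Hq Hx; apply/(row_norm_lt _ e0) => i.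
by rewrite !mxE; case: eqVneq => // _; have := Hq i; rewrite !mxE.
Qed.

Lemma setc_dist_le q q' x x' e : 0 <= e -> `|q' - q| <= e -> `|x' - x| <= e ->
  `|setc s q' x' - setc s q x| <= e.
Proof.
move=> e0 /(row_norm_le _ e0) Hq Hx; apply/(row_norm_le _ e0) => i.
by rewrite !mxE; case: eqVneq => // _; have := Hq i; rewrite !mxE.
Qed.

End Setc.

(** For the difference quotients of an inverse function: the mean value theorem writes them as
    quotients of derivatives at two points that depend on h and tend to q. *)
Lemma cvg_quotient m (A B : 'rV[R]_m -> R) (q : 'rV[R]_m) (phi : R -> R) :
  {for q, continuous A} -> {for q, continuous B} -> B q != 0 ->
  (forall e : R, 0 < e -> exists2 d : R, 0 < d & forall h : R, h != 0 -> `|h| < d ->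
     exists x1 x2 : 'rV[R]_m, [/\ `|x1 - q| < e, `|x2 - q| < e & phi h = A x2 / B x1]) ->
  phi @ 0^' --> A q / B q.
Proof.
move=> Ac Bc B0 H; apply/cvgrPdist_lt => e e0.
set a := A q; set b := B q in B0 *.
have b0 : 0 < `|b| by rewrite normr_gt0.
(* If a' and b' are within e1 of a and b, and |b'| >= |b| / 2, then a'/b' is within e1 C of a/b. *)
pose C := 2 / `|b| + 2 * `|a| / `|b| ^+ 2.
have C0 : 0 <= C by rewrite addr_ge0// !mulr_ge0// ?invr_ge0.
pose e1 := Num.min (`|b| / 2) (e / (C + 1)).
have e10 : 0 < e1 by rewrite lt_min !divr_gt0// ltr_wpDl.
have [r1 r10 r1H] := (continuous_dist _ _).1 Ac _ e10.
have [r2 r20 r2H] := (continuous_dist _ _).1 Bc _ e10.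
have [d d0 dH] := H (Num.min r1 r2) ltac:(by rewrite lt_min r10).
near=> h.
have h0 : h != 0 by near: h; exact: nbhs_dnbhs_neq.
have hd : `|h| < d by near: h; exact: dnbhs0_lt.
have [x1 [x2 [X1 X2 ->]]] := dH _ h0 hd.
move: X1 X2; rewrite !lt_min => /andP[_ /r2H H1] /andP[/r1H H2 _].
set a' := A x2 in H2 *; set b' := B x1 in H1 *; rewrite -/a in H2; rewrite -/b in H1.
have eb : e1 <= `|b| / 2 by rewrite ge_min lexx.
have b'b : `|b| / 2 <= `|b'|.
  have : `|b| <= `|b'| + `|b' - b|.
    by rewrite -{1}(subKr b' b) (le_trans (ler_normB _ _)).
  by lra.
have b'0 : 0 < `|b'| by apply: lt_le_trans b'b; lra.
have nb' : b' != 0 by rewrite -normr_gt0.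
have -> : a / b - a' / b' = - ((a' - a) / b') + a * ((b' - b) / (b * b')).
  by field; rewrite nb'.
apply: le_lt_trans (ler_normD _ _) _; rewrite normrN !normrM !normfV normrM.
have i1 : `|b'|^-1 <= 2 / `|b|.
  by rewrite -[leRHS]invrK invf_div lef_pV2 ?posrE// divr_gt0.
have K1 : `|a' - a| / `|b'| <= e1 * (2 / `|b|).
  by apply: ler_pM => //; exact: ltW.
have K2 : `|a| * (`|b' - b| / (`|b| * `|b'|)) <= e1 * (2 * `|a| / `|b| ^+ 2).
  rewrite (_ : e1 * _ = `|a| * (e1 * (`|b|^-1 * (2 / `|b|)))); last by rewrite expr2; field; rewrite gt_eqF.
  apply: ler_wpM2l => //; rewrite invfM; apply: ler_pM => //.
  - exact: ltW.
  - by apply: ler_wpM2l => //; rewrite invr_ge0.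
apply: le_lt_trans (lerD K1 K2) _; rewrite -mulrDr -/C.
have : e1 * (C + 1) <= e by rewrite -ler_pdivlMr ?ltr_wpDl// ge_min lexx orbT.
by lra.
Unshelve. all: by end_near. Qed.

Section Inverse.
Context (m : nat) (s : 'I_m) (N : set 'rV[R]_m) (f : 'rV[R]_m -> R) (p : 'rV[R]_m).
Hypotheses (oN : open N) (sf : smooth N f) (Np : N p) (fp : partial s f p != 0).

Let Psi q := setc s q (f q).
(** Derivative of the inverse function g in direction j, obtained by differentiating f([setc] s y (g
    y)) = y_s. *)
Let coef j q := (if j == s then 1 else - partial j f q) / partial s f q.

(* On a small ball f is strictly monotone along the s-lines, so that Psi is
   injective there and its inverse is found by the intermediate value theorem. *)
Lemma coordinate_inverse :
  exists (M : set 'rV[R]_m) (g : 'rV[R]_m -> R),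
  [/\ open M, M p, M `<=` N & open (Psi @` M)] /\
  [/\ smooth (Psi @` M) g, forall q, M q -> g (Psi q) = q 0 s,
      forall q, M q -> partial s f q != 0 &
      forall q j, M q -> partial j g (Psi q) = coef j q].
Proof.
pose a := partial s f p.
have [r r0 [rN ra]] : exists2 r : R, 0 < r & ball p r `<=` N /\
    forall x, ball p r x -> 0 < Num.sg a * partial s f x.
  have /nbhs_ballP[r1 /= r1p r1N] := open_nbhs_nbhs (conj oN Np).
  have a0 : 0 < `|a| by rewrite normr_gt0.
  (* With tolerance |a| the derivative along s keeps the sign of a. The factor [Num.sg a] then
     treats increasing and decreasing f at once. *)
  have /continuous_dist/(_ _ a0)[r2 r2p r2H] := ((sf 1%N).2 s).2.1 p Np.
  exists (Num.min r1 r2); first by rewrite lt_min r1p.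
  split => x; rewrite -ball_normE /ball_ /= lt_min => /andP[H1 H2].
    by apply: r1N; rewrite -ball_normE.
  have := r2H x; rewrite distrC => /(_ H2); rewrite -/a => H.
  have [a1|a1|a1] := ltgtP a 0.
  - rewrite (ltr0_sg a1) mulN1r oppr_gt0; move: H.
    by rewrite (ltr0_norm a1) => /ltr_normlP[]; lra.
  - rewrite (gtr0_sg a1) mul1r; move: H.
    by rewrite (gtr0_norm a1) => /ltr_normlP[]; lra.
  - by move: fp; rewrite -/a a1 eqxx.
pose M : set 'rV[R]_m := ball p r.
have fd i x : M x -> derivable f x (delta_mx 0 i).
  by move=> Mx; apply: ((sf 1%N).2 i).1; exact: rN.
have fc x : M x -> {for x, continuous f} by move=> Mx; apply: (sf 0%N).1; exact: rN.
have pc i x : M x -> {for x, continuous (partial i f)}.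
  by move=> Mx; apply: ((sf 1%N).2 i).2.1; exact: rN.
have ps x : M x -> partial s f x != 0.
  by move=> /ra; apply: contraTneq => ->; rewrite mulr0 ltxx.
have Mseg (q : 'rV[R]_m) (x y t : R) : M (setc s q x) -> M (setc s q y) ->
    0 <= t <= 1 -> M (setc s q x + (t * (y - x)) *: delta_mx 0 s).
  move=> Mx My /andP[t0 t1]; rewrite (_ : _ + _ = setc s q (x + t * (y - x))); last first.
    by rewrite (setc_line s q x (x + _)) addrAC subrr add0r.
  move: Mx My; rewrite /M => /(row_ballP _ _ r0) Hx /(row_ballP _ _ r0) Hy.
  apply/(row_ballP _ _ r0) => i; have := Hx i; have := Hy i; rewrite !mxE.
  case: eqVneq => // _ H1 H2.
  rewrite (_ : _ - _ = t * (y - p 0 i) + (1 - t) * (x - p 0 i)); last by ring.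
  set u := y - p 0 i in H1 *; set v := x - p 0 i in H2 *.
  apply: le_lt_trans (ler_normD _ _) _; rewrite !normrM (ger0_norm t0) (@ger0_norm _ (1 - t)) ?subr_ge0//.
  apply: (@le_lt_trans _ _ (Num.max `|u| `|v|)); last by rewrite gt_max H1.
  have M1 : `|u| <= Num.max `|u| `|v| by rewrite le_max lexx.
  have M2 : `|v| <= Num.max `|u| `|v| by rewrite le_max lexx orbT.
  by nra.
have mvt (q : 'rV[R]_m) (x y : R) : M (setc s q x) -> M (setc s q y) ->
    exists2 xi, M xi & f (setc s q y) - f (setc s q x) = (y - x) * partial s f xi
      /\ `|xi - setc s q x| <= `|y - x|.
  move=> Mx My; rewrite [in f (setc s q y)](setc_line s q x).
  have [t t01 E] := @line_MVT R m f (setc s q x) (delta_mx 0 s) (y - x)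
     (fun t t01 => fd s _ (Mseg _ _ _ _ Mx My t01)).
  exists (setc s q x + (t * (y - x)) *: delta_mx 0 s); first exact: Mseg.
  split => //; rewrite addrC addKr; apply/row_norm_le => // i; rewrite !mxE eqxx /=.
  case/andP: t01 => t0 t1; rewrite !normrM (ger0_norm t0).
  by case: eqP => _; rewrite ?normr1 ?normr0 ?mulr0 ?mulr1 // ler_piMl.
have mono (q : 'rV[R]_m) (x y : R) : M (setc s q x) -> M (setc s q y) -> x < y ->
    Num.sg a * f (setc s q x) < Num.sg a * f (setc s q y).
  move=> Mx My xy; have [xi /ra Mxi [E _]] := mvt _ _ _ Mx My.
  by rewrite -subr_gt0 -mulrBr E mulrCA mulr_gt0// subr_gt0.
have inj (q : 'rV[R]_m) (x y : R) : M (setc s q x) -> M (setc s q y) ->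
    f (setc s q x) = f (setc s q y) -> x = y.
  move=> Mx My E; have [xy|xy|//] := ltgtP x y.
    by have := mono _ _ _ Mx My xy; rewrite E ltxx.
  by have := mono _ _ _ My Mx xy; rewrite E ltxx.
have oM : open M by exact: ball_open.
(* The s-coordinates of the preimages of y in M, of which [inj] leaves at most one. Off the image g
   takes the default 0, and nothing is claimed there. *)
pose P (y : 'rV[R]_m) : set R := [set x | M (setc s y x) /\ f (setc s y x) = y 0 s].
pose g y : R := xget 0 (P y).
have gP y x : P y x -> g y = x.
  move=> Px; have [Mg Eg] : P y (g y) by apply: xgetPex; exists x.
  by case: Px => Mx Ex; apply: inj Mg Mx _; rewrite Eg Ex.
have PPsi q : M q -> P (Psi q) (q 0 s).
  by move=> Mq; rewrite /P /Psi /= setc_setc setc_id setcE.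
have gPsi q : M q -> g (Psi q) = q 0 s by move=> /PPsi /gP.
have Psi_g y x : P y x -> (Psi @` M) y.
  by case=> Mx Ex; exists (setc s y x) => //; rewrite /Psi Ex setc_setc setc_id.
(* The intermediate value theorem on the s-line of every y near Psi q. It yields both the openness
   of the image and the continuity of g. *)
have local q (e : R) : M q -> 0 < e -> exists2 d : R, 0 < d & forall y, `|y - Psi q| < d ->
    exists2 x, `|x - q 0 s| <= e & P y x.
  move=> Mq; wlog eM : e / M (setc s q (q 0 s - e)) /\ M (setc s q (q 0 s + e)).
    move=> W e0; have /nbhs_ballP[r1 /= r10 r1M] := open_nbhs_nbhs (conj oM Mq).
    pose e1 := Num.min e (r1 / 2).
    have e10 : 0 < e1 by rewrite lt_min e0 divr_gt0.
    have e1r : e1 < r1 by rewrite gt_min; apply/orP; right; lra.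
    have bM x : `|x - q 0 s| <= e1 -> M (setc s q x).
      move=> xe; apply: r1M; rewrite -ball_normE /ball_ /= distrC -{2}(setc_id s q).
      by apply: setc_dist => //; rewrite ?subrr ?normr0//; exact: le_lt_trans xe e1r.
    have [|d d0 dH] := W e1 _ e10.
      split; apply: bM; first by rewrite addrC addKr normrN gtr0_norm.
      by rewrite addrC addKr gtr0_norm.
    exists d => // y /dH[x xe Px]; exists x => //; apply: le_trans xe _.
    by rewrite ge_min lexx.
  case: eM => Mm Mp e0.
  have lt1 : q 0 s - e < q 0 s by lra.
  have lt2 : q 0 s < q 0 s + e by lra.
  have Mq' : M (setc s q (q 0 s)) by rewrite setc_id.
  have m1 := mono _ _ _ Mm Mq' lt1; have m2 := mono _ _ _ Mq' Mp lt2.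
  rewrite setc_id in m1 m2.
  (* Half the smaller of the two gaps of f: two values that each move by less than e1 keep their
     order. *)
  pose e1 := Num.min (Num.sg a * f q - Num.sg a * f (setc s q (q 0 s - e)))
    (Num.sg a * f (setc s q (q 0 s + e)) - Num.sg a * f q) / 2.
  have e10 : 0 < e1 by rewrite divr_gt0// lt_min !subr_gt0 m1.
  have /continuous_dist/(_ _ e10)[d1 d10 d1H] := fc _ Mm.
  have /continuous_dist/(_ _ e10)[d2 d20 d2H] := fc _ Mp.
  have /nbhs_ballP[r1 /= r10 r1M] := open_nbhs_nbhs (conj oM Mm).
  have /nbhs_ballP[r2 /= r20 r2M] := open_nbhs_nbhs (conj oM Mp).
  exists (Num.min (Num.min e1 (Num.min d1 d2)) (Num.min r1 r2)).
    by rewrite !lt_min e10 d10 d20 r10 r20.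
  move=> y; rewrite !lt_min => /andP[/andP[ye /andP[y1 y2]] /andP[y3 y4]].
  have cl x (d : R) : `|y - Psi q| < d -> `|setc s y x - setc s q x| < d.
    move=> yd; have d0 : 0 < d by exact: le_lt_trans yd.
    rewrite -(setc_setc s q (f q) x); apply: setc_dist => //.
    by rewrite subrr normr0.
  have My1 : M (setc s y (q 0 s - e)).
    by apply: r1M; rewrite -ball_normE /ball_ /= distrC; exact: cl.
  have My2 : M (setc s y (q 0 s + e)).
    by apply: r2M; rewrite -ball_normE /ball_ /= distrC; exact: cl.
  have H1 := d1H _ (cl (q 0 s - e) _ y1).
  have H2 := d2H _ (cl (q 0 s + e) _ y2).
  have H3 : `|y 0 s - f q| < e1.
    by apply: le_lt_trans ye; have := row_coord_le (y - Psi q) s; rewrite !mxE eqxx.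
  have sgn (b c d : R) : `|b - c| < d -> Num.sg a * c - d < Num.sg a * b < Num.sg a * c + d.
    have [a1|a1|a1] := ltgtP a 0.
    - by rewrite (ltr0_sg a1) => /ltr_normlP[h1 h2]; apply/andP; split; lra.
    - by rewrite (gtr0_sg a1) => /ltr_normlP[h1 h2]; apply/andP; split; lra.
    - by move: fp; rewrite -/a a1 eqxx.
  move: (sgn _ _ _ H1) (sgn _ _ _ H2) (sgn _ _ _ H3) => /andP[_ S1] /andP[S2 _] /andP[S3 S4].
  have E1 : 2 * e1 <= Num.sg a * f q - Num.sg a * f (setc s q (q 0 s - e)).
    by rewrite mulrC divfK// ge_min lexx.
  have E2 : 2 * e1 <= Num.sg a * f (setc s q (q 0 s + e)) - Num.sg a * f q.
    by rewrite mulrC divfK// ge_min lexx orbT.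
  have T1 : Num.sg a * f (setc s y (q 0 s - e)) < Num.sg a * y 0 s by lra.
  have T2 : Num.sg a * y 0 s < Num.sg a * f (setc s y (q 0 s + e)) by lra.
  have Myx x : q 0 s - e <= x <= q 0 s + e -> M (setc s y x).
    move=> /andP[x1 x2].
    have := Mseg y (q 0 s - e) (q 0 s + e) ((x - (q 0 s - e)) / (2 * e)) My1 My2.
    rewrite (_ : _ + _ = setc s y x); last first.
      rewrite (setc_line s y (q 0 s - e) x); congr (_ + _ *: _); field.
      by rewrite gt_eqF.
    apply; apply/andP; split; first by apply: divr_ge0; lra.
    by rewrite ler_pdivrMr; lra.
  have [|||c] := @IVT R (fun x => Num.sg a * f (setc s y x)) (q 0 s - e) (q 0 s + e) (Num.sg a * y 0 s).
  - lra.
  - apply: continuous_in_subspaceT => x; rewrite inE /= in_itv /= => xI.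
    apply: (@continuousM _ _ (fun=> Num.sg a) (fun x0 : R => f (setc s y x0))); first exact: cst_continuous.
    apply: (@continuous_comp _ _ _ (setc s y) f); last exact/fc/Myx.
    apply/continuous_dist => e' e'0; exists e' => // x' xx'.
    by apply: setc_dist => //; rewrite subrr normr0.
  - by rewrite ge_min le_max (ltW T1) (ltW T2) orbT.
  rewrite in_itv /= => cI E; exists c.
    by move: cI => /andP[c1 c2]; apply/ler_normlP; split; lra.
  split; first exact: Myx.
  by apply: mulfI E; rewrite sgr_eq0.
have oB : open (Psi @` M).
  rewrite openE => _ [q Mq <-]; have [d d0 dH] := local q 1 Mq ltr01.
  apply/nbhs_ballP; exists d => //= y.
  by rewrite -ball_normE /ball_ /= distrC => /dH[x _] /Psi_g.
have gc q (e : R) : M q -> 0 < e -> exists2 d : R, 0 < d & forall y, `|y - Psi q| < d ->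
    `|g y - g (Psi q)| <= e /\ P y (g y).
  move=> Mq e0; have [d d0 dH] := local q e Mq e0; exists d => // y /dH[x xe Px].
  by rewrite gPsi// (gP _ _ Px).
have g0 : class_C 0 (Psi @` M) g.
  split => // _ [q Mq <-]; apply/continuous_dist => e e0.
  have e20 : 0 < e / 2 by lra.
  have [d d0 dH] := gc q _ Mq e20; exists d => // y /dH[ye _].
  by apply: le_lt_trans ye _; lra.
have gd q j : M q -> is_derive (Psi q) (delta_mx 0 j) g (coef j q).
  move=> Mq.
  suff H : (fun h : R => h^-1 *: (g (h *: delta_mx 0 j + Psi q) - g (Psi q))) @ 0^' --> coef j q.
    by split; [apply/cvg_ex; exists (coef j q)|exact/cvg_lim].
  apply: (@cvg_quotient m (fun x => if j == s then 1 else - partial j f x) (partial s f)).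
  - case: (j == s); first exact: cst_continuous.
    by apply: continuousN; exact: pc.
  - exact: pc.
  - exact: ps.
  move=> e e0; have e20 : 0 < e / 3 by lra.
  have /nbhs_ballP[r1 /= r10 r1M] := open_nbhs_nbhs (conj oM Mq).
  pose e1 := Num.min (e / 3) (r1 / 2).
  have e10 : 0 < e1 by rewrite lt_min e20 divr_gt0.
  have [d d0 dH] := gc q _ Mq e10.
  exists (Num.min d e1); first by rewrite lt_min d0.
  move=> h h0; rewrite lt_min => /andP[hd he].
  pose y := h *: delta_mx 0 j + Psi q.
  have nh (t : R) : `|t *: (delta_mx 0 j : 'rV[R]_m)| <= `|t|.
    apply/row_norm_le => // i; rewrite !mxE eqxx /= normrM.
    by case: eqP => _; rewrite ?normr1 ?normr0 ?mulr0 ?mulr1.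
  have [|ge [Mg Eg]] := dH y; first by rewrite addrK; exact: le_lt_trans (nh h) hd.
  rewrite gPsi// in ge.
  have qr x : `|x - q| <= e1 -> M x.
    move=> xq; apply: r1M; rewrite -ball_normE /ball_ /= distrC; apply: le_lt_trans xq _.
    by rewrite gt_min; apply/orP; right; lra.
  have near_e x : `|x - q| <= e1 -> `|x - q| < e.
    by move/le_lt_trans; apply; rewrite gt_min; apply/orP; left; lra.
  (* moving first along e_j, then along e_s *)
  pose z := setc s y (q 0 s).
  have zE : z = q + (if j == s then 0 else h) *: delta_mx 0 j.
    apply/rowP => i; rewrite !mxE eqxx /=.
    have [->|js] := eqVneq j s.
      by rewrite mul0r addr0; case: eqVneq => [->//|_]; rewrite mulr0 add0r.
    case: (eqVneq i s) => [->|_]; first by rewrite eq_sym (negbTE js) mulr0 addr0.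
    by rewrite addrC.
  have Mz : M z.
    by apply: qr; rewrite zE addrC addKr; apply: le_trans (nh _) _; case: ifP => _;
       rewrite ?normr0 ltW.
  have [x1 Mx1 [Ex1 dx1]] := mvt y (q 0 s) (g y) Mz Mg.
  have inb (t : R) : 0 <= t <= 1 -> `|q + (t * (if j == s then 0 else h)) *: delta_mx 0 j - q| <= e1.
    move=> /andP[t0 t1]; rewrite addrC addKr; apply: le_trans (nh _) _.
    rewrite normrM (ger0_norm t0); case: ifP => _; first by rewrite normr0 mulr0 ltW.
    by apply: le_trans (ltW he); rewrite ler_piMl.
  have [t t01 Et] := @line_MVT R m f q (delta_mx 0 j) (if j == s then 0 else h)
    (fun t t01 => fd j _ (qr _ (inb t t01))).
  exists x1, (q + (t * (if j == s then 0 else h)) *: delta_mx 0 j); split.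
  - have : `|x1 - z| <= e1 by exact: le_trans dx1 ge.
    move=> H1; rewrite -(subrKA z); apply: le_lt_trans (ler_normD _ _) _.
    have : `|z - q| <= e1.
      rewrite zE addrC addKr; apply: le_trans (nh _) _; case: ifP => _.
        by rewrite normr0 ltW.
      exact: ltW.
    have : e1 <= e / 3 by rewrite ge_min lexx.
    by lra.
  - exact/near_e/inb.
  - have psx := ps _ Mx1; rewrite gPsi// -/y -[_ *: _]/(_ * _).
    have K : (g y - q 0 s) * partial s f x1 =
        h * (if j == s then 1 else - partial j f (q + (t * (if j == s then 0 else h)) *: delta_mx 0 j)).
      rewrite -Ex1 Eg -/z zE -[f (q + _)](subrK (f q)) Et /y !mxE !eqxx /= eq_sym.
      by rewrite /partial; case: (j == s) => /=; ring.
    apply: (mulIf psx); rewrite divfK// -mulrA K mulrA mulVf// mul1r.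
    by [].
have coefC k j : class_C k M (coef j).
  apply: class_CM => //.
    case: (j == s); first exact: class_C_cst.
    have := class_CM oM (class_C_cst k M (-1)) (class_C_sub rN ((sf k.+1).2 j).2).
    by apply: class_C_eq => // q _; rewrite mulN1r.
  by apply: class_CV => //; exact: class_C_sub rN ((sf k.+1).2 s).2.
have sg : smooth (Psi @` M) g.
  elim=> [|k IH]; first exact: g0.
  split; first exact: g0.1.
  move=> j; split; first by move=> _ [q Mq <-]; have [] := gd q j Mq.
  (* The derivatives of g are [coef] composed with the inverse map, which is built from g: class C^k
     passes to class C^(k+1). *)
  apply: (@class_C_eq _ _ _ _ (fun y => coef j (setc s y (g y)))) => //.
    move=> _ [q Mq <-]; rewrite gPsi// /Psi setc_setc setc_id /partial.
    by have [_ ->] := gd q j Mq.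
  apply: (class_C_comp oB oM) (coefC k j).
    by move=> _ [q Mq <-]; rewrite gPsi// /Psi setc_setc setc_id.
  move=> i; case: (eqVneq i s) => [->|nis].
    by apply: class_C_eq IH => // y _; rewrite setcE.
  by apply: class_C_eq (class_C_coord k _ i) => // y _; rewrite mxE (negbTE nis).
exists M, g; split; split => //; first exact: ballxx.
by move=> q j Mq; rewrite /partial; have [_ ->] := gd q j Mq.
Qed.

End Inverse.
End CoordinateInverse.

(** * The Poincare lemma *)

Section StarIntegral.
Context {R : realType}.
Notation mu := (@lebesgue_measure R).

Lemma ball_dist (V : normedModType R) (x y : V) (r : R) : ball x r y <-> `|y - x| < r.
Proof. by rewrite -ball_normE /ball_ /= distrC. Qed.

Definition int01 (f : R -> R) : R := \int[mu]_(t in `[0, 1]) f t.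

Definition continuous01 (f : R -> R) := forall t : R, 0 <= t <= 1 -> {for t, continuous f}.

Lemma continuous01_within f : continuous01 f -> {within `[0, 1], continuous f}.
Proof.
move=> H; apply: continuous_in_subspaceT => t; rewrite inE /= in_itv /=.
exact: H.
Qed.

Lemma continuous01_integrable f : continuous01 f -> mu.-integrable `[0, 1] (EFin \o f).
Proof.
move=> /continuous01_within H.
by apply: continuous_compact_integrable => //; exact: segment_compact.
Qed.

Lemma int01_eq f g : (forall t : R, 0 <= t <= 1 -> f t = g t) -> int01 f = int01 g.
Proof. by move=> H; apply: eq_Rintegral => t; rewrite inE /= in_itv /= => /H. Qed.

Lemma int01D f g : continuous01 f -> continuous01 g ->
  int01 (fun t => f t + g t) = int01 f + int01 g.
Proof.
by move=> Hf Hg; apply: RintegralD => //; exact: continuous01_integrable.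
Qed.

Lemma int01Z c f : continuous01 f -> int01 (fun t => c * f t) = c * int01 f.
Proof. by move=> Hf; apply: RintegralZl => //; exact: continuous01_integrable. Qed.

Lemma continuous01D f g : continuous01 f -> continuous01 g ->
  continuous01 (fun t => f t + g t).
Proof. by move=> Hf Hg t t01; apply: continuousD; [exact: Hf|exact: Hg]. Qed.

Lemma continuous01M f g : continuous01 f -> continuous01 g ->
  continuous01 (fun t => f t * g t).
Proof. by move=> Hf Hg t t01; apply: continuousM; [exact: Hf|exact: Hg]. Qed.

Lemma continuous01_cst c : continuous01 (fun _ => c).
Proof. by move=> t _; exact: cst_continuous. Qed.

Lemma continuous01_sum (I : Type) (r : seq I) (F : I -> R -> R) :
  (forall i, continuous01 (F i)) -> continuous01 (fun t => \sum_(i <- r) F i t).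
Proof.
move=> H; elim: r => [|a r IH].
  by under eq_fun do rewrite big_nil; exact: continuous01_cst.
by under eq_fun do rewrite big_cons; apply: continuous01D.
Qed.

Lemma int01_cst c : int01 (fun _ => c) = c.
Proof.
rewrite /int01 Rintegral_cst//= lebesgue_measure_itv /= lte_fin ltr01.
by rewrite oppr0 adde0 mulr1.
Qed.

Lemma int01_sum (I : Type) (r : seq I) (F : I -> R -> R) :
  (forall i, continuous01 (F i)) ->
  int01 (fun t => \sum_(i <- r) F i t) = \sum_(i <- r) int01 (F i).
Proof.
move=> H; elim: r => [|a r IH].
  by rewrite big_nil -[RHS](int01_cst 0); apply: int01_eq => t _; rewrite big_nil.
rewrite big_cons -IH -int01D//; last exact: continuous01_sum.
by apply: int01_eq => t _; rewrite big_cons.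
Qed.

Lemma int01B f g : continuous01 f -> continuous01 g ->
  int01 (fun t => f t - g t) = int01 f - int01 g.
Proof.
by move=> Hf Hg; apply: RintegralB => //; exact: continuous01_integrable.
Qed.

Lemma int01_bound f (C : R) : continuous01 f ->
  (forall t : R, 0 <= t <= 1 -> `|f t| <= C) -> `|int01 f| <= C.
Proof.
move=> Hf HC; have If := continuous01_integrable Hf.
apply: (@le_trans _ _ (int01 (fun t => `|f t|))); first exact: le_normr_Rintegral.
rewrite -[leRHS]int01_cst; apply: le_Rintegral => //.
- apply: continuous01_integrable => t t01.
  by apply: (@continuous_comp _ _ _ f); [exact: Hf|exact: norm_continuous].
- by apply: continuous01_integrable; exact: continuous01_cst.
Qed.

Lemma int01_FTC f F : continuous01 f ->
  (forall t : R, 0 <= t <= 1 -> is_derive t 1 F (f t)) -> int01 f = F 1 - F 0.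
Proof.
move=> Hf HF.
have cF t : 0 <= t <= 1 -> {for t, continuous F}.
  move=> t01; apply: differentiable_continuous; apply/derivable1_diffP.
  by have [] := HF t t01.
rewrite /int01 /Rintegral (@continuous_FTC2 R f F 0 1)//.
- exact: continuous01_within.
- split.
  + by move=> t /andP[t0 t1]; have [|] := HF t; rewrite ?ltW.
  + by apply: cvg_at_right_filter; apply: cF; rewrite lexx ler01.
  + by apply: cvg_at_left_filter; apply: cF; rewrite lexx ler01.
- move=> t; rewrite in_itv /= => /andP[t0 t1]; rewrite derive1E.
  by have [|] := HF t; rewrite ?ltW.
Qed.

(* The coordinates selected by c are kept, the others are contracted towards p. *)
Definition star m (c : pred 'I_m) (p : 'rV[R]_m) (t : R) (q : 'rV[R]_m) : 'rV[R]_m :=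
  \row_i if c i then q 0 i else p 0 i + t * (q 0 i - p 0 i).

(** The weight t^a makes the family closed under partial derivatives: a derivative in a contracted
    direction brings out one more factor t. *)
Definition star_int m (c : pred 'I_m) (p : 'rV[R]_m) (a : nat)
    (b : 'rV[R]_m -> R) (q : 'rV[R]_m) : R :=
  int01 (fun t => t ^+ a * b (star c p t q)).

Section Star.
Context (m : nat) (c : pred 'I_m) (p : 'rV[R]_m).

Lemma star1 q : star c p 1 q = q.
Proof. by apply/rowP => i; rewrite !mxE mul1r addrC subrK; case: (c i). Qed.

Lemma star_shift t q h i :
  star c p t (q + h *: delta_mx 0 i) =
  star c p t q + (h * t ^+ ~~ c i) *: delta_mx 0 i.
Proof.
apply/rowP => j; rewrite !mxE eqxx /=; case: eqVneq => [->|ji].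
  by case: (c i) => /=; rewrite ?expr0 ?expr1; ring.
by rewrite !mulr0 !addr0.
Qed.

Lemma star_dist (r s t : R) q x : 0 <= t <= 1 -> `|s - t| < r -> r <= 1 -> `|x - q| < r ->
  `|star c p s x - star c p t q| <= r * (2 + `|q - p|).
Proof.
move=> t01 str r1 xqr; have r0 : 0 < r by exact: le_lt_trans str.
have n0 := normr_ge0 (q - p).
apply/row_norm_le; first by apply: mulr_ge0; [exact: ltW|lra].
move=> i; rewrite !mxE; have xqi := row_coord_le (x - q) i.
have qpi := row_coord_le (q - p) i; rewrite !mxE in xqi qpi.
case: (c i).
  apply: le_trans xqi _; apply: le_trans (ltW xqr) _.
  by rewrite ler_peMr ?(ltW r0)//; have := normr_ge0 (q - p); lra.
have -> : p 0 i + s * (x 0 i - p 0 i) - (p 0 i + t * (q 0 i - p 0 i)) =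
  s * (x 0 i - q 0 i) + (s - t) * (q 0 i - p 0 i) by ring.
apply: le_trans (ler_normD _ _) _; rewrite [r * _]mulrDr; apply: lerD; rewrite normrM.
  rewrite mulrC; apply: ler_pM => //; first exact: le_trans xqi (ltW xqr).
  have : `|s| <= `|s - t| + `|t| by rewrite -{1}(subrK t s) ler_normD.
  by case/andP: t01 => t0 t1; rewrite (ger0_norm t0); lra.
by apply: ler_pM => //; exact: ltW.
Qed.

Variable N : set 'rV[R]_m.
Hypothesis oN : open N.
Hypothesis starN : forall (q : 'rV[R]_m) (t : R), N q -> 0 <= t <= 1 -> N (star c p t q).

(** Compactness of [0, 1] makes the continuity of b uniform in t; this is what allows limits and
    derivatives to pass under the integral. *)
Lemma star_tube (b : 'rV[R]_m -> R) (q : 'rV[R]_m) (e : R) : (forall x, N x -> {for x, continuous b}) -> N q -> 0 < e ->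
  exists2 r : R, 0 < r & forall (x : 'rV[R]_m) (t : R), `|x - q| < r -> 0 <= t <= 1 ->
    `|b (star c p t x) - b (star c p t q)| < e.
Proof.
move=> bc Nq e0.
have K := @segment_compact R 0 1.
have FF : Filter (nbhs q) := @nbhs_filter 'rV[R]_m q.
have e2 : 0 < e / 2 by rewrite divr_gt0.
have /compact_near_coveringP/(_ _ (nbhs q)
  (fun x t => `|b (star c p t x) - b (star c p t q)| < e) FF) := K.
have H : forall t : R, `[0, 1]%classic t -> \forall t' \near t & x \near nbhs q,
    `|b (star c p t' x) - b (star c p t' q)| < e.
  move=> t; rewrite /= in_itv /= => t01.
  have /continuous_dist/(_ _ e2)[r r0 rH] := bc _ (starN Nq t01).
  pose d := Num.min 1 (r / (3 + `|q - p|)).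
  have n0 : 0 < 3 + `|q - p| by rewrite ltr_wpDr.
  have d0 : 0 < d by rewrite lt_min ltr01 divr_gt0.
  have dr : d * (2 + `|q - p|) < r.
    apply: (@lt_le_trans _ _ (d * (3 + `|q - p|))).
      by rewrite ltr_pM2l// ltrD2r ltr_nat.
    by rewrite -ler_pdivlMr// /d ge_min lexx orbT.
  have d1 : d <= 1 by rewrite /d ge_min lexx.
  exists (ball t d, ball q d) => /=.
    by split; apply: nbhsx_ballx.
  move=> [t' x] [/= /ball_dist tt' /ball_dist xq].
  have near1 y : `|y - q| < d -> `|b (star c p t' y) - b (star c p t q)| < e / 2.
    move=> yq; apply: rH; apply: le_lt_trans dr; exact: star_dist.
  have := near1 _ xq; have := near1 q; rewrite subrr normr0 => /(_ d0) => h1 h2.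
  rewrite -(subrKA (b (star c p t q))) (splitr e).
  apply: le_lt_trans (ler_normD _ _) _; apply: ltrD => //.
  by rewrite distrC.
move/(_ H) => /nbhs_ballP[r /= r0 rH]; exists r => // x t xq t01.
have := rH x; rewrite -ball_normE /ball_ /= distrC => /(_ xq) /(_ t).
by apply; rewrite /= in_itv.
Qed.

Lemma star_continuous01 b q : (forall x, N x -> {for x, continuous b}) -> N q ->
  continuous01 (fun t => b (star c p t q)).
Proof.
move=> bc Nq t t01; apply: (@continuous_comp _ _ _ (fun t => star c p t q) b).
  apply/continuous_dist => e e0.
  have n0 : 0 < 3 + `|q - p| by rewrite ltr_wpDr.
  exists (Num.min 1 (e / (3 + `|q - p|))).
    by rewrite lt_min ltr01 divr_gt0.
  move=> s; set d := Num.min _ _ => st.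
  have d0 : 0 < d by exact: le_lt_trans st.
  apply: (@le_lt_trans _ _ (d * (2 + `|q - p|))).
    by apply: star_dist => //; [rewrite /d ge_min lexx|rewrite subrr normr0].
  apply: (@lt_le_trans _ _ (d * (3 + `|q - p|))).
    by rewrite ltr_pM2l// ltrD2r ltr_nat.
  by rewrite -ler_pdivlMr// /d ge_min lexx orbT.
by apply: bc; exact: starN.
Qed.

Lemma continuous01X a : continuous01 (fun t => t ^+ a).
Proof. by move=> t _; exact: exprn_continuous. Qed.

Lemma star_int_continuous a b : (forall x, N x -> {for x, continuous b}) ->
  forall q, N q -> {for q, continuous (star_int c p a b)}.
Proof.
move=> bc q Nq; apply/continuous_dist => e e0.
have e2 : 0 < e / 2 by rewrite divr_gt0.
have [r r0 rH] := star_tube bc Nq e2.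
have /nbhs_ballP[r' /= r'0 r'N] := open_nbhs_nbhs (conj oN Nq).
exists (Num.min r r'); first by rewrite lt_min r0.
move=> x; rewrite lt_min => /andP[xr xr'].
have Nx : N x by apply: r'N; rewrite -ball_normE /ball_ /= distrC.
have cx := continuous01M (@continuous01X a) (star_continuous01 bc Nx).
have cq := continuous01M (@continuous01X a) (star_continuous01 bc Nq).
rewrite /star_int -int01B//.
apply: (@le_lt_trans _ _ (e / 2)); last by rewrite gtr_pMr// invf_lt1// ltr1n.
apply: int01_bound => [t t01|t t01].
  by apply: continuousB; [exact: cx|exact: cq].
rewrite -mulrBr normrM; case/andP: (t01) => t0 t1.
apply: (@le_trans _ _ (1 * `|b (star c p t x) - b (star c p t q)|)).
  by apply: ler_wpM2r => //; rewrite normrX exprn_ile1// ger0_norm.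
by rewrite mul1r ltW// rH.
Qed.

(** By [line_MVT] the difference quotient of the integrand is a derivative at a shifted point, and
    [star_tube] bounds the effect of the shift uniformly in t. *)
Lemma is_derive_star_int a b (i : 'I_m) q : class_C 1 N b -> N q ->
  is_derive q (delta_mx 0 i) (star_int c p a b)
    (star_int c p (a + ~~ c i) (partial i b) q).
Proof.
move=> [bc bd] Nq; have [bi [bic _]] := bd i.
suff H : (fun h : R => h^-1 *: (star_int c p a b (h *: delta_mx 0 i + q) - star_int c p a b q))
    @ 0^' --> star_int c p (a + ~~ c i) (partial i b) q.
  by split; [apply/cvg_ex; exists (star_int c p (a + ~~ c i) (partial i b) q)|exact/cvg_lim].
apply/cvgrPdist_le => e e0.
have [r r0 rH] := star_tube bic Nq e0.
have /nbhs_ballP[r' /= r'0 r'N] := open_nbhs_nbhs (conj oN Nq).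
near=> h.
have h0 : h != 0 by near: h; exact: nbhs_dnbhs_neq.
have hd : `|h| < Num.min r r'.
  near: h; apply: dnbhs0_lt; by rewrite lt_min r0.
have {hd}[hr hr'] : `|h| < r /\ `|h| < r' by apply/andP; rewrite -lt_min.
have nd (s : R) : `|(s * h) *: (delta_mx 0 i : 'rV[R]_m)| <= `|s| * `|h|.
  apply/row_norm_le; first exact: mulr_ge0.
  move=> j; rewrite !mxE eqxx /= -normrM; case: eqP => _; first by rewrite mulr1.
  by rewrite mulr0 normr0.
have inN (s : R) : 0 <= s <= 1 -> `|q + (s * h) *: delta_mx 0 i - q| < Num.min r r'.
  move=> /andP[s0 s1]; rewrite addrC addKr; apply: le_lt_trans (nd s) _.
  apply: (@le_lt_trans _ _ `|h|); first by rewrite ger0_norm// ler_piMl.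
  by rewrite lt_min hr.
have NN (s : R) : 0 <= s <= 1 -> N (q + (s * h) *: delta_mx 0 i).
  move=> /inN; rewrite lt_min => /andP[_ H]; apply: r'N.
  by rewrite -ball_normE /ball_ /= distrC.
have Nh : N (q + h *: delta_mx 0 i) by rewrite -[h]mul1r; apply: NN; rewrite lexx ler01.
rewrite [h *: _ + q]addrC.
have cx := continuous01M (@continuous01X a) (star_continuous01 bc Nh).
have cq := continuous01M (@continuous01X a) (star_continuous01 bc Nq).
have ci := continuous01M (@continuous01X (a + ~~ c i)) (star_continuous01 bic Nq).
have cB : continuous01 (fun t => t ^+ a * b (star c p t (q + h *: delta_mx 0 i)) - t ^+ a * b (star c p t q)).
  by move=> t t01; apply: continuousB; [exact: cx|exact: cq].
rewrite /star_int -int01B// -[_ *: _]/(_ * _) -int01Z// -int01B//; last first.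
  exact: continuous01M (@continuous01_cst _) cB.
apply: int01_bound => [t t01|t t01].
  by apply: continuousB; [exact: ci|exact: (continuous01M (@continuous01_cst _) cB)].
have [|s s01 E] := @line_MVT R m b (star c p t q) (delta_mx 0 i) (h * t ^+ ~~ c i).
  by move=> s s01; rewrite mulrA -star_shift; apply: bi; apply: starN => //; exact: NN.
rewrite star_shift -mulrBr E -['D_ _ _ _]/(partial i b _) mulrA -star_shift.
have F (A B : R) : t ^+ (a + ~~ c i) * A - h^-1 * (t ^+ a * (h * t ^+ (~~ c i) * B)) =
    t ^+ (a + ~~ c i) * (A - B).
  by rewrite exprD; field.
rewrite F normrM distrC; case/andP: (t01) => t0 t1.
apply: (@le_trans _ _ (1 * e)); last by rewrite mul1r.
apply: ler_pM => //; first by rewrite normrX exprn_ile1// ger0_norm.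
by apply/ltW/rH => //; have := inN _ s01; rewrite lt_min => /andP[].
Unshelve. all: by end_near. Qed.

Lemma class_C_star_int k a b : class_C k N b -> class_C k N (star_int c p a b).
Proof.
elim: k a b => [|k IH] a b Hb; have [bc bd] := Hb.
  by split => //; exact: star_int_continuous.
have C1 : class_C 1 N b.
  by elim: {IH bc bd} k Hb => // k IH /class_C_S.
split; first exact: star_int_continuous.
move=> i; split.
  by move=> q Nq; have [] := is_derive_star_int a i C1 Nq.
apply: class_C_eq (IH (a + ~~ c i)%N _ (bd i).2) => // q Nq.
by rewrite [RHS]/partial; have [_ ->] := is_derive_star_int a i C1 Nq.
Qed.

End Star.

Lemma ball_star m (c : pred 'I_m) (p q : 'rV[R]_m) (r t : R) :
  0 <= t <= 1 -> ball p r q -> ball p r (star c p t q).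
Proof.
move=> /andP[t0 t1] pq.
have r0 : 0 < r by move: pq; rewrite -ball_normE /ball_ /=; exact: le_lt_trans.
move: pq => /(row_ballP _ _ r0) H; apply/(row_ballP _ _ r0) => i; rewrite !mxE.
case: (c i) => //; rewrite addrC addKr normrM (ger0_norm t0).
by apply: le_lt_trans (H i); rewrite ler_piMl.
Qed.

Lemma is_derive_star m (c : pred 'I_m) (p q : 'rV[R]_m) (b : 'rV[R]_m -> R) (t : R) :
  differentiable b (star c p t q) ->
  is_derive t 1 (fun s => b (star c p s q))
    (\sum_(i | ~~ c i) (q 0 i - p 0 i) * partial i b (star c p t q)).
Proof.
move=> db; pose v : 'rV[R]_m := \row_i if c i then 0 else q 0 i - p 0 i.
pose o : 'rV[R]_m := \row_i if c i then q 0 i else p 0 i.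
have E s : star c p s q = o + s *: v.
  apply/rowP => i; rewrite !mxE; case: (c i); first by rewrite mulr0 addr0.
  by [].
have -> : (fun s => b (star c p s q)) = (fun s => b (o + s *: v)).
  by apply/funext => s; rewrite E.
apply: is_derive_line; rewrite -E.
have D1 : derivable b (star c p t q) v by exact: diff_derivable.
split => //.
rewrite derive_row_sum// [RHS]big_mkcond /=; apply: eq_bigr => i _; rewrite mxE.
by case: (c i) => //=; rewrite mul0r.
Qed.

(** The primitive is the integral of w along the segments issuing from p; with [pred0] the map
    [star] contracts every coordinate. *)
Lemma poincare_lemma m (p : 'rV[R]_m) (r : R) (w : form1 m) : 0 < r ->
  smooth_map (ball p r) w -> (forall q, ball p r q -> dext w q = 0) ->
  exists2 v : 'rV[R]_m -> R, smooth (ball p r) v &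
    forall q, ball p r q -> grad v q = w q.
Proof.
move=> r0 sw dw; have oN : open (ball p r) by exact: ball_open.
have sN (q : 'rV[R]_m) (t : R) : ball p r q -> 0 <= t <= 1 -> ball p r (star pred0 p t q).
  by move=> Bq t01; exact: ball_star.
pose J i := star_int pred0 p 0 (fun x => w x 0 i).
exists (fun q : 'rV[R]_m => \sum_i (q 0 i - p 0 i) * J i q).
  move=> k; apply: class_C_sum => // i _; apply: class_CM => //.
    by apply: class_CD => //; [exact: class_C_coord|exact: class_C_cst].
  by apply: class_C_star_int => //; exact: sw.
move=> q Bq; apply/rowP => j; rewrite mxE.
have D i : is_derive q (delta_mx 0 j) (fun q : 'rV[R]_m => (q 0 i - p 0 i) * J i q)
    ((q 0 i - p 0 i) * star_int pred0 p 1 (partial j (fun x => w x 0 i)) q + J i q * (i == j)%:R).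
  have D1 : is_derive q (delta_mx 0 j) (fun q : 'rV[R]_m => q 0 i - p 0 i) ((i == j)%:R).
    have H := is_deriveB (is_derive_coord i q (delta_mx 0 j)) (is_derive_cst (p 0 i) q (delta_mx 0 j)).
    by apply: is_derive_eq H _; rewrite mxE eqxx subr0.
  exact: is_deriveM D1 (is_derive_star_int oN sN 0 j (sw i 1%N) Bq).
have -> : partial j (fun q : 'rV[R]_m => \sum_i (q 0 i - p 0 i) * J i q) q =
  \sum_i ((q 0 i - p 0 i) * star_int pred0 p 1 (partial j (fun x => w x 0 i)) q + J i q * (i == j)%:R).
  have H := is_derive_sum D.
  have E : (fun q : 'rV[R]_m => \sum_i (q 0 i - p 0 i) * J i q) =
    \sum_(i < m) (fun q : 'rV[R]_m => (q 0 i - p 0 i) * J i q) by apply/funext => x; rewrite fct_sumE.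
  by rewrite /partial E; have [_ ->] := H.
rewrite big_split /= [X in _ + X](bigD1 j)//= eqxx mulr1 [X in _ + (_ + X)]big1 ?addr0; last first.
  by move=> i ij; rewrite (negbTE ij) mulr0.
have wc i x : ball p r x -> {for x, continuous (fun x => w x 0 i)}.
  exact: (sw i 0%N).1.
have wpc i l x : ball p r x -> {for x, continuous (partial l (fun x => w x 0 i))}.
  exact: ((sw i 1%N).2 l).2.1.
have c1 i l (a : nat) : continuous01 (fun t => t ^+ a * partial l (fun x => w x 0 i) (star pred0 p t q)).
  by apply: continuous01M; [exact: continuous01X|apply: (@star_continuous01 _ _ _ _ sN (partial l (fun x => w x 0 i)) q) => // x; exact: wpc].
have c0 i (a : nat) : continuous01 (fun t => t ^+ a * w (star pred0 p t q) 0 i).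
  by apply: continuous01M; [exact: continuous01X|apply: (@star_continuous01 _ _ _ _ sN (fun x => w x 0 i) q) => // x; exact: wc].
under eq_bigr => i _ do rewrite /star_int -int01Z//.
rewrite -int01_sum; last by move=> i; apply: continuous01M; [exact: continuous01_cst|exact: c1].
rewrite /J /star_int -int01D//; last first.
  by apply: continuous01_sum => i; apply: continuous01M; [exact: continuous01_cst|exact: c1].
(* Since w is closed, the integrand is the derivative of t times the j-th coefficient of w along the
   segment. *)
pose G (t : R) := t * w (star pred0 p t q) 0 j.
transitivity (G 1 - G 0); last by rewrite /G star1 mul1r mul0r subr0.
apply: int01_FTC.
- apply: continuous01D; last exact: c0.
  by apply: continuous01_sum => i; apply: continuous01M; [exact: continuous01_cst|exact: c1].
- move=> t t01; have Bt := sN _ _ Bq t01.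
  have dj : differentiable (fun x => w x 0 j) (star pred0 p t q).
  by apply: (@class_C1_differentiable _ _ (ball p r)) => //; exact: sw.
  have H := is_deriveM (is_derive_id t (1 : R)) (is_derive_star dj).
  apply: is_derive_eq H _; rewrite expr0 mul1r -[_ *: 1]/(_ * 1) mulr1 -[_ *: _]/(t * _).
  congr (_ + _); rewrite mulr_sumr; apply: eq_big => //= i _.
  rewrite expr1 mulrCA; congr (_ * (_ * _)).
  by have /matrixP/(_ i j) := dw _ Bt; rewrite !mxE => /eqP; rewrite subr_eq0 => /eqP.
Qed.

End StarIntegral.

(** * Scalar differential equations *)

Section ScalarODE.
Context {R : realType}.
Notation mu := (@lebesgue_measure R).

Lemma MVT_closed (F dF : R -> R) (a b : R) : a <= b ->
  (forall t : R, a <= t <= b -> is_derive t 1 F (dF t)) ->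
  exists2 c : R, a <= c <= b & F b - F a = dF c * (b - a).
Proof.
move=> ab H; have [||c cI E] := @MVT_segment R F dF a b ab.
- by move=> t; rewrite in_itv /= => /andP[t0 t1]; apply: H; rewrite !ltW.
- apply: derivable_within_continuous => t; rewrite in_itv /= => tI.
  by have [] := H t tI.
by exists c => //; rewrite in_itv in cI.
Qed.

Lemma MVT_bound (F dF : R -> R) (a b lo hi e : R) :
  lo <= a <= hi -> lo <= b <= hi ->
  (forall t : R, lo <= t <= hi -> is_derive t 1 F (dF t)) ->
  (forall t : R, lo <= t <= hi -> `|dF t| <= e) -> `|F b - F a| <= e * `|b - a|.
Proof.
move=> + + H He; wlog ab : a b / a <= b.
  move=> W la lb; have [ab|/ltW ba] := leP a b; first exact: W.
  by rewrite distrC [`|b - a|]distrC; exact: W.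
move=> /andP[la ah] /andP[lb bh].
have inI t : a <= t <= b -> lo <= t <= hi.
  by move=> /andP[h1 h2]; rewrite (le_trans la h1) (le_trans h2 bh).
have [c cI ->] := MVT_closed ab (fun t tI => H t (inI t tI)).
by rewrite normrM ler_wpM2r// He// inI.
Qed.

Lemma gronwall01 (y dy : R -> R) (C : R) :
  (forall t : R, 0 <= t <= 1 -> is_derive t 1 y (dy t)) ->
  (forall t : R, 0 <= t <= 1 -> `|dy t| <= 2^-1 * `|y t| + C) ->
  forall t : R, 0 <= t <= 1 -> `|y t| <= 2 * (`|y 0| + C).
Proof.
move=> Hy Hd.
have [|c] := @EVT_max R (fun t => `|y t|) 0 1 ler01.
  apply: continuous_in_subspaceT => t; rewrite inE /= in_itv /= => tI.
  apply: (@continuous_comp _ _ _ y); last exact: norm_continuous.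
  apply: differentiable_continuous; apply/derivable1_diffP.
  by have [] := Hy t tI.
rewrite in_itv /= => /andP[c0 c1] cmax t tI.
have le t' : 0 <= t' <= 1 -> `|y t'| <= `|y c| by move=> I; apply: cmax; rewrite in_itv.
apply: le_trans (le t tI) _.
have [d /andP[d0 dc] E] := MVT_closed c0 (fun t (tI : 0 <= t <= c) =>
  Hy t (introT andP (conj (andP tI).1 (le_trans (andP tI).2 c1)))).
have dI : 0 <= d <= 1 by rewrite d0 (le_trans dc).
have H1 : `|y c| <= `|y 0| + `|dy d| * c.
  rewrite -(subrK (y 0) (y c)) E subr0 addrC; apply: le_trans (ler_normD _ _) _.
  by rewrite normrM (ger0_norm c0).
have H2 := Hd d dI; have H3 := le d dI.
have H4 : `|dy d| * c <= `|dy d| by rewrite ler_piMr.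
by lra.
Qed.

(** With c n = 2 D / 2^n the intervals [u n - c n, u n + c n] are nested, and the limit is the
    supremum of their left ends. *)
Lemma geometric_limit (u : nat -> R) (D : R) :
  (forall n, `|u n.+1 - u n| <= D / 2 ^+ n) ->
  exists l, forall n, `|l - u n| <= 2 * D / 2 ^+ n.
Proof.
move=> H; pose c n := 2 * D / 2 ^+ n.
have D0 : 0 <= D by have := le_trans (normr_ge0 _) (H 0%N); rewrite expr0 divr1.
have c0 n : 0 <= c n by rewrite divr_ge0// ?mulr_ge0// exprn_ge0.
have cS n : c n = c n.+1 + D / 2 ^+ n.
  by rewrite /c exprS; field; rewrite expf_neq0.
have lo n : u n - c n <= u n.+1 - c n.+1.
  by rewrite (cS n); have /ler_normlP[] := H n; lra.
have hi n : u n.+1 + c n.+1 <= u n + c n.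
  by rewrite (cS n); have /ler_normlP[] := H n; lra.
have loh m n : (m <= n)%N -> u m - c m <= u n - c n.
  exact: (@homo_leq _ (fun n => u n - c n) <=%R (@lexx _ _) (@le_trans _ _)).
have hih m n : (m <= n)%N -> u n + c n <= u m + c m.
  move=> /subnK <-; elim: (n - m)%N => [|k IH] //; rewrite addSn.
  exact: le_trans (hi _) IH.
have cross m n : u m - c m <= u n + c n.
  apply: le_trans (loh _ _ (leq_maxl m n)) _.
  apply: le_trans _ (hih _ _ (leq_maxr m n)).
  by have := c0 (maxn m n); lra.
pose A := [set x | exists n, x = u n - c n].
have hA : has_sup A.
  by split; [exists (u 0%N - c 0%N), 0%N|exists (u 0%N + c 0%N) => _ [n ->]].
exists (sup A) => n; apply/ler_normlP; rewrite -/(c n).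
have h1 : u n - c n <= sup A by apply: ub_le_sup => //; [exact: hA.2|exists n].
have h2 : sup A <= u n + c n by apply: ge_sup => //; [exact: hA.1|move=> _ [m ->]].
by split; lra.
Qed.

Lemma exists_small_geometric (C e : R) : 0 < e -> exists n : nat, C / 2 ^+ n < e.
Proof.
move=> e0; have [n Hn] : exists n : nat, C / e < n%:R.
  by exists (Num.truncn (C / e)).+1; exact: truncnS_gt.
exists n; rewrite ltr_pdivrMr ?exprn_gt0// mulrC -ltr_pdivrMr//.
apply: lt_le_trans Hn _; rewrite -natrX ler_nat; exact/ltnW/ltn_expl.
Qed.

(** The primitive that vanishes at 0, meaningful for negative t too: the base point -2 lies below
    all times in use, so both integrals run over ordered intervals. *)
Definition prim (f : R -> R) (t : R) : R :=
  \int[mu]_(x in `[(-2 : R), t]) f x - \int[mu]_(x in `[(-2 : R), 0]) f x.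

Lemma prim0 f : prim f 0 = 0.
Proof. by rewrite /prim subrr. Qed.

Lemma is_derive_prim (f : R -> R) (t : R) : continuous f -> -2 < t < 3 -> is_derive t 1 (prim f) (f t).
Proof.
move=> cf /andP[t0 t1].
have If : mu.-integrable `[-2, 3] (EFin \o f).
  apply: continuous_compact_integrable; first exact: segment_compact.
  exact: continuous_subspaceT.
have [D1 D2] := @continuous_FTC1_closed R f (-2) t 3 t1 If t0 (cf t).
have H : is_derive t 1 (fun t : R => \int[mu]_(x in `[(-2 : R), t]) f x) (f t).
  by split; [exact: D1|rewrite -derive1E; exact: D2].
have := is_deriveB H (is_derive_cst (\int[mu]_(x in `[(-2 : R), 0]) f x) t (1 : R)).
by rewrite subr0.
Qed.

Lemma clamp_dist (lo hi x y : R) :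
  `|Num.max lo (Num.min hi x) - Num.max lo (Num.min hi y)| <= `|x - y|.
Proof.
have maxd (a u v : R) : `|Num.max a u - Num.max a v| <= `|u - v|.
  wlog uv : u v / u <= v.
    by move=> W; have [/W//|/ltW/W] := leP u v; rewrite distrC [leRHS]distrC.
  rewrite [leRHS]distrC (ger0_norm (_ : 0 <= v - u)) ?subr_ge0//.
  by case: (leP a u) => h1; case: (leP a v) => h2; apply/ler_normlP; split; lra.
have mind (a u v : R) : `|Num.min a u - Num.min a v| <= `|u - v|.
  wlog uv : u v / u <= v.
    by move=> W; have [/W//|/ltW/W] := leP u v; rewrite distrC [leRHS]distrC.
  rewrite [leRHS]distrC (ger0_norm (_ : 0 <= v - u)) ?subr_ge0//.
  by case: (leP a u) => h1; case: (leP a v) => h2; apply/ler_normlP; split; lra.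
exact: le_trans (maxd _ _ _) (mind _ _ _).
Qed.

Section Picard.
Variables (H : R -> R -> R) (A x0 : R).
Hypotheses (Hc : forall x : R -> R, continuous x -> continuous (fun t => H t (x t)))
  (HL : forall t x y, `|H t x - H t y| <= 4^-1 * `|x - y|)
  (HA : forall t x, `|H t x| <= A).

(** Clamping time makes the iterates total continuous functions. The range exceeds [0, 1] because
    the derivatives at 0 and 1 are two-sided. *)
Let cl (t : R) : R := Num.max (-1) (Num.min 2 t).

Let clI (t : R) : -1 <= cl t <= 2.
Proof. by rewrite /cl le_max lexx /= ge_max ge_min lexx /= andbT; lra. Qed.

Let cl_id (t : R) : -1 < t < 2 -> cl t = t.
Proof. by move=> /andP[t0 t1]; rewrite /cl min_r ?max_r// ltW. Qed.

Let cl_continuous : continuous cl.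
Proof.
move=> t; apply/continuous_dist => e e0; exists e => // s.
exact: le_lt_trans (clamp_dist _ _ _ _).
Qed.

Let X := fix X n := if n is n'.+1 then
  fun t => x0 + prim (fun t => H t (X n' t)) (cl t) else fun _ => x0.

Let prim_cl_continuous (f : R -> R) : continuous f -> continuous (fun t => prim f (cl t)).
Proof.
move=> cf t; apply: (@continuous_comp _ _ _ cl (prim f)); first exact: cl_continuous.
apply: differentiable_continuous; apply/derivable1_diffP.
have [|//] := @is_derive_prim f (cl t) cf _.
by have /andP[h1 h2] := clI t; apply/andP; split; lra.
Qed.

Let X_continuous n : continuous (X n).
Proof.
elim: n => [|n IH] t; first exact: cst_continuous.
apply: (@continuousD _ _ _ (fun=> x0) (fun t => prim (fun t => H t (X n t)) (cl t))).
  exact: cst_continuous.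
exact: prim_cl_continuous (Hc IH) t.
Qed.

(** The factor 2 is the largest distance of a clamped time from 0. *)
Let prim_dist (f g : R -> R) (e : R) : continuous f -> continuous g ->
  (forall t, `|f t - g t| <= e) -> forall t, `|prim f (cl t) - prim g (cl t)| <= 2 * e.
Proof.
move=> cf cg fg t; have /andP[h1 h2] := clI t.
have D (s : R) : -1 <= s <= 2 -> is_derive s 1 (fun s => prim f s - prim g s) (f s - g s).
  by move=> /andP[h3 h4]; apply: is_deriveB; apply: is_derive_prim => //; apply/andP; split; lra.
have I0 : -1 <= (0 : R) <= 2 by apply/andP; split; lra.
have := @MVT_bound _ _ 0 (cl t) _ _ e I0 (clI t) D (fun s _ => fg s).
rewrite !prim0 subrr !subr0 => /le_trans; apply; rewrite mulrC.
have e0 : 0 <= e by apply: le_trans (fg 0).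
by apply: ler_wpM2r => //; apply/ler_normlP; split; lra.
Qed.

Let X_step n t : `|X n.+1 t - X n t| <= 2 * A / 2 ^+ n.
Proof.
elim: n t => [|n IH] t.
  rewrite /= addrC addKr expr0 divr1.
  have c0 : continuous (fun _ : R => 0 : R) by move=> s; exact: cst_continuous.
  have cH : continuous (fun s => H s x0).
    by apply: (Hc (x := fun=> x0)) => s; exact: cst_continuous.
  have p0 s : prim (fun _ => 0) s = 0.
    by rewrite /prim !Rintegral_cst//= !mul0r subr0.
  have := prim_dist cH c0 _ t; rewrite p0 subr0; apply => s.
  by rewrite subr0.
rewrite -[X n.+2 t]/(x0 + prim (fun t => H t (X n.+1 t)) (cl t)).
rewrite -[X n.+1 t]/(x0 + prim (fun t => H t (X n t)) (cl t)).
rewrite opprD addrACA subrr add0r.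
rewrite (_ : 2 * A / 2 ^+ n.+1 = 2 * (4^-1 * (2 * A / 2 ^+ n))); last first.
  by rewrite exprS; field; rewrite expf_neq0.
apply: prim_dist; [exact: Hc|exact: Hc|move=> s].
by apply: le_trans (HL _ _ _) _; rewrite ler_wpM2l.
Qed.

(** The Lipschitz constant 1/4 over times at distance at most 2 from 0 makes each iteration halve
    the distance, as [geometric_limit] requires. *)
Lemma picard : exists x : R -> R, [/\ continuous x, x 0 = x0 &
  forall t : R, -1 < t < 2 -> is_derive t 1 x (H t (x t))].
Proof.
pose x t := sval (cid (geometric_limit (X_step ^~ t))).
have xX n t : `|x t - X n t| <= 2 * (2 * A) / 2 ^+ n.
  by rewrite /x; case: cid.
have cx : continuous x.
  move=> t; apply/continuous_dist => e e0; have e4 : 0 < e / 4 by lra.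
  have [n Hn] := exists_small_geometric (2 * (2 * A)) e4.
  have [r r0 rH] := (continuous_dist _ _).1 (@X_continuous n t) _ e4.
  exists r => // s st; have h1 := xX n t; have h2 := xX n s; have h3 := rH _ st.
  move: h1 h2 h3 Hn; set a := _ / _; set b := X n t; set b' := X n s.
  by move=> /ler_normlP[h1 h1'] /ler_normlP[h2 h2'] /ltr_normlP[h3 h3'] Hn; apply/ltr_normlP; split; lra.
have xE t : x t = x0 + prim (fun t => H t (x t)) (cl t).
  apply/eqP; rewrite -subr_eq0 -normr_le0; apply/ler_addgt0Pr => e e0; rewrite add0r.
  have [n Hn] := exists_small_geometric (2 * (2 * A)) e0.
  apply: le_trans _ (ltW Hn); set Y := x0 + _.
  have h1 := xX n.+1 t.
  have h2 : `|X n.+1 t - Y| <= 2 * (4^-1 * (2 * (2 * A) / 2 ^+ n)).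
    rewrite /Y /= opprD addrACA subrr add0r.
    apply: prim_dist; [exact: Hc|exact: Hc|move=> s].
    by apply: le_trans (HL _ _ _) _; rewrite ler_wpM2l// distrC.
  rewrite -(subrKA (X n.+1 t)); apply: le_trans (ler_normD _ _) _.
  rewrite [leRHS](_ : _ = 2 * (2 * A) / 2 ^+ n.+1 + 2 * (4^-1 * (2 * (2 * A) / 2 ^+ n))).
    exact: lerD.
  by rewrite exprS; field; rewrite expf_neq0.
exists x; split => //.
  by rewrite xE cl_id ?prim0 ?addr0//; apply/andP; split; lra.
move=> t tI; have /andP[t0 t1] := tI.
have D : is_derive t 1 (fun t => x0 + prim (fun t => H t (x t)) t) (H t (x t)).
  have Dp : is_derive t 1 (prim (fun t => H t (x t))) (H t (x t)).
    by apply: is_derive_prim; [exact: Hc|apply/andP; split; lra].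
  by have := is_deriveD (is_derive_cst x0 t (1 : R)) Dp; rewrite add0r.
apply: near_eq_is_derive D; near=> s.
rewrite [in RHS]xE cl_id//; near: s.
apply/nbhs_ballP; exists (Num.min (t + 1) (2 - t)) => /=.
  by rewrite lt_min; apply/andP; split; lra.
move=> s /ball_dist; rewrite lt_min => /andP[/ltr_normlP[h1 h2] /ltr_normlP[h3 h4]].
by apply/andP; split; lra.
Unshelve. all: by end_near. Qed.

End Picard.
End ScalarODE.

(** * The Frobenius theorem in codimension one *)

Section Bounds.
Context {R : realType} (m : nat).
Implicit Types (p : 'rV[R]_m) (f : 'rV[R]_m -> R).

Definition bounded_lipschitz p (r C : R) f := forall x y : 'rV[R]_m,
  ball p r x -> ball p r y -> `|f x| <= C /\ `|f x - f y| <= C * `|x - y|.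

Lemma bounded_lipschitz_mono p (r r' C C' : R) f : r' <= r -> C <= C' ->
  bounded_lipschitz p r C f -> bounded_lipschitz p r' C' f.
Proof.
move=> rr CC H x y Bx By.
have [|h1 h2] := H x y _ (le_ball rr By); first exact: le_ball rr _ Bx.
by split; [exact: le_trans h1 CC|apply: le_trans h2 _; exact: ler_wpM2r].
Qed.

Lemma smooth_bounded_lipschitz p (N : set 'rV[R]_m) f : open N -> N p -> smooth N f ->
  exists2 r : R, 0 < r & exists2 C : R, 0 <= C & bounded_lipschitz p r C f.
Proof.
move=> oN Np sf.
have bnd (g : 'rV[R]_m -> R) : {for p, continuous g} ->
    exists2 r : R, 0 < r & forall x, ball p r x -> `|g x| <= `|g p| + 1.
  move=> /continuous_dist/(_ _ ltr01)[r r0 rH]; exists r => // x /ball_dist /rH H.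
  by rewrite -(subrK (g p) (g x)) addrC; apply: le_trans (ler_normD _ _) _; rewrite lerD2l ltW.
have /nbhs_ballP[r1 /= r10 r1N] := open_nbhs_nbhs (conj oN Np).
have [r2 r20 r2H] := bnd f ((sf 0%N).1 p Np).
have [r3 r30 r3H] : exists2 r : R, 0 < r & forall x, ball p r x ->
    forall i, `|partial i f x| <= `|partial i f p| + 1.
  have FF : Filter (nbhs p) := @nbhs_filter 'rV[R]_m p.
  have /nbhs_ballP[r /= r0 rH] : \forall x \near p, forall i, `|partial i f x| <= `|partial i f p| + 1.
    apply: (@filter_forall _ _ (fun i x => `|partial i f x| <= `|partial i f p| + 1) _ FF) => i.
    have [r r0 rH] := bnd _ (((sf 1%N).2 i).2.1 p Np).
    by apply/nbhs_ballP; exists r.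
  by exists r.
pose r := Num.min r1 (Num.min r2 r3).
have r0 : 0 < r by rewrite !lt_min r10 r20.
pose D := \sum_i (`|partial i f p| + 1); pose C := `|f p| + 1 + D.
have D0 : 0 <= D by apply: sumr_ge0 => i _; rewrite addr_ge0.
(* The intermediate points z of the telescoping satisfy |z - y| <= |x - y|; with x and y within r /
   3 of p, they stay within r of p. *)
exists (r / 3); first by lra.
exists C; first by rewrite /C; have := normr_ge0 (f p); lra.
move=> x y /ball_dist Bx /ball_dist By.
have br z : `|z - p| < r -> [/\ ball p r1 z, ball p r2 z & ball p r3 z].
  by rewrite !lt_min => /andP[h1 /andP[h2 h3]]; split; apply/ball_dist.
have rr : r / 3 < r by lra.
split.
  have [_ /r2H h _] := br x (lt_trans Bx rr); apply: le_trans h _.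
  by rewrite /C lerDl.
have inr z : `|z - y| <= `|x - y| -> `|z - p| < r.
  move=> zy; have h1 : `|x - y| <= `|x - p| + `|y - p|.
    by rewrite -(subrKA p) [`|y - p|]distrC ler_normD.
  have h2 : `|z - p| <= `|z - y| + `|y - p| by rewrite -(subrKA y) ler_normD.
  by lra.
have [|xi [xiH E]] := @increment_telescope R m f y (x - y).
  by move=> z /inr /br[/r1N Nz _ _] i; exact: ((sf 1%N).2 i).1.
rewrite -[in f x](subrK y x) [x - y + y]addrC E.
apply: le_trans (ler_norm_sum _ _ _) _.
apply: (@le_trans _ _ (D * `|x - y|)); last first.
  by apply: ler_wpM2r => //; rewrite /C lerDr addr_ge0.
rewrite /D mulr_suml; apply: ler_sum => i _; rewrite normrM mulrC.
apply: ler_pM => //; last exact: row_coord_le.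
by have [_ _ /r3H] := br _ (inr _ (xiH i)); apply.
Qed.

Lemma bounded_lipschitz_uniform (I : finType) p (f : I -> 'rV[R]_m -> R) :
  (forall i, exists2 r : R, 0 < r & exists2 C : R, 0 <= C & bounded_lipschitz p r C (f i)) ->
  exists2 r : R, 0 < r & exists2 C : R, 0 <= C & forall i, bounded_lipschitz p r C (f i).
Proof.
move=> H.
suff [r r0 [C C0 HC]] : exists2 r : R, 0 < r & exists2 C : R, 0 <= C &
    forall i, i \in enum I -> bounded_lipschitz p r C (f i).
  by exists r => //; exists C => // i; apply: HC; rewrite mem_enum.
elim: (enum I) => [|i l [r r0 [C C0 HC]]]; first by exists 1 => //; exists 0.
have [r' r'0 [C' C'0 HC']] := H i.
exists (Num.min r r'); first by rewrite lt_min r0.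
exists (C + C'); first exact: addr_ge0.
move=> j; rewrite in_cons => /orP[/eqP ->|/HC Hj].
  by apply: bounded_lipschitz_mono HC'; rewrite ?ge_min ?lexx ?orbT// lerDr.
by apply: bounded_lipschitz_mono Hj; rewrite ?ge_min ?lexx// lerDl.
Qed.

(** The remainder is a sum of differences of partial derivatives at points at distance at most |d|,
    each weighted by a coordinate of d, hence quadratic in d. *)
Lemma taylor1 p (r C : R) f (x d : 'rV[R]_m) : 0 < r ->
  (forall y i, ball p r y -> derivable f y (delta_mx 0 i)) ->
  (forall i, bounded_lipschitz p r C (partial i f)) ->
  ball p (r / 3) x -> ball p (r / 3) (x + d) ->
  `|f (x + d) - f x - \sum_i d 0 i * partial i f x| <= m%:R * C * `|d| ^+ 2.
Proof.
move=> r0 fd fL Bx Bd.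
have inr z : `|z - x| <= `|d| -> ball p r z.
  move=> zx; apply/ball_dist; move: Bx Bd => /ball_dist Bx /ball_dist Bd.
  have h1 : `|d| <= `|x + d - p| + `|x - p|.
    have := ler_normB (x + d - p) (x - p); rewrite (_ : x + d - p - (x - p) = d)//.
    by rewrite opprB [x + d]addrC addrA subrK addrK.
  have h2 : `|z - p| <= `|z - x| + `|x - p| by rewrite -(subrKA x) ler_normD.
  by lra.
have Bxr : ball p r x by apply: inr; rewrite subrr normr0.
have [|xi [xiH ->]] := @increment_telescope R m f x d.
  by move=> z /inr Bz i; exact: fd.
rewrite -sumrB; apply: le_trans (ler_norm_sum _ _ _) _.
apply: (@le_trans _ _ (\sum_(i < m) (C * `|d| ^+ 2))).
  apply: ler_sum => i _; rewrite -mulrBr normrM expr2 mulrCA.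
  apply: ler_pM => //; first exact: row_coord_le.
  have [_ h] := fL i _ _ (inr _ (xiH i)) Bxr; apply: le_trans h _.
  apply: ler_wpM2l => //.
  by have [h _] := fL i _ _ Bxr Bxr; exact: le_trans (normr_ge0 _) h.
by rewrite sumr_const card_ord -[leLHS]mulr_natl mulrA.
Qed.

End Bounds.

Section StarFacts.
Context {R : realType} (m : nat) (c : pred 'I_m) (p : 'rV[R]_m).

Lemma star_contract (t : R) (z z' : 'rV[R]_m) : 0 <= t <= 1 ->
  `|star c p t z - star c p t z'| <= `|z - z'|.
Proof.
move=> /andP[t0 t1]; apply/row_norm_le => // i.
have := row_coord_le (z - z') i; rewrite !mxE; case: (c i) => // h.
rewrite (_ : _ - _ = t * (z 0 i - z' 0 i)); last by ring.
by rewrite normrM (ger0_norm t0); apply: le_trans h; rewrite ler_piMl.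
Qed.

Lemma star_sub (t : R) (z z' : 'rV[R]_m) i :
  (star c p t z - star c p t z') 0 i = t ^+ (~~ c i) * (z 0 i - z' 0 i).
Proof. by rewrite !mxE; case: (c i) => /=; rewrite ?expr0 ?expr1; ring. Qed.

End StarFacts.

(** * The radial equation of the leaves *)

Section Leaf.
Context {R : realType} (m : nat) (s : 'I_m) (p : 'rV[R]_m).
Variables (a : 'I_m -> 'rV[R]_m -> R) (r C : R).
Hypotheses (r0 : 0 < r) (C0 : 0 <= C)
  (sa : forall i, smooth (ball p r) (a i))
  (aL : forall i, bounded_lipschitz p r C (a i))
  (daL : forall i j, bounded_lipschitz p r C (partial j (a i))).

Notation ss := (pred1 s).

(** Let the coordinates other than s run along the segment from p_i to z_i. A curve tangent to the
    kernel of dx_s + sum of a_i dx_i then has s-velocity - [radial] t z, where z_s is its current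
    s-coordinate. *)
Definition radial (t : R) (z : 'rV[R]_m) : R :=
  \sum_(i | i != s) (z 0 i - p 0 i) * a i (star ss p t z).

(** Partial derivative of [radial] in z_l; the power of t comes from the contraction by [star]. *)
Definition dradial (t : R) (z : 'rV[R]_m) (l : 'I_m) : R :=
  (l != s)%:R * a l (star ss p t z) +
  \sum_(i | i != s) (z 0 i - p 0 i) * (t ^+ (l != s) * partial l (a i) (star ss p t z)).

Lemma sum_bound (P : pred 'I_m) (F : 'I_m -> R) (c : R) : 0 <= c ->
  (forall i, P i -> `|F i| <= c) -> `|\sum_(i | P i) F i| <= m%:R * c.
Proof.
move=> c0 H; apply: le_trans (ler_norm_sum _ _ _) _.
rewrite big_mkcond; apply: (@le_trans _ _ (\sum_(i < m) c)).
  by apply: ler_sum => i _; case: ifP => // Pi; exact: H.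
by rewrite sumr_const card_ord -[leLHS]mulr_natl.
Qed.

Lemma radial_bound t z (d : R) : 0 <= t <= 1 -> ball p r z -> 0 <= d ->
  (forall i, i != s -> `|z 0 i - p 0 i| <= d) -> `|radial t z| <= m%:R * (d * C).
Proof.
move=> t01 Bz d0 H; apply: sum_bound => [|i /H Hi]; first exact: mulr_ge0.
rewrite normrM; apply: ler_pM => //.
by have Bx := ball_star ss t01 Bz; have [] := aL i Bx Bx.
Qed.

Lemma dradial_bound t z (d : R) : 0 <= t <= 1 -> ball p r z -> 0 <= d ->
  (forall i, i != s -> `|z 0 i - p 0 i| <= d) -> `|dradial t z s| <= m%:R * (d * C).
Proof.
move=> t01 Bz d0 H; rewrite /dradial eqxx mul0r add0r.
apply: sum_bound => [|i /H Hi]; first exact: mulr_ge0.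
rewrite expr0 mul1r normrM; apply: ler_pM => //.
by have Bx := ball_star ss t01 Bz; have [] := daL i s Bx Bx.
Qed.

(** In the direction s the Lipschitz constant carries the displacement d as a factor, so it becomes
    as small as Picard's iteration and Gronwall's estimate demand. *)
Lemma radial_lipschitz_s t (q : 'rV[R]_m) (x y d : R) : 0 <= t <= 1 -> 0 <= d ->
  ball p r (setc s q x) -> ball p r (setc s q y) ->
  (forall i, i != s -> `|q 0 i - p 0 i| <= d) ->
  `|radial t (setc s q x) - radial t (setc s q y)| <= m%:R * (d * C) * `|x - y|.
Proof.
move=> t01 d0 Bx By H; rewrite /radial -sumrB -mulrA.
apply: sum_bound => [|i is']; first by rewrite !mulr_ge0.
have E (z : R) : setc s q z 0 i = q 0 i by rewrite mxE (negbTE is').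
rewrite !E -mulrBr normrM -mulrA; apply: ler_pM => //; first exact: H.
have [_ h] := aL i (ball_star ss t01 Bx) (ball_star ss t01 By).
apply: le_trans h _; apply: ler_wpM2l => //; apply: le_trans (star_contract _ _ _ _ t01) _.
by apply: setc_dist_le => //; rewrite subrr normr0.
Qed.

Lemma star_r3 c t z : 0 <= t <= 1 -> ball p (r / 3) z -> ball p (r / 3) (star c p t z).
Proof. by move=> t01; exact: ball_star. Qed.

Lemma ball_r3 z : ball p (r / 3) z -> ball p r z.
Proof. by have h := r0; apply: le_ball; lra. Qed.

Lemma ball_coord z i : ball p (r / 3) z -> `|z 0 i - p 0 i| <= r.
Proof.
have r0' := r0; move=> /ball_dist H; have := row_coord_le (z - p) i; rewrite !mxE => h.
by apply: le_trans h _; apply: le_trans (ltW H) _; lra.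
Qed.

Lemma radial_lipschitz t z z' : 0 <= t <= 1 -> ball p (r / 3) z -> ball p (r / 3) z' ->
  `|radial t z' - radial t z| <= m%:R * ((1 + r) * C) * `|z' - z|.
Proof.
move=> t01 Bz Bz'; rewrite /radial -sumrB -mulrA.
apply: sum_bound => [|i _]; first by rewrite !mulr_ge0// addr_ge0// ltW.
have Bx := ball_r3 (star_r3 ss t01 Bz); have Bx' := ball_r3 (star_r3 ss t01 Bz').
rewrite (_ : _ - _ = (z' 0 i - z 0 i) * a i (star ss p t z') +
  (z 0 i - p 0 i) * (a i (star ss p t z') - a i (star ss p t z))); last by ring.
apply: le_trans (ler_normD _ _) _.
rewrite -[leRHS]mulrA [leRHS]mulrDl mul1r; apply: lerD.
  rewrite normrM mulrC; apply: ler_pM => //.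
  - by have [] := aL i Bx' Bx'.
  - by have := row_coord_le (z' - z) i; rewrite !mxE.
rewrite normrM; apply: ler_pM => //; first exact: ball_coord.
have [_ h] := aL i Bx' Bx; apply: le_trans h _.
apply: ler_wpM2l => //; exact: star_contract.
Qed.

Lemma radial_taylor t z z' : 0 <= t <= 1 -> ball p (r / 3) z -> ball p (r / 3) z' ->
  `|radial t z' - radial t z - \sum_l (z' 0 l - z 0 l) * dradial t z l|
    <= m%:R * ((1 + r * m%:R) * C) * `|z' - z| ^+ 2.
Proof.
move=> t01 Bz Bz'; set x := star ss p t z; set x' := star ss p t z'.
have Bx : ball p (r / 3) x by exact: star_r3.
have Bx' : ball p (r / 3) x' by exact: star_r3.
have xx' : `|x' - x| <= `|z' - z| by exact: star_contract.
have -> : \sum_l (z' 0 l - z 0 l) * dradial t z l =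
    \sum_(i | i != s) ((z' 0 i - z 0 i) * a i x +
      (z 0 i - p 0 i) * \sum_l (x' - x) 0 l * partial l (a i) x).
  under eq_bigr => l _ do rewrite /dradial mulrDr.
  rewrite !big_split /=; congr (_ + _).
    rewrite [RHS]big_mkcond; apply: eq_bigr => l _; rewrite -/x.
    by case: (l != s); rewrite ?mul1r ?mul0r ?mulr0.
  under eq_bigr => l _ do rewrite mulr_sumr.
  rewrite exchange_big; apply: eq_bigr => i _; rewrite mulr_sumr; apply: eq_bigr => l _.
  by rewrite /x' /x star_sub /=; ring.
rewrite /radial -/x -/x' -sumrB -sumrB -mulrA.
apply: sum_bound => [|i _].
  by rewrite !mulr_ge0 ?exprn_ge0// addr_ge0// mulr_ge0// ltW.
rewrite (_ : _ - _ - _ = (z' 0 i - z 0 i) * (a i x' - a i x) +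
  (z 0 i - p 0 i) * (a i x' - a i x - \sum_l (x' - x) 0 l * partial l (a i) x)); last by ring.
apply: le_trans (ler_normD _ _) _.
rewrite -mulrA [leRHS]mulrDl mul1r; apply: lerD; rewrite normrM.
  rewrite expr2 mulrCA; apply: ler_pM => //.
    by have := row_coord_le (z' - z) i; rewrite !mxE.
  have [_ h] := aL i (ball_r3 Bx') (ball_r3 Bx); apply: le_trans h _.
  exact: ler_wpM2l.
rewrite -mulrA; apply: ler_pM => //; first exact: ball_coord.
have -> : x' = x + (x' - x) by rewrite addrC subrK.
rewrite [x + (x' - x) - x]addrC addKr mulrA.
apply: (@le_trans _ _ (m%:R * C * `|x' - x| ^+ 2)).
  apply: taylor1 r0 _ (daL i) Bx _.
    by move=> y j By; exact: ((sa i 1%N).2 j).1.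
  by rewrite addrC subrK.
by apply: ler_wpM2l; [exact: mulr_ge0|rewrite lerXn2r ?nnegrE].
Qed.

Lemma continuous_sum_at (T : topologicalType) (P : pred 'I_m) (F : 'I_m -> T -> R) (t : T) :
  (forall i, P i -> {for t, continuous (F i)}) ->
  {for t, continuous (fun t => \sum_(i | P i) F i t)}.
Proof.
move=> H; elim: (index_enum _) => [|i l IH].
  rewrite (_ : (fun t => _) = fun _ => 0); first exact: cst_continuous.
  by apply/funext => x; rewrite big_nil.
rewrite (_ : (fun t => _) =
    if P i then fun t => F i t + \sum_(i <- l | P i) F i t else fun t => \sum_(i <- l | P i) F i t).
  by case Pi: (P i) => //; apply: continuousD => //; exact: H.
by apply/funext => x; rewrite big_cons; case: (P i).
Qed.

Lemma star_curve_continuous (c : R -> R) (Z : R -> 'rV[R]_m) (t : R) :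
  {for t, continuous c} -> {for t, continuous Z} ->
  {for t, continuous (fun t => star ss p (c t) (Z t))}.
Proof.
move=> cc cZ; have cZi i : {for t, continuous (fun t => Z t 0 i)}.
  apply: (@continuous_comp _ _ _ Z (fun z => z 0 i)) => //; exact: coord_continuous.
apply: row_continuous => i.
rewrite (_ : (fun t => _) =
    if ss i then fun t => Z t 0 i else fun t => p 0 i + c t * (Z t 0 i - p 0 i)); last first.
  by apply/funext => x; rewrite mxE; case: (ss i).
case: (ss i) => //; apply: continuousD; first exact: cst_continuous.
apply: continuousM => //; apply: continuousB => //; exact: cst_continuous.
Qed.

Lemma radial_continuous (c : R -> R) (Z : R -> 'rV[R]_m) (t : R) :
  {for t, continuous c} -> {for t, continuous Z} -> ball p r (star ss p (c t) (Z t)) ->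
  {for t, continuous (fun t => radial (c t) (Z t))}.
Proof.
move=> cc cZ B; have cs := star_curve_continuous cc cZ.
apply: continuous_sum_at => i _; apply: continuousM.
  apply: continuousB; last exact: cst_continuous.
  apply: (@continuous_comp _ _ _ Z (fun z => z 0 i)) => //; exact: coord_continuous.
apply: (@continuous_comp _ _ _ (fun t => star ss p (c t) (Z t)) (a i)) => //.
exact: (sa i 0%N).1.
Qed.

(** A leaf starts within delta <= r / 12 of p_s and moves by at most m delta C <= r / 12, so it
    stays within r / 6; 1/4 is the Lipschitz constant of [picard]. *)
Variable delta : R.
Hypotheses (d0 : 0 < delta) (dr : delta <= r / 12) (dC : m%:R * (delta * C) <= r / 12)
  (d4 : m%:R * (delta * C) <= 4^-1).

Definition clamp01 (t : R) : R := Num.max 0 (Num.min 1 t).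

Lemma clamp01I t : 0 <= clamp01 t <= 1.
Proof. by rewrite /clamp01 le_max lexx /= ge_max ge_min lexx /= ler01. Qed.

Lemma clamp01_id (t : R) : 0 <= t <= 1 -> clamp01 t = t.
Proof. by move=> /andP[t0 t1]; rewrite /clamp01 min_r// max_r. Qed.

Lemma clamp01_continuous : continuous clamp01.
Proof.
move=> t; apply/continuous_dist => e e0; exists e => // x.
exact: le_lt_trans (clamp_dist _ _ _ _).
Qed.

Lemma setc_r3 (q : 'rV[R]_m) (x : R) : ball p delta q -> `|x - p 0 s| < r / 3 ->
  ball p (r / 3) (setc s q x).
Proof.
have r0' := r0; have dr' := dr; move=> /(row_ballP _ _ d0) Bq xp; apply/row_ballP => [|i]; first by lra.
rewrite mxE; case: eqP => [->//|_]; apply: lt_le_trans (Bq i) _.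
by lra.
Qed.

(** At time 0 the leaf lies over p with s-coordinate q_s; at time 1 it lies over q, and [sigma q 1]
    is its height there. *)
Definition is_leaf (sigma : 'rV[R]_m -> R -> R) := forall q, ball p delta q ->
  [/\ continuous (sigma q), sigma q 0 = q 0 s,
      forall t : R, 0 <= t <= 1 -> `|sigma q t - p 0 s| < r / 3 &
      forall t : R, 0 <= t <= 1 ->
        is_derive t 1 (sigma q) (- radial t (setc s q (sigma q t)))].

(* Picard's theorem is applied after clamping t to [0, 1] and the s-coordinate to
   a neighbourhood of p; the solution does not reach the bounds. *)
Lemma leaf_exists : exists sigma, is_leaf sigma.
Proof.
suff H q : exists x : R -> R, ball p delta q ->
  [/\ continuous x, x 0 = q 0 s,
      forall t : R, 0 <= t <= 1 -> `|x t - p 0 s| < r / 3 &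
      forall t : R, 0 <= t <= 1 ->
        is_derive t 1 x (- radial t (setc s q (x t)))].
  by exists (fun q => sval (cid (H q))) => q Bq; case: cid => x; apply.
have r0' := r0; have dr' := dr; have d0' := d0; have d4' := d4.
have [Bq|nB] := pselect (ball p delta q); last by exists (fun=> 0).
pose lo := p 0 s - r / 6; pose hi := p 0 s + r / 6.
pose cx (x : R) := Num.max lo (Num.min hi x).
have lohi : lo <= hi by rewrite /lo /hi; lra.
have cxI x : lo <= cx x <= hi.
  by rewrite /cx le_max lexx /= ge_max ge_min lexx /= lohi.
have cxp x : `|cx x - p 0 s| < r / 3.
  by have /andP[] := cxI x; rewrite /lo /hi => h1 h2; apply/ltr_normlP; split; lra.
have B3 x : ball p (r / 3) (setc s q (cx x)) by exact: setc_r3.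
have qd i : i != s -> `|q 0 i - p 0 i| <= delta.
  by move=> _; have /(row_ballP _ _ d0)/(_ i)/ltW := Bq.
have sd x i : i != s -> `|setc s q x 0 i - p 0 i| <= delta.
  by move=> nis; rewrite mxE (negbTE nis); exact: qd.
pose H (t x : R) := - radial (clamp01 t) (setc s q (cx x)).
have HA t x : `|H t x| <= m%:R * (delta * C).
  rewrite normrN; apply: radial_bound; [exact: clamp01I|exact/ball_r3/B3|exact: ltW|exact: sd].
have HL t x y : `|H t x - H t y| <= 4^-1 * `|x - y|.
  rewrite /H -opprD normrN.
  apply: le_trans (radial_lipschitz_s (clamp01I t) (ltW d0) (ball_r3 (B3 x)) (ball_r3 (B3 y)) qd) _.
  by apply: ler_pM => //; [rewrite !mulr_ge0// ltW|exact: clamp_dist].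
have Hc (x : R -> R) : continuous x -> continuous (fun t => H t (x t)).
  move=> cX t.
  have h : {for t, continuous (fun t => radial (clamp01 t) (setc s q (cx (x t))))}.
    apply: radial_continuous.
    - exact: clamp01_continuous.
    - apply/continuous_dist => e e0.
      have [d dd0 dH] := (continuous_dist _ _).1 (cX t) _ e0; exists d => // t' /dH h.
      apply: setc_dist => //; first by rewrite subrr normr0.
      exact: le_lt_trans (clamp_dist _ _ _ _) h.
    - by apply: ball_star; [exact: clamp01I|exact: ball_r3].
  exact: (cvgN h).
have [x [cX x0 dX]] := picard (q 0 s) Hc HL HA.
have dX1 (t : R) : 0 <= t <= 1 -> is_derive t 1 x (H t (x t)).
  by move=> /andP[t0 t1]; apply: dX; apply/andP; split; lra.
have xq (t : R) : 0 <= t <= 1 -> `|x t - q 0 s| <= r / 12.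
  move=> t01; rewrite -x0.
  have I0 : 0 <= (0 : R) <= 1 by rewrite lexx ler01.
  have := MVT_bound I0 t01 dX1 (fun s _ => HA s (x s)); rewrite subr0 => h.
  apply: le_trans h _; apply: le_trans dC; case/andP: t01 => t0 t1.
  by rewrite ger0_norm// ler_piMr// !mulr_ge0// ltW.
have qs : `|q 0 s - p 0 s| < delta by have /(row_ballP _ _ d0) := Bq; apply.
exists x => _; split => // t t01.
  have h1 := xq _ t01; rewrite -(subrKA (q 0 s)); apply: le_lt_trans (ler_normD _ _) _.
  by lra.
suff cxx : cx (x t) = x t by have := dX1 t t01; rewrite /H clamp01_id// cxx.
have h2 : `|x t - p 0 s| <= r / 6.
  rewrite -(subrKA (q 0 s)); apply: le_trans (ler_normD _ _) _.
  by have := xq _ t01; lra.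
move: h2 => /ler_normlP[h2 h3].
by rewrite /cx min_r ?max_r // /lo /hi; lra.
Qed.

End Leaf.

(** * Dependence of the leaves on the end point *)

Section LeafDerivative.
Context {R : realType} (m : nat) (s : 'I_m) (p : 'rV[R]_m).
Variables (a : 'I_m -> 'rV[R]_m -> R) (r C : R).
Hypotheses (r0 : 0 < r) (C0 : 0 <= C)
  (sa : forall i, smooth (ball p r) (a i))
  (aL : forall i, bounded_lipschitz p r C (a i))
  (daL : forall i j, bounded_lipschitz p r C (partial j (a i))).
Variable delta : R.
Hypotheses (d0 : 0 < delta) (dr : delta <= r / 12)
  (d4 : m%:R * (delta * C) <= 4^-1).
Variable sigma : 'rV[R]_m -> R -> R.
Hypothesis leaf : is_leaf s p a r delta sigma.

Notation ss := (pred1 s).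
Notation rad := (@radial R m s p a).
Notation drad := (@dradial R m s p a).

Let S q := sigma q 1.
(** The straightening map: it sends the slice q_s = c into the leaf that meets the s-line through p
    at height c. *)
Let Phi q := setc s q (S q).

Let I0 : 0 <= (0 : R) <= 1. Proof. by rewrite lexx ler01. Qed.
Let I1 : 0 <= (1 : R) <= 1. Proof. by rewrite lexx ler01. Qed.

Let qd q i : ball p delta q -> i != s -> `|q 0 i - p 0 i| <= delta.
Proof. by move=> /(row_ballP _ _ d0) Bq _; exact/ltW/Bq. Qed.

Lemma leaf_in q (t : R) : ball p delta q -> 0 <= t <= 1 -> ball p (r / 3) (setc s q (sigma q t)).
Proof. by move=> Bq t01; have [_ _ H _] := leaf Bq; apply: (setc_r3 r0 d0 dr Bq); exact: H. Qed.

Lemma leaf_unique q (y : R -> R) : ball p delta q -> y 0 = q 0 s ->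
  (forall t : R, 0 <= t <= 1 -> `|y t - p 0 s| < r / 3) ->
  (forall t : R, 0 <= t <= 1 -> is_derive t 1 y (- rad t (setc s q (y t)))) ->
  forall t : R, 0 <= t <= 1 -> y t = sigma q t.
Proof.
move=> Bq y0 yp dy t t01; have [_ s0 sp ds] := leaf Bq.
apply/eqP; rewrite -subr_eq0 -normr_le0.
have D (x : R) : 0 <= x <= 1 -> is_derive x 1 (fun t => y t - sigma q t)
    (- rad x (setc s q (y x)) - - rad x (setc s q (sigma q x))).
  by move=> I; exact: is_deriveB (dy x I) (ds x I).
have := @gronwall01 R _ _ 0 D _ t t01; rewrite y0 s0 subrr normr0 addr0 mulr0; apply.
move=> x x01; rewrite addr0 -opprD normrN.
have B1 : ball p r (setc s q (y x)) by apply: ball_r3 => //; apply: (setc_r3 r0 d0 dr Bq); exact: yp.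
have B2 : ball p r (setc s q (sigma q x)) by apply: ball_r3 => //; exact: leaf_in.
apply: le_trans (radial_lipschitz_s C0 aL x01 (ltW d0) B1 B2 (fun i => @qd q i Bq)) _.
by apply: ler_wpM2r => //; apply: le_trans d4 _; lra.
Qed.

Lemma star_delta q (t : R) : ball p delta q -> 0 <= t <= 1 -> ball p delta (star ss p t q).
Proof. by move=> Bq t01; exact: ball_star. Qed.

(** Rescaling time by t turns the leaf towards q into the leaf towards the intermediate point, and
    uniqueness identifies them. Thus a whole leaf is recorded by the values of S. *)
Lemma leaf_star q (t : R) : ball p delta q -> 0 <= t <= 1 -> S (star ss p t q) = sigma q t.
Proof.
move=> Bq t01; have [_ s0 sp ds] := leaf Bq; have /andP[t0 t1] := t01.
have tI (x : R) : 0 <= x <= 1 -> 0 <= t * x <= 1.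
  by move=> /andP[x0 x1]; rewrite mulr_ge0//= mulr_ile1.
rewrite /S -[in RHS](mulr1 t); apply/esym.
apply: (@leaf_unique _ (fun x => sigma q (t * x)) (star_delta Bq t01) _ _ _ 1 I1).
- by rewrite mulr0 s0 mxE /= eqxx.
- by move=> x /tI; exact: sp.
move=> x x01; have H1 : is_derive x 1 (fun x : R => t * x) t.
  have := is_deriveZ t (is_derive_id x (1 : R)).
  by rewrite -[t *: 1]/(t * 1) mulr1.
have H2 := @is_derive1_comp R (sigma q) (fun x => t * x) x _ _ (ds _ (tI _ x01)) H1.
apply: is_derive_eq H2 _; rewrite mulrC mulrN; congr (- _).
rewrite /radial mulr_sumr; apply: eq_bigr => i nis.
have -> : setc s (star ss p t q) (sigma q (t * x)) 0 i - p 0 i = t * (q 0 i - p 0 i).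
  by rewrite !mxE /= !(negbTE nis) [p 0 i + _]addrC addrK.
have -> : setc s q (sigma q (t * x)) 0 i = q 0 i by rewrite mxE (negbTE nis).
rewrite mulrA; congr (_ * a i _).
apply/rowP => l; rewrite !mxE /=; case: eqP => // _.
by rewrite [p 0 l + t * _]addrC addrK mulrA [x * t]mulrC.
Qed.

Lemma Phi_star q (t : R) : ball p delta q -> 0 <= t <= 1 ->
  star ss p t (setc s q (sigma q t)) = Phi (star ss p t q).
Proof.
move=> Bq t01; rewrite /Phi leaf_star//; apply/rowP => i.
by rewrite !mxE /=; case: eqP.
Qed.

Lemma Phi_in q : ball p delta q -> ball p r (Phi q).
Proof. by move=> Bq; apply: ball_r3 => //; exact: leaf_in. Qed.

(** Gronwall's 2 (|y 0| + C), per unit of |q' - q|, with the Lipschitz constant of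
    [radial_lipschitz]. *)
Definition leaf_lip : R := 2 * (1 + m%:R * ((1 + r) * C)).

Lemma leaf_lip_ge0 : 0 <= leaf_lip.
Proof. by rewrite /leaf_lip mulr_ge0// addr_ge0// !mulr_ge0// addr_ge0// ltW. Qed.

Lemma leaf_lipschitz q q' (t : R) : ball p delta q -> ball p delta q' -> 0 <= t <= 1 ->
  `|sigma q' t - sigma q t| <= leaf_lip * `|q' - q|.
Proof.
move=> Bq Bq' t01; have [_ s0 sp ds] := leaf Bq; have [_ s0' sp' ds'] := leaf Bq'.
have D (x : R) : 0 <= x <= 1 -> is_derive x 1 (fun t => sigma q' t - sigma q t)
    (- rad x (setc s q' (sigma q' x)) - - rad x (setc s q (sigma q x))).
  by move=> I; exact: is_deriveB (ds' x I) (ds x I).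
have := @gronwall01 R _ _ (m%:R * ((1 + r) * C) * `|q' - q|) D _ t t01; rewrite s0 s0' => H.
apply: le_trans (H _) _.
  move=> x x01; rewrite -opprD normrN.
  have B1 : ball p (r / 3) (setc s q (sigma q x)) by exact: leaf_in.
  have B2 : ball p (r / 3) (setc s q' (sigma q' x)) by exact: leaf_in.
  have B3 : ball p (r / 3) (setc s q (sigma q' x)) by apply: (setc_r3 r0 d0 dr Bq); exact: sp'.
  rewrite -(subrKA (rad x (setc s q (sigma q' x)))) addrC.
  apply: le_trans (ler_normD _ _) _; apply: lerD.
    apply: le_trans (radial_lipschitz_s C0 aL x01 (ltW d0) (ball_r3 r0 B3) (ball_r3 r0 B1) (fun i => @qd q i Bq)) _.
    by apply: ler_wpM2r => //; apply: le_trans d4 _; lra.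
  apply: le_trans (radial_lipschitz s r0 C0 aL x01 B3 B2) _.
  apply: ler_wpM2l; first by rewrite !mulr_ge0// addr_ge0// ltW.
  by apply: setc_dist_le => //; rewrite subrr normr0.
rewrite /leaf_lip -[leRHS]mulrA; apply: ler_wpM2l => //; rewrite [leRHS]mulrDl mul1r lerD2r.
by have := row_coord_le (q' - q) s; rewrite !mxE.
Qed.

Lemma leaf_continuous q : ball p delta q -> {for q, continuous S}.
Proof.
move=> Bq; apply/continuous_dist => e e0.
have /nbhs_ballP[d /= dd0 dH] := open_nbhs_nbhs (conj (ball_open p delta) Bq).
have K0 : 0 < leaf_lip + 1 by have := leaf_lip_ge0; lra.
exists (Num.min d (e / (leaf_lip + 1))); first by rewrite lt_min dd0 divr_gt0.
move=> x; rewrite lt_min => /andP[x1 x2].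
apply: le_lt_trans (leaf_lipschitz Bq _ I1) _; first exact/dH/ball_dist.
apply: (@le_lt_trans _ _ ((leaf_lip + 1) * `|x - q|)).
  by apply: ler_wpM2r => //; lra.
by rewrite mulrC -ltr_pdivlMr.
Qed.

(* u solves the linearized equation along the leaf. *)
Lemma leaf_derive q (j : 'I_m) (u : R -> R) : ball p delta q -> u 0 = (j == s)%:R ->
  (forall t : R, 0 <= t <= 1 -> is_derive t 1 u
    (- ((j != s)%:R * drad t (setc s q (sigma q t)) j +
        u t * drad t (setc s q (sigma q t)) s))) ->
  is_derive q (delta_mx 0 j) S (u 1).
Proof.
move=> Bq u0 du; have [_ s0 sp ds] := leaf Bq.
have /nbhs_ballP[d /= dd0 dH] := open_nbhs_nbhs (conj (ball_open p delta) Bq).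
(* With |z' - z| <= (1 + [leaf_lip]) |h|, the remainder of [radial_taylor] is at most K h^2;
   Gronwall's estimate doubles it. *)
pose K := m%:R * ((1 + r * m%:R) * C) * (1 + leaf_lip) ^+ 2.
have K0 : 0 <= K.
  rewrite /K; apply: mulr_ge0 (sqr_ge0 _); apply: mulr_ge0 => //; apply: mulr_ge0 => //.
  by rewrite addr_ge0// mulr_ge0// ltW.
suff H (h : R) : `|h| < d -> `|S (h *: delta_mx 0 j + q) - S q - h * u 1| <= 2 * K * h ^+ 2.
  suff H1 : (fun h : R => h^-1 *: (S (h *: delta_mx 0 j + q) - S q)) @ 0^' --> u 1.
    by split; [apply/cvg_ex; exists (u 1)|exact/cvg_lim].
  apply/cvgrPdist_le => e e0; have K1 : 0 < 2 * K + 1 by lra.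
  near=> h.
  have h0 : h != 0 by near: h; exact: nbhs_dnbhs_neq.
  have hd : `|h| < Num.min d (e / (2 * K + 1)).
    by near: h; apply: dnbhs0_lt; rewrite lt_min dd0 divr_gt0.
  have {hd}[hd he] : `|h| < d /\ `|h| < e / (2 * K + 1) by apply/andP; rewrite -lt_min.
  rewrite -[h^-1 *: _]/(h^-1 * _) distrC.
  rewrite (_ : _ - _ = h^-1 * (S (h *: delta_mx 0 j + q) - S q - h * u 1)); last by field.
  rewrite normrM normfV ler_pdivrMl ?normr_gt0//.
  apply: le_trans (H _ hd) _; rewrite -[h ^+ 2]ger0_norm ?sqr_ge0// normrX expr2 mulrCA.
  apply: ler_wpM2l => //; move: he; rewrite ltr_pdivlMr// => he.
  by have := normr_ge0 h; nra.
move=> hd; pose q' := h *: delta_mx 0 j + q.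
have q'q : `|q' - q| <= `|h|.
  rewrite /q' addrK; apply/row_norm_le => // i; rewrite !mxE eqxx /= normrM.
  by case: eqP => _; rewrite ?normr1 ?normr0 ?mulr0 ?mulr1.
have Bq' : ball p delta q' by apply/dH/ball_dist; exact: le_lt_trans hd.
have [_ s0' sp' ds'] := leaf Bq'.
have D (x : R) : 0 <= x <= 1 -> is_derive x 1 (fun t => sigma q' t - sigma q t - h * u t)
    (- rad x (setc s q' (sigma q' x)) - - rad x (setc s q (sigma q x)) -
     h * - ((j != s)%:R * drad x (setc s q (sigma q x)) j +
        u x * drad x (setc s q (sigma q x)) s)).
  move=> I; apply: is_deriveB; first exact: is_deriveB (ds' x I) (ds x I).
  apply: is_derive_eq (is_deriveM (is_derive_cst h x (1 : R)) (du x I)) _.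
  by rewrite scaler0 addr0.
have := @gronwall01 R _ _ (K * h ^+ 2) D _ 1 I1.
have -> : sigma q' 0 - sigma q 0 - h * u 0 = 0.
  by rewrite s0 s0' u0 /q' !mxE eqxx /= [s == j]eq_sym; ring.
rewrite normr0 add0r [2 * (K * _)]mulrA; apply => t t01.
set z := setc s q (sigma q t); set z' := setc s q' (sigma q' t).
have Bz : ball p (r / 3) z by exact: leaf_in.
have Bz' : ball p (r / 3) z' by exact: leaf_in.
have zz' : `|z' - z| <= (1 + leaf_lip) * `|h|.
  have L0 := leaf_lip_ge0.
  apply: setc_dist_le; first by rewrite mulr_ge0// addr_ge0.
    by apply: le_trans q'q _; rewrite mulrDl mul1r lerDl mulr_ge0.
  apply: le_trans (leaf_lipschitz Bq Bq' t01) _; rewrite mulrDl mul1r.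
  by apply: ler_wpDl => //; exact: ler_wpM2l.
have T := radial_taylor s r0 C0 sa aL daL t01 Bz Bz'.
have E : \sum_l (z' 0 l - z 0 l) * drad t z l =
    h * ((j != s)%:R * drad t z j) + (sigma q' t - sigma q t) * drad t z s.
  rewrite (bigD1 s)//= !mxE eqxx addrC; congr (_ + _).
  have zl l : l != s -> z' 0 l - z 0 l = h * (l == j)%:R.
    by move=> nls; rewrite !mxE (negbTE nls) /= addrK.
  have [js|js] := eqVneq j s.
    rewrite mul0r mulr0 big1// => l nls; rewrite zl// js (negbTE nls).
    by rewrite mulr0 mul0r.
  rewrite (bigD1 j)//= zl// eqxx big1 => [|l /andP[nls nlj]]; first by rewrite mulr1 mul1r addr0.
  by rewrite zl// (negbTE nlj) mulr0 mul0r.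
rewrite E in T.
set A := rad t z' in T *; set B := rad t z in T *.
set y := sigma q' t - sigma q t - h * u t.
set P := drad t z j in T *; set Q := drad t z s in T *.
have -> : - A - - B - h * - ((j != s)%:R * P + u t * Q) =
    - (A - B - (h * ((j != s)%:R * P) + (sigma q' t - sigma q t) * Q)) - y * Q.
  by rewrite /y; move: (A) (B) (P) (Q) (u t) (sigma q' t) (sigma q t) => *; ring.
apply: le_trans (ler_normB _ _) _; rewrite normrN addrC; apply: lerD.
  rewrite normrM mulrC; apply: ler_wpM2r => //.
  apply: le_trans (dradial_bound C0 daL t01 (ball_r3 r0 Bz) (ltW d0) _) _; last by apply: le_trans d4 _; lra.
  by move=> i nis; rewrite mxE (negbTE nis); exact: qd.
apply: le_trans T _; rewrite /K -[leRHS]mulrA; apply: ler_wpM2l.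
  by rewrite !mulr_ge0// addr_ge0// mulr_ge0// ltW.
rewrite -[h ^+ 2]ger0_norm ?sqr_ge0// normrX -exprMn; apply: lerXn2r; rewrite ?nnegrE//.
by rewrite mulr_ge0// addr_ge0// leaf_lip_ge0.
Unshelve. all: by end_near. Qed.

End LeafDerivative.

(** * Smoothness of the straightening map *)

Section LeafSmooth.
Context {R : realType} (m : nat) (s : 'I_m) (p : 'rV[R]_m).
Variables (a : 'I_m -> 'rV[R]_m -> R) (r C : R).
Hypotheses (r0 : 0 < r) (C0 : 0 <= C)
  (sa : forall i, smooth (ball p r) (a i))
  (aL : forall i, bounded_lipschitz p r C (a i))
  (daL : forall i j, bounded_lipschitz p r C (partial j (a i))).
(** Integrability of dx_s + sum of a_i dx_i: the fields d/dx_i - a_i d/dx_s commute. *)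
Hypothesis integrable_a : forall i j q, i != s -> j != s -> ball p r q ->
  partial i (a j) q - partial j (a i) q =
  a i q * partial s (a j) q - a j q * partial s (a i) q.
Variable delta : R.
Hypotheses (d0 : 0 < delta) (dr : delta <= r / 12)
  (d4 : m%:R * (delta * C) <= 4^-1).
Variable sigma : 'rV[R]_m -> R -> R.
Hypothesis leaf : is_leaf s p a r delta sigma.

Notation ss := (pred1 s).
Notation rad := (@radial R m s p a).
Notation drad := (@dradial R m s p a).
Notation S := (fun q => sigma q 1).
Notation Phi := (fun q => setc s q (sigma q 1)).

Lemma leaf_center : sigma p 1 = p 0 s.
Proof.
have Bp : ball p delta p by exact: ballxx.
have I1 : 0 <= (1 : R) <= 1 by rewrite lexx ler01.
apply/esym.
apply: (leaf_unique r0 C0 aL d0 dr d4 leaf (y := fun _ => p 0 s) Bp _ _ _ I1) => //.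
  by move=> t _; rewrite subrr normr0; have := r0; lra.
move=> t _; rewrite (_ : rad _ _ = 0) ?oppr0; first exact: is_derive_cst.
by rewrite /radial big1// => i nis; rewrite mxE (negbTE nis) subrr mul0r.
Qed.

(** By integrability - t a_j along the leaf solves the linearized equation. So the surface swept out
    by the radial curves is tangent to the kernel of the form in all directions, not only in the
    radial ones. *)
Lemma leaf_partial j q : j != s -> ball p delta q ->
  is_derive q (delta_mx 0 j) S (- a j (Phi q)).
Proof.
move=> js Bq; have [_ s0 sp ds] := leaf Bq.
pose gam t := star ss p t (setc s q (sigma q t)).
pose u t := - (t * a j (gam t)).
have -> : - a j (Phi q) = u 1 by rewrite /u /gam star1 mul1r.
apply: (leaf_derive r0 C0 sa aL daL d0 dr d4 leaf Bq).
  by rewrite /u mul0r oppr0 (negbTE js).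
move=> t t01; have Bg : ball p r (gam t).
  by apply: (ball_star _ t01); exact: (ball_r3 r0 (leaf_in r0 d0 dr leaf Bq t01)).
have dg l : is_derive t 1 (fun t => gam t 0 l)
    (if l == s then - rad t (setc s q (sigma q t)) else q 0 l - p 0 l).
  rewrite (_ : (fun t => _) = if l == s then sigma q else fun t => p 0 l + t * (q 0 l - p 0 l)); last first.
    by apply/funext => x; rewrite !mxE /=; case: (l == s).
  case: (l == s); first exact: ds.
  apply: is_derive_eq (is_deriveD (is_derive_cst (p 0 l) t (1 : R))
    (is_deriveM (is_derive_id t (1 : R)) (is_derive_cst (q 0 l - p 0 l) t (1 : R)))) _.
  by rewrite add0r scaler0 add0r -[_ *: 1]/(_ * 1) mulr1.
have dj : differentiable (a j) (gam t).
  by apply: (@class_C1_differentiable _ _ (ball p r)) => //; [exact: ball_open|exact: sa].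
have dgd l : differentiable (fun t => gam t 0 l) t.
  by apply/derivable1_diffP; have [] := dg l.
have H := is_derive_chain (1 : R) dj dgd.
have HM := is_deriveN (is_deriveM (is_derive_id t (1 : R)) H).
apply: is_derive_eq HM _.
have -> : \sum_l 'D_1 (fun t => gam t 0 l) t * partial l (a j) (gam t) =
    \sum_(i | i != s) (q 0 i - p 0 i) *
      (partial j (a i) (gam t) - a j (gam t) * partial s (a i) (gam t)).
  rewrite (bigD1 s)//=; have [_ ->] := dg s; rewrite eqxx /radial mulNr mulr_suml -sumrN.
  rewrite -big_split /=; apply: eq_bigr => i nis.
  have [_ ->] := dg i; rewrite (negbTE nis) mxE (negbTE nis) -/(gam t).
  rewrite -mulrA -mulrN -mulrDr; congr (_ * _).
  have := integrable_a nis js Bg => /eqP.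
  by rewrite subr_eq => /eqP ->; ring.
rewrite /dradial js eqxx /= mul0r add0r -[_ *: 1]/(_ * 1) mulr1 -[_ *: _]/(t * _).
congr (- _); rewrite !mul1r -/(gam t) /u mulNr addrC -[in RHS]addrA; congr (_ + _).
rewrite !mulr_sumr -sumrB; apply: eq_bigr => i nis.
by rewrite mxE (negbTE nis) expr1 expr0; ring.
Qed.

Lemma Phi_continuous q : ball p delta q -> {for q, continuous Phi}.
Proof.
move=> Bq; apply/continuous_dist => e e0.
have Sc := leaf_continuous r0 C0 aL d0 dr d4 leaf Bq.
have [d dd0 dH] := (continuous_dist _ _).1 Sc _ e0.
exists (Num.min d e); first by rewrite lt_min dd0.
move=> x; rewrite lt_min => /andP[x1 x2]; apply: setc_dist => //; exact: dH.
Qed.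

(** The value at time 1 of the solution of the linearized equation in the direction s. By [Phi_star]
    the integral along the leaf becomes one of a function of Phi, and so inherits the regularity of
    S. *)
Definition leaf_factor (q : 'rV[R]_m) : R := expR (- \sum_(i | i != s) (q 0 i - p 0 i) *
  star_int ss p 0 (fun x => partial s (a i) (Phi x)) q).

Lemma leaf_partial_s q : ball p delta q ->
  is_derive q (delta_mx 0 s) S (leaf_factor q).
Proof.
move=> Bq; have [sc s0 sp ds] := leaf Bq.
have Bd (t : R) : 0 <= t <= 1 -> ball p r (star ss p t (setc s q (sigma q t))).
  by move=> t01; apply: (ball_star _ t01); exact: (ball_r3 r0 (leaf_in r0 d0 dr leaf Bq t01)).
(* The clamping makes f continuous on the whole line, as [is_derive_prim] requires. *)
pose f (t : R) := \sum_(i | i != s) (q 0 i - p 0 i) *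
  partial s (a i) (star ss p (clamp01 t) (setc s q (sigma q (clamp01 t)))).
have fc : continuous f.
  move=> t; apply: continuous_sum_at => i _; apply: continuousM; first exact: cst_continuous.
  apply: (@continuous_comp _ _ _ (fun t => star ss p (clamp01 t) (setc s q (sigma q (clamp01 t)))) (partial s (a i))).
    apply: star_curve_continuous; first exact: clamp01_continuous.
    apply/continuous_dist => e e0.
    have c : {for t, continuous (fun t => sigma q (clamp01 t))}.
      by apply: continuous_comp; [exact: clamp01_continuous|exact: sc].
    have [d dd0 dH] := (continuous_dist _ _).1 c _ e0; exists d => // t' /dH h.
    by apply: setc_dist => //; rewrite subrr normr0.
  apply: ((sa i 1%N).2 s).2.1; apply: Bd; exact: clamp01I.
have fE : prim f 1 = \sum_(i | i != s) (q 0 i - p 0 i) *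
    star_int ss p 0 (fun x => partial s (a i) (Phi x)) q.
  have pc i : continuous01 (fun t => partial s (a i) (Phi (star ss p t q))).
    apply: (@star_continuous01 _ _ ss p (ball p delta) _ (fun x => partial s (a i) (Phi x)) q) => //.
      by move=> x t Bx t01; exact: ball_star.
    move=> x Bx; apply: (@continuous_comp _ _ _ Phi (partial s (a i))); first exact: Phi_continuous.
    apply: ((sa i 1%N).2 s).2.1; exact: (Phi_in r0 d0 dr leaf).
  have D (t : R) : 0 <= t <= 1 -> is_derive t 1 (prim f) (f t).
    by move=> /andP[t0 t1]; apply: is_derive_prim => //; apply/andP; split; lra.
  have fc01 : continuous01 f by move=> t _; exact: fc.
  have := int01_FTC fc01 D; rewrite prim0 subr0 => <-.
  rewrite [RHS](_ : _ = \sum_i int01 (fun t => if i != s then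
      (q 0 i - p 0 i) * (t ^+ 0 * partial s (a i) (Phi (star ss p t q))) else 0)); last first.
    rewrite big_mkcond; apply: eq_bigr => i _.
    case: (i != s) => /=; last by rewrite int01_cst.
    rewrite /star_int -int01Z//.
    by apply: continuous01M; [exact: continuous01X|exact: pc].
  rewrite -int01_sum; last first.
    move=> i; case: (i != s); last exact: continuous01_cst.
    apply: continuous01M; first exact: continuous01_cst.
    by apply: continuous01M; [exact: continuous01X|exact: pc].
  apply: int01_eq => t t01; rewrite /f big_mkcond; apply: eq_bigr => i _.
  case: (i != s) => //; rewrite clamp01_id// expr0 mul1r.
  by rewrite (Phi_star r0 C0 aL d0 dr d4 leaf Bq t01).
rewrite /leaf_factor -fE.
apply: (leaf_derive r0 C0 sa aL daL d0 dr d4 leaf Bq (u := fun t => expR (- prim f t))).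
  by rewrite prim0 oppr0 expR0 eqxx.
move=> t t01; have /andP[t0 t1] := t01.
have D : is_derive t 1 (prim f) (f t).
  by apply: is_derive_prim => //; apply/andP; split; lra.
have H := @is_derive1_comp R expR (fun t => - prim f t) t _ _ (is_derive_expR _) (is_deriveN D).
apply: is_derive_eq H _; rewrite eqxx mul0r add0r mulrN; congr (- (_ * _)).
rewrite /f /dradial eqxx mul0r add0r clamp01_id//; apply: eq_bigr => i nis.
by rewrite mxE (negbTE nis) expr0 mul1r.
Qed.

Lemma class_C_Phi k : class_C k (ball p delta) S ->
  forall i, class_C k (ball p delta) (fun q => Phi q 0 i).
Proof.
move=> HS i; have [->|nis] := eqVneq i s.
  by apply: class_C_eq HS => [|q _]; [exact: ball_open|rewrite setcE].
have := class_C_coord k (ball p delta) i; apply: class_C_eq; first exact: ball_open.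
by move=> q _; rewrite mxE (negbTE nis).
Qed.

Lemma smooth_leaf : smooth (ball p delta) S.
Proof.
have oB : open (ball p delta) by exact: ball_open.
have oBr : open (ball p r) by exact: ball_open.
have Sc q : ball p delta q -> {for q, continuous S}.
  exact: (leaf_continuous r0 C0 aL d0 dr d4 leaf).
have Pin q : ball p delta q -> ball p r (Phi q) by exact: (Phi_in r0 d0 dr leaf).
elim=> [|k IH]; first by split.
split => // j; have HP := class_C_Phi IH.
have [->|js] := eqVneq j s.
  split; first by move=> q /leaf_partial_s[].
  apply: (@class_C_eq _ _ _ _ leaf_factor) => //.
    by move=> q Bq; rewrite /partial; have [_ ->] := leaf_partial_s Bq.
  apply: class_C_expR => //.
  apply: (@class_C_eq _ _ _ _ (fun q => -1 * \sum_(i | i != s) (q 0 i - p 0 i) *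
     star_int ss p 0 (fun x => partial s (a i) (Phi x)) q)) => //.
    by move=> q _; rewrite mulN1r.
  apply: class_CM => //; first exact: class_C_cst.
  apply: class_C_sum => // i _; apply: class_CM => //.
    by apply: class_CD => //; [exact: class_C_coord|exact: class_C_cst].
  apply: class_C_star_int => //; first by move=> q t Bq t01; exact: ball_star.
  exact: (class_C_comp oB oBr Pin HP ((sa i k.+1).2 s).2).
split; first by move=> q /(leaf_partial js)[].
apply: (@class_C_eq _ _ _ _ (fun q => -1 * a j (Phi q))) => //.
  by move=> q Bq; rewrite mulN1r /partial; have [_ ->] := leaf_partial js Bq.
apply: class_CM => //; first exact: class_C_cst.
exact: (class_C_comp oB oBr Pin HP (sa j k)).
Qed.

End LeafSmooth.

(** * First integrals *)

Section Frobenius.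
Context {R : realType} (m : nat).

Theorem frobenius (N : set 'rV[R]_m) (w b : form1 m) (p : 'rV[R]_m) (s : 'I_m) :
  open N -> smooth_map N w -> N p -> w p 0 s != 0 ->
  (forall q, N q -> dext w q = b q ⋀ w q) ->
  exists (M : set 'rV[R]_m) (f v : 'rV[R]_m -> R),
    [/\ open M, M p, M `<=` N & smooth M v] /\
    [/\ smooth M f, forall q, M q -> f q != 0 & forall q, M q -> w q = f q *: grad v q].
Proof.
move=> oN sw Np wp dw.
have [r1 r10 r1N] : exists2 r1 : R, 0 < r1 & forall q, ball p r1 q -> N q /\ w q 0 s != 0.
  have /nbhs_ballP[r /= rr0 rN] := open_nbhs_nbhs (conj oN Np).
  have wp0 : 0 < `|w p 0 s| by rewrite normr_gt0.
  have /continuous_dist/(_ _ wp0)[r' r'0 r'H] := (sw s 0%N).1 p Np.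
  exists (Num.min r r'); first by rewrite lt_min rr0.
  move=> q /ball_dist; rewrite lt_min => /andP[h1 h2]; split.
    exact/rN/ball_dist.
  by apply: contraTneq (r'H _ h2) => ->; rewrite sub0r normrN ltxx.
(* Division by w_s normalizes the form to dx_s + sum of a_i dx_i, and b cancels from its
   integrability condition. *)
pose a i q := w q 0 i / w q 0 s.
have oB1 : open (ball p r1) by exact: ball_open.
have sa1 i : smooth (ball p r1) (a i).
  move=> k; apply: class_CM => //; first by apply: class_C_sub (sw i k) => q /r1N[].
  apply: class_CV => //; first by move=> q /r1N[].
  by apply: class_C_sub (sw s k) => q /r1N[].
have Bp1 : ball p r1 p by exact: ballxx.
have [r2 r20 [C2 C20 aL2]] := bounded_lipschitz_uniform
  (fun i => smooth_bounded_lipschitz oB1 Bp1 (sa1 i)).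
have [r3 r30 [C3 C30 aL3]] := bounded_lipschitz_uniform
  (fun ij : 'I_m * 'I_m => smooth_bounded_lipschitz oB1 Bp1
     (fun k => ((sa1 ij.1 k.+1).2 ij.2).2)).
pose r := Num.min r1 (Num.min r2 r3); pose C := C2 + C3.
have r0 : 0 < r by rewrite !lt_min r10 r20.
have C0 : 0 <= C by exact: addr_ge0.
have rr1 : ball p r `<=` ball p r1 by apply: le_ball; rewrite ge_min lexx.
have sa i : smooth (ball p r) (a i) by move=> k; exact: class_C_sub rr1 (sa1 i k).
have aL i : bounded_lipschitz p r C (a i).
  by apply: bounded_lipschitz_mono (aL2 i); rewrite ?lerDl// !ge_min lexx /= orbT.
have daL i j : bounded_lipschitz p r C (partial j (a i)).
  by apply: bounded_lipschitz_mono (aL3 (i, j)); rewrite ?lerDr// !ge_min lexx /= !orbT.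
have integ i j q : i != s -> j != s -> ball p r q ->
    partial i (a j) q - partial j (a i) q =
    a i q * partial s (a j) q - a j q * partial s (a i) q.
  move=> _ _ /rr1 /r1N[Nq wq].
  have D l (n : 'I_m) : partial l (a n) q =
      partial l (fun x => w x 0 n) q / w q 0 s - w q 0 n * partial l (fun x => w x 0 s) q / w q 0 s ^+ 2.
    have d n' : derivable (fun x => w x 0 n') q (delta_mx 0 l) by exact: ((sw n' 1%N).2 l).1.
    rewrite /partial /a deriveM//; last exact: derivableV.
    by rewrite deriveV// /GRing.scale /=; field.
  rewrite !D; move/matrixP: (dw _ Nq) => E.
  have E1 k l : partial k (fun x => w x 0 l) q =
      partial l (fun x => w x 0 k) q + (b q 0 k * w q 0 l - w q 0 k * b q 0 l).
    have := E k l; rewrite /wedge !mxE !big_ord1 !mxE => <-.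
    by rewrite addrC subrK.
  by rewrite /a (E1 i j) (E1 i s) (E1 j s); field.
(* Chosen to make m delta C at most both r / 12 and 1/4; the summand 1 keeps the denominator
   positive when m C = 0. *)
pose delta := Num.min (r / 12) (Num.min (r / 12) 4^-1 / (m%:R * C + 1)).
have mC0 : 0 <= m%:R * C by exact: mulr_ge0.
have d0 : 0 < delta by rewrite lt_min !divr_gt0//= ?lt_min ?divr_gt0 ?invr_gt0//; lra.
have dr : delta <= r / 12 by rewrite ge_min lexx.
have dmC : m%:R * (delta * C) <= Num.min (r / 12) 4^-1.
  rewrite mulrCA; apply: (@le_trans _ _ (delta * (m%:R * C + 1))).
    by apply: ler_wpM2l; [exact: ltW|lra].
  by rewrite -ler_pdivlMr; [rewrite ge_min lexx orbT|lra].
have dC : m%:R * (delta * C) <= r / 12 by apply: le_trans dmC _; rewrite ge_min lexx.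
have d4 : m%:R * (delta * C) <= 4^-1 by apply: le_trans dmC _; rewrite ge_min lexx orbT.
have [sigma leaf] := leaf_exists s r0 C0 sa aL d0 dr dC d4.
have Bp : ball p delta p by exact: ballxx.
have sS := smooth_leaf r0 C0 sa aL daL integ d0 dr d4 leaf.
have dS q (Bq : ball p delta q) := leaf_partial_s r0 C0 sa aL daL d0 dr d4 leaf Bq.
have dSj j q (js : j != s) (Bq : ball p delta q) :=
  leaf_partial r0 C0 sa aL daL integ d0 dr d4 leaf js Bq.
have Pin q (Bq : ball p delta q) := Phi_in r0 d0 dr leaf Bq.
have Sp : partial s (fun q => sigma q 1) p != 0.
  by rewrite /partial; have [_ ->] := dS p Bp; rewrite gt_eqF// expR_gt0.
(* Solving Phi for the s-coordinate: g assigns to a point the label of its leaf, and is the first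
   integral v. *)
have [M' [g [[oM' M'p M'B oPM'] [sg gP Ss0 dg]]]] := coordinate_inverse (ball_open p delta) sS Bp Sp.
pose Phi q := setc s q (sigma q 1).
have Phip : Phi p = p by rewrite /Phi (leaf_center r0 C0 aL d0 dr d4 leaf) setc_id.
pose M := Phi @` M'.
have gs q : M' q -> partial s g (Phi q) = (partial s (fun q => sigma q 1) q)^-1.
  by move=> M'q; rewrite dg// eqxx mul1r.
have MN : M `<=` N.
  by move=> _ [q M'q <-]; have [] := r1N _ (rr1 _ (Pin _ (M'B _ M'q))).
have Mws q : M q -> w q 0 s != 0.
  by move=> [q' M'q <-]; have [] := r1N _ (rr1 _ (Pin _ (M'B _ M'q))).
have gs0 q : M q -> partial s g q != 0.
  by move=> [q' M'q <-]; rewrite gs// invr_eq0 Ss0.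
(* The differential of g is a multiple of dx_s + sum of a_i dx_i, and w is w_s times that form;
   comparing the dx_s components gives f. *)
exists M, (fun q => w q 0 s / partial s g q), g; split; split => //.
- by exists p.
- move=> k; apply: class_CM => //; first exact: class_C_sub MN (sw s k).
  by apply: class_CV => //; exact: ((sg k.+1).2 s).2.
- by move=> q Mq; rewrite mulf_neq0 ?invr_eq0 ?Mws ?gs0.
move=> _ [q M'q <-]; have Mq : M (Phi q) by exists q.
apply/rowP => j; rewrite !mxE.
have Bq := M'B _ M'q.
have [->|js] := eqVneq j s; first by rewrite divfK// gs0.
have [_ Dj] := dSj _ _ js Bq.
rewrite gs// dg// (negbTE js) /(partial j) Dj opprK /a -/(Phi q).
by field; rewrite Ss0// Mws.
Qed.

End Frobenius.

(** * Second derivatives and exterior derivatives *)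

Section Schwarz.
Context {R : realType}.

(* The second difference over a small square is h^2 times a mixed derivative in
   either order, by the mean value theorem. *)
Lemma second_difference m (f : 'rV[R]_m -> R) (q : 'rV[R]_m) (r h : R) i j :
  smooth (ball q r) f -> 0 < h -> h + h < r ->
  exists2 y, `|y - q| <= h + h &
    f (q + h *: delta_mx 0 i + h *: delta_mx 0 j) - f (q + h *: delta_mx 0 i)
      - (f (q + h *: delta_mx 0 j) - f q) = h * (h * partial j (partial i f) y).
Proof.
move=> sf h0 hr.
have B (s t : R) : 0 <= s <= h -> 0 <= t <= h ->
    `|q + s *: delta_mx 0 i + t *: delta_mx 0 j - q| <= h + h.
  move=> /andP[s0 sh] /andP[t0 th].
  have -> : q + s *: delta_mx 0 i + t *: delta_mx 0 j - q =
      s *: delta_mx 0 i + t *: delta_mx 0 j :> 'rV[R]_m.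
    by apply/rowP => k; rewrite !mxE; ring.
  apply: le_trans (ler_normD _ _) _.
  have E (k : 'I_m) (x : R) : 0 <= x <= h -> `|x *: (delta_mx 0 k : 'rV[R]_m)| <= h.
    move=> /andP[x0 xh]; apply/row_norm_le; first exact: ltW.
    move=> l; rewrite !mxE /=; case: (l == k); rewrite ?mulr1 ?mulr0 ?normr0 ?ger0_norm//.
    exact: ltW.
  by rewrite lerD// E//; apply/andP.
have B0 (s t : R) : 0 <= s <= h -> 0 <= t <= h ->
    ball q r (q + s *: delta_mx 0 i + t *: delta_mx 0 j).
  by move=> Hs Ht; apply/ball_dist/(le_lt_trans (B _ _ Hs Ht)).
have I0 : 0 <= (0 : R) <= h by rewrite lexx ltW.
have Ih : 0 <= h <= h by rewrite lexx ltW.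
have th1 (t : R) : 0 <= t <= 1 -> 0 <= t * h <= h.
  move=> /andP[t0 t1]; rewrite mulr_ge0 ?(ltW h0)//=.
  by rewrite -[leRHS]mul1r ler_pM2r.
pose g (x : 'rV[R]_m) := f (x + h *: delta_mx 0 j) - f x.
have Dg (t : R) : 0 <= t <= 1 -> is_derive (q + (t * h) *: delta_mx 0 i) (delta_mx 0 i) g
    (partial i f (q + (t * h) *: delta_mx 0 i + h *: delta_mx 0 j)
     - partial i f (q + (t * h) *: delta_mx 0 i)).
  move=> /th1 t1; apply: is_deriveB.
    apply: is_derive_of_line.
    pose x := q + (t * h) *: delta_mx 0 i + h *: delta_mx 0 j.
    have Hx : is_derive (x + 0 *: delta_mx 0 i) (delta_mx 0 i) f (partial i f x).
      by rewrite scale0r addr0; apply/derivableP; exact: ((sf 1%N).2 i).1 _ (B0 _ _ t1 Ih).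
    have := is_derive_line Hx; rewrite (_ : (fun s => f (x + s *: _)) = fun s =>
      f (q + (t * h) *: delta_mx 0 i + s *: delta_mx 0 i + h *: delta_mx 0 j))//.
    by apply/funext => s; rewrite /x addrAC.
  have := B0 _ _ t1 I0; rewrite scale0r addr0 => Bt.
  by apply/derivableP; exact: ((sf 1%N).2 i).1.
have [t /[dup] /th1 t1 t01 E] : exists2 t : R, 0 <= t <= 1 &
    g (q + h *: delta_mx 0 i) - g q = h * 'D_(delta_mx 0 i) g (q + (t * h) *: delta_mx 0 i).
  by apply: line_MVT => t t1; have [] := Dg _ t1.
have [_ D] := Dg _ t01; rewrite D in E.
have [s /th1 s1 E'] : exists2 s : R, 0 <= s <= 1 &
    partial i f (q + (t * h) *: delta_mx 0 i + h *: delta_mx 0 j)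
     - partial i f (q + (t * h) *: delta_mx 0 i) =
    h * partial j (partial i f) (q + (t * h) *: delta_mx 0 i + (s * h) *: delta_mx 0 j).
  apply: line_MVT => s /th1 s1.
  exact: (((sf 2%N).2 i).2.2 j).1 _ (B0 _ _ t1 s1).
exists (q + (t * h) *: delta_mx 0 i + (s * h) *: delta_mx 0 j); first exact: B.
by rewrite -E' -E /g.
Qed.

Lemma partial_comm m (N : set 'rV[R]_m) (f : 'rV[R]_m -> R) q i j :
  open N -> smooth N f -> N q ->
  partial i (partial j f) q = partial j (partial i f) q.
Proof.
move=> oN sf Nq; apply/eqP; rewrite -subr_eq0 -normr_le0.
apply/ler_addgt0Pr => e e0; rewrite add0r.
have e2 : 0 < e / 2 by rewrite divr_gt0.
have [r0 /= r0p r0N] := (nbhs_ballP _ _).1 (open_nbhs_nbhs (conj oN Nq)).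
have c1 := (((sf 2%N).2 i).2.2 j).2.1 q Nq.
have c2 := (((sf 2%N).2 j).2.2 i).2.1 q Nq.
have [r1 r1p H1] := (continuous_dist _ _).1 c1 _ e2.
have [r2 r2p H2] := (continuous_dist _ _).1 c2 _ e2.
pose h := Num.min r0 (Num.min r1 r2) / 3.
have m0 : 0 < Num.min r0 (Num.min r1 r2) by rewrite !lt_min r0p r1p.
have h0 : 0 < h by rewrite divr_gt0.
have hm : h + h < Num.min r0 (Num.min r1 r2) by rewrite /h; lra.
have sB : smooth (ball q r0) f by move=> k; exact: class_C_sub r0N (sf k).
move: hm; rewrite !lt_min => /and3P[hr0 hr1 hr2].
have T (x a b : R) : `|x - a| < e / 2 -> `|x - b| < e / 2 -> `|a - b| <= e.
  by move=> /ltr_normlP[? ?] /ltr_normlP[? ?]; apply/ler_normlP; split; lra.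
have [y1 Y1 E1] := second_difference i j sB h0 hr0.
have [y2 Y2 E2] := second_difference j i sB h0 hr0.
(* The second difference is symmetric in i and j, so its two expressions agree; y1 and y2 are so
   close to q that continuity concludes. *)
have E : partial j (partial i f) y1 = partial i (partial j f) y2.
  apply: (mulfI (lt0r_neq0 h0)); apply: (mulfI (lt0r_neq0 h0)).
  have E0 : q + h *: delta_mx 0 j + h *: delta_mx 0 i =
    q + h *: delta_mx 0 i + h *: delta_mx 0 j by rewrite addrAC.
  rewrite E0 in E2; apply: etrans (esym E1) _; apply: etrans _ E2.
  move: (f (q + _ + _)) (f (q + h *: delta_mx 0 i)) (f (q + h *: delta_mx 0 j)) (f q).
  by move=> a b c d; ring.
have := H1 _ (le_lt_trans Y1 hr1); have := H2 _ (le_lt_trans Y2 hr2); rewrite E.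
exact: T.
Qed.

Lemma smooth_sub m (M N : set 'rV[R]_m) f : M `<=` N -> smooth N f -> smooth M f.
Proof. by move=> MN sf k; exact: class_C_sub MN (sf k). Qed.

Lemma smooth_map_sub m n (M N : set 'rV[R]_m) (F : 'rV[R]_m -> 'rV[R]_n) :
  M `<=` N -> smooth_map N F -> smooth_map M F.
Proof. by move=> MN sF j; exact: smooth_sub MN (sF j). Qed.

Lemma smooth_partial m (N : set 'rV[R]_m) f i : smooth N f -> smooth N (partial i f).
Proof. by move=> sf k; exact: ((sf k.+1).2 i).2. Qed.

Lemma smooth_grad m (N : set 'rV[R]_m) f : smooth N f -> smooth_map N (grad f).
Proof.
move=> sf j; rewrite (_ : (fun q => _) = partial j f); first exact: smooth_partial.
by apply/funext => q; rewrite mxE.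
Qed.

Lemma smooth_continuous m n (N : set 'rV[R]_m) (F : 'rV[R]_m -> 'rV[R]_n) q :
  smooth_map N F -> N q -> {for q, continuous F}.
Proof. by move=> sF Nq; apply: row_continuous => j; exact: (sF j 0%N).1. Qed.

Lemma dext_grad m (N : set 'rV[R]_m) f q : open N -> smooth N f -> N q -> dext (grad f) q = 0.
Proof.
move=> oN sf Nq; apply/matrixP => i j; rewrite !mxE.
rewrite (_ : (fun x => _) = partial j f); last by apply/funext => x; rewrite mxE.
rewrite (_ : (fun x => grad f x 0 i) = partial i f); last by apply/funext => x; rewrite mxE.
by rewrite (partial_comm i j oN sf Nq) subrr.
Qed.

Lemma smooth_comp m n (M : set 'rV[R]_m) (N : set 'rV[R]_n) f (G : 'rV[R]_m -> 'rV[R]_n) :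
  open M -> open N -> (forall q, M q -> N (G q)) -> smooth_map M G -> smooth N f ->
  smooth M (fun q => f (G q)).
Proof. by move=> oM oN MN sG sf k; exact: class_C_comp oM oN MN (fun j => sG j k) (sf k). Qed.

End Schwarz.

(** * Local diffeomorphisms *)

Section LocalDiffeo.
Context {R : realType} (m : nat).
Implicit Types (F G : 'rV[R]_m -> 'rV[R]_m) (M N : set 'rV[R]_m) (p q : 'rV[R]_m).

Definition local_diffeo N p F :=
  exists M, [/\ M p, M `<=` N & diffeo M (F @` M) F].

Lemma smooth_map_preimage_open M N F : open M -> open N -> smooth_map M F ->
  open (M `&` F @^-1` N).
Proof.
move=> oM oN sF; rewrite openE => q [Mq NFq].
have c : {for q, continuous F} by exact: smooth_continuous sF Mq.
apply: filterI; first exact: open_nbhs_nbhs.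
by apply: c; exact: open_nbhs_nbhs.
Qed.

Lemma smooth_map_comp M N F G : open M -> open N -> (forall q, M q -> N (F q)) ->
  smooth_map M F -> smooth_map N G -> smooth_map M (fun q => G (F q)).
Proof. by move=> oM oN MN sF sG j; exact: (smooth_comp oM oN MN sF (sG j)). Qed.

Lemma local_diffeo_comp N N' p F F' : local_diffeo N p F -> local_diffeo N' (F p) F' ->
  local_diffeo N p (fun q => F' (F q)).
Proof.
move=> [M1 [M1p M1N [oM1 oB1 _ sF [G [sG GK]]]]] [M2 [M2p M2N [oM2 oB2 _ sF' [G' [sG' GK']]]]].
pose M := M1 `&` F @^-1` M2.
have oM : open M by exact: smooth_map_preimage_open.
have E : (fun q => F' (F q)) @` M = (F' @` M2) `&` G' @^-1` (F @` M1).
  apply/seteqP; split => [_ [q [M1q M2q] <-]|_ [[y M2y <-]]].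
    by split; [exists (F q)|rewrite /= GK'//; exists q].
  rewrite /= GK'// => -[q M1q Fq]; exists q; last by rewrite Fq.
  by split => //; rewrite /= Fq.
have oB : open ((fun q => F' (F q)) @` M).
  by rewrite E; exact: smooth_map_preimage_open.
exists M; split => //; first by move=> q [/M1N].
split => //.
  apply: (smooth_map_comp oM oM2) => //; first by move=> q [].
  by apply: smooth_map_sub sF => q [].
exists (fun y => G (G' y)); split.
  apply: (smooth_map_comp oB oB1) => //.
    by move=> _ [q [M1q M2q] <-]; rewrite GK'//; exists q.
  by apply: smooth_map_sub sG' => y; rewrite E => -[].
by move=> q [M1q M2q]; rewrite GK'// GK.
Qed.

Lemma smooth_eq M (f g : 'rV[R]_m -> R) : open M -> (forall q, M q -> f q = g q) ->
  smooth M f -> smooth M g.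
Proof. by move=> oM fg sf k; exact: class_C_eq oM fg (sf k). Qed.

Lemma local_diffeo_eq N p F F' : local_diffeo N p F -> (forall q, N q -> F q = F' q) ->
  local_diffeo N p F'.
Proof.
move=> [M [Mp MN [oM oB _ sF [G [sG GK]]]]] FF'.
have E : F' @` M = F @` M.
  by apply/seteqP; split => [_ [q Mq <-]|_ [q Mq <-]]; exists q => //; rewrite FF'//; exact: MN.
exists M; split => //; rewrite E; split => //.
  by move=> j; apply: smooth_eq (sF j) => // q /MN /FF' ->.
by exists G; split => // q Mq; rewrite -FF' ?GK//; exact: MN.
Qed.

Lemma local_diffeo_sub N p F M : local_diffeo M p F -> M `<=` N -> local_diffeo N p F.
Proof.
by move=> [M' [M'p M'M d]] MN; exists M'; split => // q /M'M /MN.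
Qed.

Lemma local_diffeo_setc N p s f : open N -> smooth N f -> N p -> partial s f p != 0 ->
  exists M g, [/\ open M, M p, M `<=` N & diffeo M ((fun q => setc s q (f q)) @` M) (fun q => setc s q (f q))] /\
    [/\ smooth ((fun q => setc s q (f q)) @` M) g, forall q, M q -> g (setc s q (f q)) = q 0 s
      & forall j, partial j g (setc s p (f p)) =
          (if j == s then 1 else - partial j f p) / partial s f p].
Proof.
move=> oN sf Np fp.
have [M [g [[oM Mp MN oB] [sg gK _ dg]]]] := coordinate_inverse oN sf Np fp.
exists M, g; split; last by split => // j; exact: dg.
split => //; split => //.
  move=> j; have [<-|js] := eqVneq j s.
    apply: (smooth_sub MN); rewrite (_ : (fun q => _) = f)//.
    by apply/funext => q; rewrite setcE.
  rewrite (_ : (fun q => _) = fun q => q 0 j); first by move=> k; exact: class_C_coord.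
  by apply/funext => q; rewrite mxE (negPf js).
exists (fun y => setc s y (g y)); split; last by move=> q Mq; rewrite gK// setc_setc setc_id.
move=> j; have [->|js] := eqVneq j s.
  rewrite (_ : (fun y => setc s y (g y) 0 s) = g)//.
  by apply/funext => q; rewrite setcE.
rewrite (_ : (fun y => setc s y (g y) 0 j) = fun q => q 0 j).
  by move=> k; exact: class_C_coord.
by apply/funext => q; rewrite mxE (negPf js).
Qed.

(** Serves both for exchanging the two fibre coordinates and for the reversal of t and x. *)
Lemma local_diffeo_signed_perm (e : 'I_m -> R) (sg : 'I_m -> 'I_m) p :
  (forall i, e i ^+ 2 = 1) -> involutive sg ->
  local_diffeo setT p (fun q => \row_i (e i * q 0 (sg i))).
Proof.
move=> e2 sK; set F := (fun q => _).
have s A (a : 'I_m -> R) : smooth_map A (fun q : 'rV[R]_m => \row_i (a i * q 0 (sg i))).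
  move=> j; rewrite (_ : (fun q => _) = fun q : 'rV[R]_m => a j * q 0 (sg j)); last first.
    by apply/funext => q; rewrite mxE.
  move=> k; apply: class_C_sub (@subsetT _ A) _; apply: class_CM; first exact: openT.
    exact: class_C_cst.
  exact: class_C_coord.
pose G q : 'rV[R]_m := \row_i (e (sg i) * q 0 (sg i)).
have GF q : G (F q) = q.
  by apply/rowP => i; rewrite !mxE sK mulrA -expr2 e2 mul1r.
have FG q : F (G q) = q.
  by apply/rowP => i; rewrite !mxE sK mulrA -expr2 e2 mul1r.
have E : F @` setT = setT.
  by apply/seteqP; split => // q _; exists (G q).
exists setT; split => //; rewrite E; split => //; try exact: openT.
  exact: s.
by exists G; split => //; exact: s.
Qed.

(* The coordinates a, b are replaced one after the other, starting with one in which
   the new function has nonzero derivative. *)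
Lemma local_diffeo_two N p (a b : 'I_m) (v z : 'rV[R]_m -> R) :
  open N -> N p -> smooth N v -> smooth N z -> a != b ->
  partial a v p * partial b z p - partial b v p * partial a z p != 0 ->
  local_diffeo N p (fun q => setc b (setc a q (v q)) (z q)).
Proof.
move=> oN Np + + ab.
have ba : b == a = false by rewrite eq_sym; exact: negbTE.
have main v' z' : smooth N v' -> smooth N z' -> partial a v' p != 0 ->
  partial a v' p * partial b z' p - partial b v' p * partial a z' p != 0 ->
  local_diffeo N p (fun q => setc b (setc a q (v' q)) (z' q)).
  move=> sv sz va0 det0.
  have [M [g [[oM Mp MN dM] [sg gK dg]]]] := local_diffeo_setc oN sv Np va0.
  pose Psi q := setc a q (v' q); pose G1 y := setc a y (g y).
  have [_ oB _ _ _] := dM.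
  have G1P q : M q -> G1 (Psi q) = q by move=> Mq; rewrite /G1 gK// setc_setc setc_id.
  pose zz y := z' (G1 y).
  have sG1 : smooth_map (Psi @` M) G1.
    move=> j; have [->|ja] := eqVneq j a.
      by rewrite (_ : (fun q => _) = g)//; apply/funext => q; rewrite setcE.
    rewrite (_ : (fun q => _) = fun q => q 0 j); first by move=> k; exact: class_C_coord.
    by apply/funext => q; rewrite mxE (negPf ja).
  have G1N y : (Psi @` M) y -> N (G1 y) by move=> [q Mq <-]; rewrite G1P//; exact: MN.
  have szz : smooth (Psi @` M) zz by exact: smooth_comp sz.
  have Bp : (Psi @` M) (Psi p) by exists p.
  (* In the coordinates where v has replaced a, the derivative of z along b is the Jacobian
     determinant divided by the derivative of v along a. *)
  have dz : partial b zz (Psi p) = partial b z' p - partial b v' p / partial a v' p * partial a z' p.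
    have df1 : differentiable z' (G1 (Psi p)).
      by rewrite G1P//; exact: class_C1_differentiable oN (sz 1%N) Np.
    have dG j : differentiable (fun x => G1 x 0 j) (Psi p).
      exact: class_C1_differentiable oB (sG1 j 1%N) Bp.
    have [_] := is_derive_chain (delta_mx 0 b) df1 dG.
    rewrite -/zz -/(partial b zz (Psi p)) => ->.
    rewrite (bigD1 a)//= (bigD1 b) ?ba//= big1 ?addr0 => [|j /andP[ja jb]].
      rewrite (_ : (fun x => G1 x 0 a) = g); last by apply/funext => x; rewrite setcE.
      rewrite (_ : (fun x => G1 x 0 b) = fun x => x 0 b); last first.
        by apply/funext => x; rewrite mxE ba.
      rewrite -/(partial b g (Psi p)) dg ba G1P//.
      have [_ ->] := is_derive_coord b (Psi p) (delta_mx 0 b).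
      by rewrite mxE !eqxx /= mul1r addrC mulNr; congr (_ + _); rewrite mulNr.
    rewrite (_ : (fun x => G1 x 0 j) = fun x => x 0 j); last first.
      by apply/funext => x; rewrite mxE (negPf ja).
    have [_ ->] := is_derive_coord j (Psi p) (delta_mx 0 b).
    by rewrite mxE (negPf jb) mul0r.
  have dz0 : partial b zz (Psi p) != 0.
    rewrite dz; apply: contra det0 => /eqP E.
    rewrite (_ : _ - _ = partial a v' p * (partial b z' p - partial b v' p / partial a v' p * partial a z' p)).
      by rewrite E mulr0.
    by field.
  have [M' [g' [[_ M'p M'B dM'] _]]] := local_diffeo_setc oB szz Bp dz0.
  have LL : local_diffeo M p (fun q => setc b (Psi q) (zz (Psi q))).
    apply: (@local_diffeo_comp M (Psi @` M) p Psi (fun y => setc b y (zz y))).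
      by exists M; split.
    by exists M'; split.
  have L : local_diffeo M p (fun q => setc b (setc a q (v' q)) (z' q)).
    apply: local_diffeo_eq LL _ => q Mq; congr setc; first by rewrite /zz G1P.
  exact: local_diffeo_sub L MN.
(* If the derivative of v along a vanishes, that of z cannot: v and z exchange roles, and the two
   coordinates are transposed afterwards. *)
move=> sv sz det0; have [va0|va0] := eqVneq (partial a v p) 0; last exact: main.
have L : local_diffeo N p (fun q => setc b (setc a q (z q)) (v q)).
  apply: main => //; last first.
    by rewrite -oppr_eq0 opprB mulrC [X in _ - X]mulrC.
  by apply: contra det0 => /eqP ->; rewrite va0 mul0r mulr0 subr0.
have H := local_diffeo_comp L (@local_diffeo_signed_perm (fun=> 1) (tperm a b) _ (fun=> expr1n _ _) (@tpermK _ a b)).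
apply: local_diffeo_eq H _ => q Nq; apply/rowP => i; rewrite !mxE mul1r.
case: tpermP => [->|->|/eqP ia /eqP ib]; rewrite ?eqxx ?ba ?(negPf ab)//.
by rewrite (negPf ia) (negPf ib).
Qed.

End LocalDiffeo.

(** * Rules for gradients and exterior derivatives *)

Section ExteriorDerivative.
Context {R : realType} (m : nat).
Implicit Types (f g : 'rV[R]_m -> R) (q v : 'rV[R]_m) (w : form1 (R := R) m).

(** Existence and values of all partial derivatives together, so that [grad_step] computes a
    gradient by following the syntax of the function. [has_dext] does the same for forms. *)
Definition has_grad f q (v : 'rV[R]_m) := forall i, is_derive q (delta_mx 0 i) f (v 0 i).

Lemma grad_eq f q v : has_grad f q v -> grad f q = v.
Proof. by move=> H; apply/rowP => i; rewrite mxE /partial; have [_ ->] := H i. Qed.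

Lemma smooth_has_grad (N : set 'rV[R]_m) f q : smooth N f -> N q -> has_grad f q (grad f q).
Proof. by move=> sf Nq i; rewrite mxE; apply/derivableP; exact: ((sf 1%N).2 i).1. Qed.

Lemma has_grad_cst (c : R) q : has_grad (fun _ => c) q 0.
Proof. by move=> i; rewrite mxE; exact: is_derive_cst. Qed.

Lemma has_grad_coord k q : has_grad (fun x => x 0 k) q (delta_mx 0 k).
Proof.
move=> i; apply: is_derive_eq (is_derive_coord k q (delta_mx 0 i)) _.
by rewrite !mxE eq_sym.
Qed.

Lemma has_gradD f g q u v : has_grad f q u -> has_grad g q v ->
  has_grad (fun x => f x + g x) q (u + v).
Proof. by move=> Hf Hg i; rewrite mxE; exact: is_deriveD (Hf i) (Hg i). Qed.

Lemma has_gradN f q u : has_grad f q u -> has_grad (fun x => - f x) q (- u).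
Proof. by move=> Hf i; rewrite mxE; exact: is_deriveN (Hf i). Qed.

Lemma has_gradM f g q u v : has_grad f q u -> has_grad g q v ->
  has_grad (fun x => f x * g x) q (f q *: v + g q *: u).
Proof. by move=> Hf Hg i; rewrite !mxE; exact: is_deriveM (Hf i) (Hg i). Qed.

Lemma has_grad_comp1 (phi : R -> R) (d : R) f q u : is_derive (f q) 1 phi d ->
  has_grad f q u -> has_grad (fun x => phi (f x)) q (d *: u).
Proof. by move=> Hp Hf i; rewrite mxE; exact: is_derive_comp1 Hp (Hf i). Qed.

Lemma has_gradX f n q u : has_grad f q u ->
  has_grad (fun x => f x ^+ n) q ((n%:R * f q ^+ n.-1) *: u).
Proof.
move=> Hf; elim: n => [|n IH].
  by rewrite mul0r scale0r; exact: has_grad_cst.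
have := has_gradM Hf IH; rewrite (_ : _ + _ = (n.+1%:R * f q ^+ n.+1.-1) *: u).
  by rewrite (_ : (fun x => f x ^+ n.+1) = fun x => f x * f x ^+ n)//; apply/funext => x; rewrite exprS.
rewrite scalerA -scalerDl; congr (_ *: _); case: n {IH} => [|n] /=; first by rewrite expr0; ring.
by rewrite exprS -[n.+2%:R]natr1; ring.
Qed.

Lemma has_gradV f q u : f q != 0 -> has_grad f q u ->
  has_grad (fun x => (f x)^-1) q (- (f q ^- 2) *: u).
Proof.
move=> f0 Hf; apply: (has_grad_comp1 (phi := fun x => x^-1)) => //.
have := @is_deriveV R id (f q) 1 1 f0 (is_derive_id _ _).
by move=> H; apply: is_derive_eq H _; rewrite -[_ *: 1]/(_ * 1) mulr1.
Qed.

Definition has_dext w q (M : 'M[R]_m) :=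
  (forall i j, derivable (fun x => w x 0 j) q (delta_mx 0 i)) /\ dext w q = M.

Lemma wedgeE (a b : 'rV[R]_m) i j : (a ⋀ b) i j = a 0 i * b 0 j - b 0 i * a 0 j.
Proof. by rewrite !mxE !big_ord1 !mxE. Qed.

Lemma smooth_has_dext (N : set 'rV[R]_m) w q : smooth_map N w -> N q -> has_dext w q (dext w q).
Proof. by move=> sw Nq; split => // i j; exact: ((sw j 1%N).2 i).1. Qed.

Lemma has_dext_cst (c : 'rV[R]_m) q : has_dext (fun _ => c) q 0.
Proof.
split => [i j|]; first exact: derivable_cst.
by apply/matrixP => i j; rewrite !mxE /partial !derive_cst subrr.
Qed.

Lemma has_dextD w w' q A B : has_dext w q A -> has_dext w' q B ->
  has_dext (fun x => w x + w' x) q (A + B).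
Proof.
move=> [dw <-] [dw' <-].
have E j : (fun x => (w x + w' x) 0 j) = (fun x => w x 0 j) + (fun x => w' x 0 j).
  by apply/funext => x; rewrite mxE.
split => [i j|]; first by rewrite E; exact: derivableD.
by apply/matrixP => i j; rewrite !mxE /partial !E !deriveD//; ring.
Qed.

Lemma has_dextN w q A : has_dext w q A -> has_dext (fun x => - w x) q (- A).
Proof.
move=> [dw <-].
have E j : (fun x => (- w x) 0 j) = - (fun x => w x 0 j).
  by apply/funext => x; rewrite mxE.
split => [i j|]; first by rewrite E; exact: derivableN.
by apply/matrixP => i j; rewrite !mxE /partial !E !deriveN//; ring.
Qed.

Lemma has_dextZ f w q u A : has_grad f q u -> has_dext w q A ->
  has_dext (fun x => f x *: w x) q (u ⋀ w q + f q *: A).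
Proof.
move=> Hf [dw <-].
have E j : (fun x => (f x *: w x) 0 j) = f * (fun x => w x 0 j).
  by apply/funext => x; rewrite mxE.
split => [i j|].
  by rewrite E; apply: derivableM => //; have [] := Hf i.
have K k l : 'D_(delta_mx 0 k) (f * (fun x => w x 0 l)) q =
    f q * 'D_(delta_mx 0 k) (fun x => w x 0 l) q + w q 0 l * u 0 k.
  by have [_ ->] := is_deriveM (Hf k) (derivableP (dw k l)).
apply/matrixP => i j; rewrite [in RHS]mxE wedgeE !mxE /partial !E (K i j) (K j i).
by ring.
Qed.

Lemma has_dext_eq w q A B : has_dext w q A -> A = B -> dext w q = B.
Proof. by move=> [_ ->]. Qed.

(** These rules have free right-hand sides: applied to a goal whose right side is an existential
    variable, they compute the entry of a large expression without unfolding matrix products. *)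
Lemma row_entryD (a b : 'rV[R]_m) i c d : a 0 i = c -> b 0 i = d -> (a + b) 0 i = c + d.
Proof. by move=> <- <-; rewrite mxE. Qed.
Lemma row_entryN (a : 'rV[R]_m) i c : a 0 i = c -> (- a) 0 i = - c.
Proof. by move=> <-; rewrite mxE. Qed.
Lemma row_entryZ r (a : 'rV[R]_m) i c : a 0 i = c -> (r *: a) 0 i = r * c.
Proof. by move=> <-; rewrite mxE. Qed.
Lemma row_entry0 i : (0 : 'rV[R]_m) 0 i = 0.
Proof. by rewrite mxE. Qed.
Lemma mx_entryD (a b : 'M[R]_m) i j c d :
  a i j = c -> b i j = d -> (a + b) i j = c + d.
Proof. by move=> <- <-; rewrite mxE. Qed.
Lemma mx_entryN (a : 'M[R]_m) i j c : a i j = c -> (- a) i j = - c.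
Proof. by move=> <-; rewrite mxE. Qed.
Lemma mx_entryZ r (a : 'M[R]_m) i j c : a i j = c -> (r *: a) i j = r * c.
Proof. by move=> <-; rewrite mxE. Qed.
Lemma mx_entry0 i j : (0 : 'M[R]_m) i j = 0.
Proof. by rewrite mxE. Qed.
Lemma wedge_entry (a b : 'rV[R]_m) i j c d c' d' : a 0 i = c -> b 0 j = d ->
  b 0 i = c' -> a 0 j = d' -> (a ⋀ b) i j = c * d - c' * d'.
Proof. by move=> <- <- <- <-; rewrite wedgeE. Qed.

End ExteriorDerivative.

(** * Tactics for derivatives and matrix entries *)

Ltac grad_step := match goal with
  | |- has_grad (fun _ => ?c) _ _ => apply: has_grad_cst
  | |- has_grad (fun x => _ + _) _ _ => apply: has_gradD
  | |- has_grad (fun x => - _) _ _ => apply: has_gradN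
  | |- has_grad (fun x => _ * _) _ _ => apply: has_gradM
  | |- has_grad (fun x => _ ^+ _) _ _ => apply: has_gradX
  | |- has_grad (fun x => (_)^-1) _ _ => apply: has_gradV
  | |- has_grad (fun x => fun_of_matrix x _ _) _ _ => apply: has_grad_coord
  | |- has_grad (fun x => _) _ _ => eassumption
  | |- has_grad _ _ _ => eassumption
  end.

Ltac dext_step := match goal with
  | |- has_dext (fun _ => ?c) _ _ => apply: has_dext_cst
  | |- has_dext (fun x => _ + _) _ _ => apply: has_dextD
  | |- has_dext (fun x => - _) _ _ => apply: has_dextN
  | |- has_dext (fun x => _ *: _) _ _ => apply: has_dextZ
  | |- has_dext (fun x => _) _ _ => eassumption
  | |- has_dext _ _ _ => eassumption
  end.

Ltac entry_step := match goal with
  | |- @fun_of_matrix _ 1 _ (_ + _) _ _ = _ => apply: row_entryD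
  | |- @fun_of_matrix _ 1 _ (- _) _ _ = _ => apply: row_entryN
  | |- @fun_of_matrix _ 1 _ (_ *: _) _ _ = _ => apply: row_entryZ
  | |- @fun_of_matrix _ 1 _ 0 _ _ = _ => apply: row_entry0
  | |- fun_of_matrix (_ + _) _ _ = _ => apply: mx_entryD
  | |- fun_of_matrix (- _) _ _ = _ => apply: mx_entryN
  | |- fun_of_matrix (_ *: _) _ _ = _ => apply: mx_entryZ
  | |- fun_of_matrix 0 _ _ = _ => apply: mx_entry0
  | |- fun_of_matrix (_ ⋀ _) _ _ = _ => apply: wedge_entry
  | |- _ => reflexivity
  end.
Ltac entries := 
  etransitivity; [repeat entry_step|etransitivity; [|symmetry; repeat entry_step]].

(** The entries of the coordinate differentials become independent variables, so one call of [field]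
    proves an identity of forms for all i and j. *)
Ltac abstract_entries := repeat match goal with
  |- context [fun_of_matrix (delta_mx ?o ?k) ?z ?i] =>
    let y := fresh "d" in set y := (fun_of_matrix (delta_mx o k) z i); clearbody y
  end.
Ltac abstract_coords q := repeat match goal with
  |- context [fun_of_matrix q ?z ?i] =>
    let y := fresh "c" in set y := (fun_of_matrix q z i); clearbody y
  end.

(** * The extended space *)

Section SmoothRules.
Context {R : realType} (m : nat) (N : set 'rV[R]_m).
Hypothesis oN : open N.
Implicit Types (f g : 'rV[R]_m -> R) (w : form1 (R := R) m).

Lemma smooth_cst (c : R) : smooth N (fun _ => c).
Proof. by move=> k; exact: class_C_cst. Qed.
Lemma smooth_coord i : smooth N (fun x => x 0 i).
Proof. by move=> k; exact: class_C_coord. Qed.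
Lemma smoothD f g : smooth N f -> smooth N g -> smooth N (fun x => f x + g x).
Proof. by move=> sf sg k; exact: class_CD. Qed.
Lemma smoothM f g : smooth N f -> smooth N g -> smooth N (fun x => f x * g x).
Proof. by move=> sf sg k; exact: class_CM. Qed.
Lemma smoothN f : smooth N f -> smooth N (fun x => - f x).
Proof.
move=> sf; rewrite (_ : (fun x => _) = fun x => -1 * f x).
  by apply: smoothM => //; exact: smooth_cst.
by apply/funext => x; rewrite mulN1r.
Qed.
Lemma smoothX f n : smooth N f -> smooth N (fun x => f x ^+ n).
Proof.
move=> sf; elim: n => [|n IH]; first exact: smooth_cst.
rewrite (_ : (fun x => _) = fun x => f x * f x ^+ n); first exact: smoothM.
by apply/funext => x; rewrite exprS.
Qed.
Lemma smoothV f : (forall q, N q -> f q != 0) -> smooth N f -> smooth N (fun x => (f x)^-1).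
Proof. by move=> f0 sf k; exact: class_CV. Qed.

Lemma smooth_map_cst (c : 'rV[R]_m) : smooth_map N (fun _ => c).
Proof. by move=> j; exact: smooth_cst. Qed.
Lemma smooth_mapD w w' : smooth_map N w -> smooth_map N w' -> smooth_map N (fun x => w x + w' x).
Proof.
move=> sw sw' j; rewrite (_ : (fun x => _) = fun x => w x 0 j + w' x 0 j); first exact: smoothD.
by apply/funext => x; rewrite mxE.
Qed.
Lemma smooth_mapN w : smooth_map N w -> smooth_map N (fun x => - w x).
Proof.
move=> sw j; rewrite (_ : (fun x => _) = fun x => - w x 0 j); first exact: smoothN.
by apply/funext => x; rewrite mxE.
Qed.
Lemma smooth_mapZ f w : smooth N f -> smooth_map N w -> smooth_map N (fun x => f x *: w x).
Proof.
move=> sf sw j; rewrite (_ : (fun x => _) = fun x => f x * w x 0 j); first exact: smoothM.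
by apply/funext => x; rewrite mxE.
Qed.
Lemma smooth_map_eq w w' : (forall q, N q -> w q = w' q) -> smooth_map N w -> smooth_map N w'.
Proof. by move=> E sw j; apply: smooth_eq (sw j) => // q /E ->. Qed.
End SmoothRules.

Ltac smooth_step := match goal with
  | |- smooth _ (fun _ => ?c) => apply: smooth_cst
  | |- smooth _ (fun x => fun_of_matrix x _ _) => apply: smooth_coord
  | |- smooth _ (fun x => _ + _) => apply: smoothD
  | |- smooth _ (fun x => - _) => apply: smoothN
  | |- smooth _ (fun x => _ * _) => apply: smoothM
  | |- smooth _ (fun x => _ ^+ _) => apply: smoothX
  | |- smooth _ (fun x => (_)^-1) => apply: smoothV
  | |- smooth_map _ (fun _ => ?c) => apply: smooth_map_cst
  | |- smooth_map _ (fun x => _ + _) => apply: smooth_mapD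
  | |- smooth_map _ (fun x => - _) => apply: smooth_mapN
  | |- smooth_map _ (fun x => _ *: _) => apply: smooth_mapZ
  | |- _ => eassumption
  end.

(** * Maps of the extended space over a reflection of the base *)

Section ExtendedMap.
Context {R : realType}.
Notation space := 'rV[R]_(19 + 2).
Notation oneform := (@form1 R (19 + 2)).
Notation d_ i := (delta_mx ord0 i : space).

(* For eps = -1 this reverses t and x and fixes y and u; a derivative of u changes sign
   with the parity of the number of differentiations in t and x. *)
Definition flip_sign (eps : R) (i : 'I_(19 + 2)) : R :=
  if nth false [:: true; true; false; false; true; true; false; false; false; true;
                   false; true; true; true; false; true; false; true; false] i
  then eps else 1.

Definition flip (eps : R) (a : space) : space := \row_i (flip_sign eps i * a 0 i).

Definition extended_map (eps : R) (v z : space -> R) (x : space) : space :=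
  setc i_vx (setc i_v (flip eps x) (v x)) (z x).

Lemma i_v_vx : (i_v == i_vx) = false. Proof. by []. Qed.

Lemma extended_map_v eps v z x : extended_map eps v z x 0 i_v = v x.
Proof. by rewrite !mxE. Qed.

Lemma extended_map_vx eps v z x : extended_map eps v z x 0 i_vx = z x.
Proof. by rewrite !mxE. Qed.

Lemma extended_map_base eps v z x i : i != i_v -> i != i_vx ->
  extended_map eps v z x 0 i = flip_sign eps i * x 0 i.
Proof. by move=> iv ivx; rewrite !mxE (negPf iv) (negPf ivx). Qed.

Lemma flip_sign_sqr eps i : eps ^+ 2 = 1 -> flip_sign eps i ^+ 2 = 1.
Proof. by move=> e2; rewrite /flip_sign; case: nth; rewrite ?expr1n. Qed.

(** The forms in question contain dv but not dv_x, so z enters the pullback only through the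
    coefficients, never through its differential. *)
Lemma pullback_extended_map eps v z N (a : oneform) x (c : R) b :
  open N -> smooth N v -> smooth N z -> N x ->
  a (extended_map eps v z x) = c *: d_ i_v + b -> b 0 i_v = 0 -> b 0 i_vx = 0 ->
  pullback (extended_map eps v z) a x = c *: grad v x + flip eps b.
Proof.
move=> oN sv sz Nx E b1 b2; apply/rowP => i; rewrite !mxE.
rewrite (bigD1 i_v)//= (bigD1 i_vx)//= E !mxE /= b1 b2 !mulr0 !addr0 mul0r mulr1 add0r.
rewrite (_ : (fun x => extended_map eps v z x 0 i_v) = v); last first.
  by apply/funext => y; rewrite extended_map_v.
congr (_ + _).
have P k j : j != i_v -> j != i_vx ->
    partial k (fun y => extended_map eps v z y 0 j) x = flip_sign eps j * (k == j)%:R.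
  move=> jv jvx; rewrite (_ : (fun y : space => extended_map eps v z y 0 j) =
      fun y => flip_sign eps j * y 0 j); last first.
    by apply/funext => y; rewrite extended_map_base.
  have [_] := has_gradM (has_grad_cst (flip_sign eps j) x) (has_grad_coord j x) k.
  by rewrite /partial => ->; rewrite !mxE eqxx mulr0 addr0 /= eq_sym.
have [->|iv] := eqVneq i i_v.
  rewrite b1 mulr0 big1// => j /andP[jv jvx].
  by rewrite P// eq_sym (negPf jv) !mulr0.
have [->|ivx] := eqVneq i i_vx.
  rewrite b2 mulr0 big1// => j /andP[jv jvx].
  by rewrite P// [i_vx == j]eq_sym (negPf jvx) !mulr0.
rewrite (bigD1 i) ?iv//= P// eqxx mulr1 big1 ?addr0 => [|j /andP[/andP[jv jvx] ji]].
  by rewrite !mxE (negPf iv) mulr0 add0r mulrC.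
by rewrite P// eq_sym (negPf ji) !mulr0.
Qed.

Lemma projb_open (M : set space) : open M -> open (@projb R @` M).
Proof.
move=> oM; rewrite openE => _ [q Mq <-]; apply/nbhs_ballP.
have [r /= r0 rM] := (nbhs_ballP _ _).1 (open_nbhs_nbhs (conj oM Mq)).
exists r => //= b /(row_ballP _ _ r0) Hb.
exists (row_mx b (rsubmx q)); last by rewrite /projb row_mxKl.
apply: rM; apply/(row_ballP _ _ r0) => i.
case: (split_ordP i) => j ->; first by rewrite row_mxEl; have := Hb j; rewrite mxE.
by rewrite row_mxEr mxE subrr normr0.
Qed.

(** The map replaces v and v_x, a local diffeomorphism as soon as the fibre Jacobian is nonzero, and
    then reflects the base; the reflection is its own inverse. *)
Lemma contact_equiv_of (eps : R) (v z : space -> R) (N D : set space) (mc : set oneform)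
    (w w0 : oneform) q :
  eps ^+ 2 = 1 -> open N -> N q -> smooth N v -> smooth N z ->
  partial i_v v q * partial i_vx z q - partial i_vx v q * partial i_v z q != 0 ->
  (forall x, N x -> D (extended_map eps v z x)) ->
  (forall a, mc a -> forall x, N x -> pullback (extended_map eps v z) a x = a x) ->
  (forall x, N x -> pullback (extended_map eps v z) w x = w0 x) ->
  contact_equiv_at mc D w q w0.
Proof.
move=> e2 oN Nq sv sz det0 ND Nmc Nw.
have L := local_diffeo_comp (local_diffeo_two oN Nq sv sz (negbT i_v_vx) det0)
  (@local_diffeo_signed_perm R _ _ id _ (fun i => flip_sign_sqr i e2) (fun i => erefl i)).
have {L} [M [Mq MN dM]] : local_diffeo N q (extended_map eps v z).
  apply: local_diffeo_eq L _ => x Nx; apply/rowP => i; rewrite !mxE.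
  case: eqVneq => [->|_]; first by rewrite /flip_sign /= mul1r.
  by case: eqVneq => [->|//]; rewrite /flip_sign /= mul1r.
have [oM _ _ _ _] := dM.
pose f (b : 'rV[R]_19) : 'rV[R]_19 := \row_i (flip_sign eps (lshift 2 i) * b 0 i).
have ff b : f (f b) = b.
  by apply/rowP => i; rewrite !mxE mulrA -expr2 flip_sign_sqr// mul1r.
have sf A : smooth_map A f.
  move=> j; rewrite (_ : (fun x => _) = fun x : 'rV[R]_19 => flip_sign eps (lshift 2 j) * x 0 j).
    move=> k; apply: class_C_sub (@subsetT _ A) _.
    by apply: class_CM; [exact: openT|exact: class_C_cst|exact: class_C_coord].
  by apply/funext => b; rewrite mxE.
have oB := projb_open oM.
exists M, (extended_map eps v z), f; split => //.
- by split => // _ [x Mx <-]; exact/ND/MN.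
- split; last first.
    move=> x Mx; apply/rowP => i; rewrite !mxE.
    have lt i0 : (19 <= nat_of_ord i0)%N -> (lshift 2 i == i0 :> 'I_(19 + 2)) = false.
      move=> H; apply/negP => /eqP /(congr1 val) /= E.
      by move: H; rewrite -E leqNgt ltn_ord.
    by rewrite !lt.
  split => //.
    rewrite (_ : f @` _ = f @^-1` (@projb R @` M)).
      apply: (@open_comp _ _ f) => // b _.
      by apply: (@smooth_continuous R 19 19 setT f b) => //; exact: sf.
    apply/seteqP; split => [_ [b [x Mx <-] <-]|b [x Mx Ex]].
      by exists x => //; rewrite ff.
    by exists (projb x); [exists x|rewrite Ex ff].
  by exists f; split => // b _; exact: ff.
- by move=> a /Nmc H x /MN; exact: H.
- by move=> x /MN; exact: Nw.
Qed.

End ExtendedMap.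

(** * Forms without fibre components *)

Section Invariance.
Context {R : realType}.
Notation space := 'rV[R]_(19 + 2).
Notation oneform := (@form1 R (19 + 2)).
Notation d_ i := (delta_mx ord0 i : space).
Implicit Types (eps : R) (a b x y : space).

Lemma flipD eps a b a' b' : flip eps a = a' -> flip eps b = b' -> flip eps (a + b) = a' + b'.
Proof. by move=> <- <-; apply/rowP => i; rewrite !mxE mulrDr. Qed.
Lemma flipN eps a a' : flip eps a = a' -> flip eps (- a) = - a'.
Proof. by move=> <-; apply/rowP => i; rewrite !mxE mulrN. Qed.
Lemma flipZ eps c a a' : flip eps a = a' -> flip eps (c *: a) = c *: a'.
Proof. by move=> <-; apply/rowP => i; rewrite !mxE mulrCA. Qed.
Lemma flip_delta eps k : flip eps (d_ k) = flip_sign eps k *: d_ k.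
Proof.
by apply/rowP => i; rewrite !mxE eqxx /=; case: eqVneq => [->|]; rewrite ?mulr0.
Qed.

Definition horizontal a := a 0 i_v = 0 /\ a 0 i_vx = 0.

Lemma horizontalD a b : horizontal a -> horizontal b -> horizontal (a + b).
Proof. by move=> [a1 a2] [b1 b2]; split; rewrite mxE ?a1 ?a2 ?b1 ?b2 addr0. Qed.
Lemma horizontalN a : horizontal a -> horizontal (- a).
Proof. by move=> [a1 a2]; split; rewrite mxE ?a1 ?a2 oppr0. Qed.
Lemma horizontalZ c a : horizontal a -> horizontal (c *: a).
Proof. by move=> [a1 a2]; split; rewrite mxE ?a1 ?a2 mulr0. Qed.
Lemma horizontal_delta k : k != i_v -> k != i_vx -> horizontal (d_ k).
Proof. by move=> kv kvx; split; rewrite mxE /= eq_sym ?(negPf kv) ?(negPf kvx). Qed.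

End Invariance.

Ltac flip_step := match goal with
  | |- flip _ (_ + _) = _ => apply: flipD
  | |- flip _ (- _) = _ => apply: flipN
  | |- flip _ (_ *: _) = _ => apply: flipZ
  | |- flip _ (delta_mx _ _) = _ => apply: flip_delta
  end.

Ltac horizontal_step := match goal with
  | |- horizontal (_ + _) => apply: horizontalD
  | |- horizontal (- _) => apply: horizontalN
  | |- horizontal (_ *: _) => apply: horizontalZ
  | |- horizontal (delta_mx _ _) => by apply: horizontal_delta
  | |- horizontal _ => by []
  end.

(** The nonvanishing hypotheses are reverted before the coordinates are generalized, so that they
    follow the new variables and discharge the side conditions of [field]. *)
Ltac entries_field q := entries;
  repeat match goal with H : is_true (_ != 0) |- _ => revert H end;
  abstract_entries; abstract_coords q; intros; field;
  repeat match goal with H : is_true (_ != 0) |- _ => rewrite ?oppr_eq0 ?H; clear H end;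
  by [].
Ltac solve_flip x := etransitivity; [by repeat flip_step|]; rewrite /flip_sign /=;
  repeat match goal with E : fun_of_matrix _ _ _ = _ |- _ => rewrite ?E; clear E end;
  let i := fresh "i" in apply/rowP => i; entries_field x.

Ltac flip_coordinates E := move: (E i_u isT isT) (E i_ux isT isT) (E i_uy isT isT) (E i_ut isT isT) (E i_utx isT isT) (E i_uty isT isT)
    (E i_uxx isT isT) (E i_uxy isT isT) (E i_utxx isT isT) (E i_uxxx isT isT) (E i_uxxy isT isT);
  rewrite /flip_sign /= ?mul1r ?mulN1r; clear E; do 11 (let e := fresh "e" in move=> e).

(** * Invariance of the Maurer-Cartan forms *)

Section MaurerCartan.
Context {R : realType}.
Notation space := 'rV[R]_(19 + 2).
Notation oneform := (@form1 R (19 + 2)).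
Variable k : R.
Implicit Types (x y : space).

Lemma horizontal_theta0 x : horizontal (theta0 x).
Proof. rewrite /theta0 /vtheta0; repeat horizontal_step. Qed.
Lemma horizontal_theta2 x : horizontal (theta2 x).
Proof. rewrite /theta2 /vtheta2; repeat horizontal_step. Qed.
Lemma horizontal_theta3 x : horizontal (theta3 k x).
Proof. rewrite /theta3 /vtheta0 /vtheta2 /vtheta3; repeat horizontal_step. Qed.
Lemma horizontal_theta22 x : horizontal (theta22 x).
Proof. rewrite /theta22 /vtheta22; repeat horizontal_step. Qed.
Lemma horizontal_xi1 x : horizontal (xi1 x).
Proof. rewrite /xi1; repeat horizontal_step. Qed.
Lemma horizontal_xi2 x : horizontal (xi2 k x).
Proof. rewrite /xi2; repeat horizontal_step. Qed.
Lemma horizontal_xi3 x : horizontal (xi3 k x).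
Proof. rewrite /xi3; repeat horizontal_step. Qed.
Lemma horizontal_eta1 x : horizontal (eta1 k x).
Proof. rewrite /eta1 /theta22 /vtheta22 /xi1 /xi2 /xi3; repeat horizontal_step. Qed.
Lemma horizontal_theta3' x : horizontal (theta3' x).
Proof. rewrite /theta3' /vtheta0 /vtheta2 /vtheta3; repeat horizontal_step. Qed.
Lemma horizontal_xi2' x : horizontal (xi2' x).
Proof. rewrite /xi2'; repeat horizontal_step. Qed.
Lemma horizontal_xi3' x : horizontal (xi3' x).
Proof. rewrite /xi3'; repeat horizontal_step. Qed.
Lemma horizontal_eta1' x : horizontal (eta1' x).
Proof. rewrite /eta1' /theta22 /vtheta22 /xi1 /xi2' /xi3'; repeat horizontal_step. Qed.

(** Relates base coordinates only; the fibre coordinates of y stay free, so the lemmas apply to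
    every [extended_map]. *)
Definition flipped (eps : R) x y := forall i, i != i_v -> i != i_vx -> y 0 i = flip_sign eps i * x 0 i.

(** For eps = -1 this is the symmetry of the equation under reversal of t and x: in each form the
    odd factors, such as u_xxx and dt, occur in pairs. *)
Lemma flip_mc_forms eps x y a : eps ^+ 2 = 1 -> generic x -> flipped eps x y ->
  mc_forms k a -> horizontal (a y) /\ flip eps (a y) = a x.
Proof.
move=> e2 [u2 u3] E.
have {e2} [e|e] : eps = 1 \/ eps = -1.
  by move/eqP: e2; rewrite sqrf_eq1 => /orP[/eqP|/eqP]; [left|right].
all: subst eps; flip_coordinates E.
all: case=> [[[[[[[->|->]|->]|->]|->]|->]|->]|->].
all: split; [first [exact: horizontal_theta0|exact: horizontal_theta2|exact: horizontal_theta3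
  |exact: horizontal_theta22|exact: horizontal_xi1|exact: horizontal_xi2|exact: horizontal_xi3
  |exact: horizontal_eta1]|].
all: rewrite /eta1 /theta0 /theta2 /theta3 /theta22 /vtheta0 /vtheta2 /vtheta3 /vtheta22
  /xi1 /xi2 /xi3 /Defs.invV /invU /uyy.
all: solve_flip x.
Qed.

Lemma flip_mc_forms' x y a : generic x -> flipped 1 x y ->
  [set theta0; theta2; theta3'; theta22; xi1; xi2'; xi3'; eta1'] a ->
  horizontal (a y) /\ flip 1 (a y) = a x.
Proof.
move=> [u2 u3] E.
flip_coordinates E.
case=> [[[[[[[->|->]|->]|->]|->]|->]|->]|->].
all: split; [first [exact: horizontal_theta0|exact: horizontal_theta2|exact: horizontal_theta3'
  |exact: horizontal_theta22|exact: horizontal_xi1|exact: horizontal_xi2'|exact: horizontal_xi3'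
  |exact: horizontal_eta1']|].
all: rewrite /eta1' /theta0 /theta2 /theta3' /theta22 /vtheta0 /vtheta2 /vtheta3 /vtheta22
  /xi1 /xi2' /xi3' /invU' /uyy.
all: solve_flip x.
Qed.
End MaurerCartan.

(** * Independence along the fibres *)

Section ContactEquivalence.
Context {R : realType}.
Notation space := 'rV[R]_(19 + 2).
Notation oneform := (@form1 R (19 + 2)).
Notation d_ i := (delta_mx ord0 i : space).
Implicit Types (x y q : space) (N : set space).

Lemma extended_map_flipped eps v z x : flipped eps x (extended_map eps v z x).
Proof. by move=> i iv ivx; rewrite extended_map_base. Qed.

Lemma pullback_horizontal eps v z N (a : oneform) x : open N -> smooth N v -> smooth N z -> N x ->
  horizontal (a (extended_map eps v z x)) ->
  pullback (extended_map eps v z) a x = flip eps (a (extended_map eps v z x)).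
Proof.
move=> oN sv sz Nx [a1 a2].
rewrite (@pullback_extended_map _ eps v z N a x 0 (a (extended_map eps v z x)))//.
  by rewrite scale0r add0r.
by rewrite scale0r add0r.
Qed.

Lemma row_free_fibre (a b : space) :
  row_free (col_mx (rsubmx a : 'rV[R]_2) (rsubmx b : 'rV[R]_2)) =
  (a 0 i_v * b 0 i_vx - a 0 i_vx * b 0 i_v != 0).
Proof.
pose A : 'M[R]_2 := col_mx (rsubmx a : 'rV[R]_2) (rsubmx b : 'rV[R]_2).
have det2 : \det A = A 0 0 * A 1 1 - A 0 1 * A 1 0.
  rewrite (expand_det_row _ 0) !big_ord_recl big_ord0 addr0 /cofactor !det_mx11 !mxE /=.
  rewrite (_ : lift 0 0 = 1 :> 'I_2); last exact: val_inj.
  rewrite (_ : lift 1 0 = 0 :> 'I_2); last exact: val_inj.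
  by rewrite expr0 expr1 mul1r mulN1r mulrN.
have A0 j : A 0 j = a 0 (rshift 19 j).
  have -> : (0 : 'I_2) = lshift 1 0 :> 'I_(1 + 1) by exact: val_inj.
  by apply: etrans (@col_mxEu R 1 1 2 _ _ 0 j) _; rewrite mxE.
have A1 j : A 1 j = b 0 (rshift 19 j).
  have -> : (1 : 'I_2) = rshift 1 0 :> 'I_(1 + 1) by exact: val_inj.
  by apply: etrans (@col_mxEd R 1 1 2 _ _ 0 j) _; rewrite mxE.
have iv : rshift 19 (0 : 'I_2) = i_v by exact: val_inj.
have ivx : rshift 19 (1 : 'I_2) = i_vx by exact: val_inj.
by rewrite -/A row_free_unit unitmxE unitfE det2 !A0 !A1 iv ivx.
Qed.

(** As b and the differential of r have no fibre components, the fibre entry of d w0 equals r / z^2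
    times the Jacobian of (v, z). *)
Lemma potential_independent N (w0 : oneform) (b : oneform) (r v z : space -> R) q :
  open N -> N q -> smooth N v -> smooth N z -> smooth N r -> smooth_map N b ->
  (forall x, N x -> z x != 0) ->
  (forall x, N x -> w0 x = (r x / z x) *: grad v x + b x) ->
  (forall x, N x -> horizontal (b x)) -> horizontal (grad r q) ->
  (dext w0 q) i_v i_vx != 0 ->
  partial i_v v q * partial i_vx z q - partial i_vx v q * partial i_v z q != 0.
Proof.
move=> oN Nq sv sz sr sb z0 w0E hb [hr1 hr2].
pose w1 x := (r x / z x) *: grad v x + b x.
have -> : dext w0 q i_v i_vx = dext w1 q i_v i_vx.
  rewrite !mxE; congr (_ - _); apply: (partial_local _ oN Nq) => x Nx; by rewrite w0E.
have gv : has_dext (grad v) q 0.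
  by rewrite -(dext_grad oN sv Nq); apply: smooth_has_dext Nq; exact: smooth_grad.
have gz := smooth_has_grad sz Nq; have gr := smooth_has_grad sr Nq.
have db := smooth_has_dext sb Nq.
have db0 : dext b q i_v i_vx = 0.
  rewrite !mxE.
  have E k j : j = i_v \/ j = i_vx -> partial k (fun x => b x 0 j) q = 0.
    move=> jv; rewrite -[RHS](derive_cst (0 : R) q (delta_mx 0 k)).
    apply: (partial_local _ oN Nq) => x Nx; have [h1 h2] := hb _ Nx.
    by case: jv => ->.
  by rewrite !E ?subrr; [|left|right].
have [_ ->] : has_dext w1 q _ :=
  has_dextD (has_dextZ (has_gradM gr (has_gradV (z0 _ Nq) gz)) gv) db.
move: db0 hr1 hr2; set D := dext b q; set gR := grad r q => db0 hr1 hr2.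
apply: contra => /eqP E; apply/eqP; etransitivity; first by repeat entry_step.
rewrite db0 hr1 hr2 ![grad v q _ _]mxE ![grad z q _ _]mxE.
transitivity (- r q / z q ^+ 2 * (partial i_v z q * partial i_vx v q - partial i_vx z q * partial i_v v q)).
  ring.
rewrite [X in _ * X](_ : _ = - (partial i_v v q * partial i_vx z q - partial i_vx v q * partial i_v z q)).
  by rewrite E oppr0 mulr0.
ring.
Qed.

End ContactEquivalence.

(** * Open domains, and smoothness of the base forms *)

Section GenericSets.
Context {R : realType}.
Notation space := 'rV[R]_(19 + 2).
Notation oneform := (@form1 R (19 + 2)).
Notation d_ i := (delta_mx ord0 i : space).
Implicit Types (x y q : space) (N : set space) (k : R).

Lemma open_coord_gt0 i : open [set x : space | 0 < x 0 i].
Proof.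
rewrite (_ : [set _ | _] = (fun x : space => x 0 i) @^-1` [set y | 0 < y])//.
apply: open_comp => [x _|]; first exact: coord_continuous.
exact: open_gt.
Qed.

Lemma open_coord_lt0 i : open [set x : space | x 0 i < 0].
Proof.
rewrite (_ : [set _ | _] = (fun x : space => x 0 i) @^-1` [set y | y < 0])//.
apply: open_comp => [x _|]; first exact: coord_continuous.
exact: open_lt.
Qed.

Lemma open_coord_neq0 i : open [set x : space | x 0 i != 0].
Proof.
rewrite (_ : [set _ | _] = [set x : space | x 0 i < 0] `|` [set x : space | 0 < x 0 i]).
  by apply: openU; [exact: open_coord_lt0|exact: open_coord_gt0].
by apply/seteqP; split => x /=; rewrite neq_lt => /orP.
Qed.

Lemma open_generic : open (@generic R).
Proof.
rewrite (_ : generic = [set x | x 0 i_uxx != 0] `&` [set x | x 0 i_uxxx != 0])//.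
by apply: openI; exact: open_coord_neq0.
Qed.

Lemma open_vx_nonzero : open (@vx_nonzero R).
Proof.
rewrite (_ : vx_nonzero = generic `&` [set x | x 0 i_vx != 0])//.
by apply: openI; [exact: open_generic|exact: open_coord_neq0].
Qed.

Lemma open_vx_positive : open (@vx_positive R).
Proof.
rewrite (_ : vx_positive = generic `&` [set x | 0 < x 0 i_vx])//.
by apply: openI; [exact: open_generic|exact: open_coord_gt0].
Qed.

Lemma open_vx_powers k : open (@vx_powers R k).
Proof.
have [ki|ki] := boolP (k \is a Num.int).
  rewrite (_ : vx_powers k = generic `&` ([set x | 0 < x 0 i_vx] `|` [set x | x 0 i_vx < 0])).
    apply: openI; first exact: open_generic.
    by apply: openU; [exact: open_coord_gt0|exact: open_coord_lt0].
  apply/seteqP; split => x.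
    by move=> [gx [xp|[xn _]]]; split => //; [left|right].
  by move=> [gx [xp|xn]]; split => //; [left|right].
rewrite (_ : vx_powers k = generic `&` [set x | 0 < x 0 i_vx]).
  by apply: openI; [exact: open_generic|exact: open_coord_gt0].
apply/seteqP; split => x [gx]; first by case=> [|[_ ki']] //; rewrite ki' in ki.
by move=> xp; split => //; left.
Qed.

Lemma vx_powers_nonzero k x : vx_powers k x -> vx_nonzero x.
Proof. by move=> [gx [vp|[vn _]]]; split => //; [exact: lt0r_neq0|exact: ltr0_neq0]. Qed.

Lemma vx_positive_nonzero x : vx_positive x -> vx_nonzero x.
Proof. by move=> [gx vp]; split => //; exact: lt0r_neq0. Qed.

End GenericSets.

Ltac solve_nonzero := match goal with |- forall _, _ -> is_true (_ != 0) => idtac end;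
  let x := fresh "x" in let Nx := fresh "Nx" in
  move=> x Nx;
  repeat match goal with
  | Nx : vx_positive x |- _ => move/vx_positive_nonzero: Nx => Nx
  | Nx : vx_powers _ x |- _ => move/vx_powers_nonzero: Nx => Nx
  | Nx : vx_nonzero x |- _ => case: Nx => [[? ?] ?]
  end;
  repeat match goal with S : ?N `<=` generic, Nx : ?N x |- _ => have [? ?] := S x Nx; clear Nx end;
  repeat match goal with
  | |- is_true (_ * _ != 0) => apply: mulf_neq0
  | |- is_true (_ ^+ _ != 0) => apply: expf_neq0
  | |- is_true (_ != 0) => first [assumption | by rewrite pnatr_eq0]
  end.
Ltac solve_smooth := repeat first [smooth_step | solve_nonzero].

Section FormsSmooth.
Context {R : realType}.
Notation space := 'rV[R]_(19 + 2).
Variables (k : R) (N : set space).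
Hypotheses (oN : open N) (Ng : N `<=` generic).

Lemma smooth_ratio : smooth N (fun x : space => x 0 i_uxxx / x 0 i_uxx).
Proof. solve_smooth. Qed.
Lemma smooth_theta0 : smooth_map N (@theta0 R).
Proof. rewrite /theta0 /vtheta0; solve_smooth. Qed.
Lemma smooth_theta2 : smooth_map N (@theta2 R).
Proof. rewrite /theta2 /vtheta2; solve_smooth. Qed.
Lemma smooth_theta3 : smooth_map N (theta3 k).
Proof. rewrite /theta3 /vtheta3 /vtheta2 /vtheta0 /uyy; solve_smooth. Qed.
Lemma smooth_theta22 : smooth_map N (@theta22 R).
Proof. rewrite /theta22 /vtheta22; solve_smooth. Qed.
Lemma smooth_xi1 : smooth_map N (@xi1 R).
Proof. rewrite /xi1; solve_smooth. Qed.
Lemma smooth_xi2 : smooth_map N (xi2 k).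
Proof. rewrite /xi2; solve_smooth. Qed.
Lemma smooth_xi3 : smooth_map N (xi3 k).
Proof. rewrite /xi3; solve_smooth. Qed.
Lemma smooth_invU : smooth N (@invU R).
Proof. rewrite /invU; solve_smooth. Qed.
Lemma smooth_invV : smooth N (Defs.invV k).
Proof. rewrite /Defs.invV; solve_smooth. Qed.
Lemma smooth_eta1 : smooth_map N (eta1 k).
Proof. rewrite /eta1 /theta22 /vtheta22 /xi1 /xi2 /xi3 /Defs.invV /invU; solve_smooth. Qed.
Lemma smooth_invU' : smooth N (@invU' R).
Proof. rewrite /invU'; solve_smooth. Qed.
Lemma smooth_theta3' : smooth_map N (@theta3' R).
Proof. rewrite /theta3' /vtheta3 /vtheta2 /vtheta0 /uyy; solve_smooth. Qed.
Lemma smooth_xi2' : smooth_map N (@xi2' R).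
Proof. rewrite /xi2'; solve_smooth. Qed.
Lemma smooth_xi3' : smooth_map N (@xi3' R).
Proof. rewrite /xi3'; solve_smooth. Qed.
Lemma smooth_eta1' : smooth_map N (@eta1' R).
Proof. rewrite /eta1' /theta22 /vtheta22 /xi1 /xi2' /xi3' /invU'; solve_smooth. Qed.

End FormsSmooth.

Ltac smooth_base_form := match goal with
  | |- context [theta0] => exact: smooth_theta0
  | |- context [theta2] => exact: smooth_theta2
  | |- context [theta3 _] => exact: smooth_theta3
  | |- context [theta22] => exact: smooth_theta22
  | |- context [xi1] => exact: smooth_xi1
  | |- context [xi2 _] => exact: smooth_xi2
  | |- context [xi3 _] => exact: smooth_xi3
  | |- context [eta1 _] => exact: smooth_eta1
  | |- context [theta3'] => exact: smooth_theta3'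
  | |- context [xi2'] => exact: smooth_xi2'
  | |- context [xi3'] => exact: smooth_xi3'
  | |- context [eta1'] => exact: smooth_eta1'
  | |- context [invU] => exact: smooth_invU
  | |- context [Defs.invV _] => exact: smooth_invV
  | |- context [invU'] => exact: smooth_invU'
  end.
Ltac horizontal_base_form := match goal with
  | |- context [theta0] => exact: horizontal_theta0
  | |- context [theta2] => exact: horizontal_theta2
  | |- context [theta3 _] => exact: horizontal_theta3
  | |- context [theta22] => exact: horizontal_theta22
  | |- context [xi1] => exact: horizontal_xi1
  | |- context [xi2 _] => exact: horizontal_xi2
  | |- context [xi3 _] => exact: horizontal_xi3
  | |- context [eta1 _] => exact: horizontal_eta1
  | |- context [theta3'] => exact: horizontal_theta3'
  | |- context [xi2'] => exact: horizontal_xi2'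
  | |- context [xi3'] => exact: horizontal_xi3'
  | |- context [eta1'] => exact: horizontal_eta1'
  end.

(** * System 1 *)

Section PotentialForm.
Context {R : realType}.
Notation space := 'rV[R]_(19 + 2).
Notation oneform := (@form1 R (19 + 2)).
Notation d_ i := (delta_mx ord0 i : space).
Notation ratio x := (x ord0 i_uxxx / x ord0 i_uxx).
Implicit Types (x y q : space) (N D : set space) (w chi a b : oneform).

Lemma ratio_neq0 x : generic x -> ratio x != 0.
Proof. by move=> [u2 u3]; rewrite mulf_neq0 ?invr_eq0. Qed.

Lemma has_grad_ratio x : generic x -> has_grad (fun y => ratio y) x
  (- (ratio x / x ord0 i_uxx) *: d_ i_uxx + (x ord0 i_uxx)^-1 *: d_ i_uxxx).
Proof.
move=> [u2 u3]; set g := (X in has_grad _ _ X).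
have -> : g = (x ord0 i_uxxx * - (x ord0 i_uxx ^- 2)) *: d_ i_uxx + (x ord0 i_uxx)^-1 *: d_ i_uxxx.
  by rewrite /g; congr (_ *: _ + _); field.
by rewrite -scalerA; repeat grad_step.
Qed.

Lemma horizontal_grad_ratio x : generic x -> horizontal (grad (fun y => ratio y) x).
Proof. by move=> gx; rewrite (grad_eq (has_grad_ratio gx)); repeat horizontal_step. Qed.

(* Near a point where it does not vanish along the fibres, w0 + chi is a multiple f dv of
   an exact form; v and the quotient of u_xxx / u_xx by f are the new coordinates. *)
Lemma contact_equiv_frobenius (mc : set oneform) w w0 chi b N q :
  open N -> N `<=` generic -> N q -> smooth_map N w0 -> smooth_map N chi ->
  (forall x, N x -> horizontal (chi x)) ->
  (forall x, N x -> dext (fun y => w0 y + chi y) x = b x ⋀ (w0 x + chi x)) ->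
  (dext w0 q) i_v i_vx != 0 -> ~ (w0 q 0 i_v = 0 /\ w0 q 0 i_vx = 0) ->
  (forall x y a, generic x -> generic y -> flipped 1 x y -> mc a -> horizontal (a y) /\ flip 1 (a y) = a x) ->
  (forall x y, N x -> flipped 1 x y -> y 0 i_vx != 0 -> exists h,
     [/\ w y = (ratio y / y 0 i_vx) *: d_ i_v + h, horizontal h & flip 1 h = - chi x]) ->
  contact_equiv_at mc vx_nonzero w q w0.
Proof.
move=> oN Ng Nq sw sc hc dw d0 fib mcE wE.
have sO : smooth_map N (fun y => w0 y + chi y) by exact: smooth_mapD.
have [s Os] : exists s, (w0 q + chi q) 0 s != 0.
  apply: contrapT => /forallNP H; apply: fib; have [c1 c2] := hc _ Nq.
  have E s : (w0 q + chi q) 0 s = 0 by apply/eqP/negPn/negP; exact: H.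
  by have := E i_v; have := E i_vx; rewrite !mxE c1 c2 !addr0.
have [M [f [v [[oM Mq MN sv] [sf f0 E]]]]] := frobenius oN sO Nq Os dw.
have Mg : M `<=` generic by move=> x /MN /Ng.
pose z x := ratio x / f x.
have z0 x : M x -> z x != 0.
  by move=> Mx; rewrite mulf_neq0 ?invr_eq0 ?f0//; exact/ratio_neq0/Mg.
have sz : smooth M z by apply: smoothM => //; [exact: smooth_ratio|exact: smoothV].
have w0E x : M x -> w0 x = (ratio x / z x) *: grad v x + - chi x.
  move=> Mx; have := E _ Mx => /(canRL (addrK _)) ->; congr (_ *: _ - _).
  by rewrite /z invf_div mulrC divfK// ratio_neq0//; exact: Mg.
have FE x : M x -> flipped 1 x (extended_map 1 v z x) by move=> _; exact: extended_map_flipped.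
have Fg x : M x -> generic (extended_map 1 v z x).
  move=> Mx; have [g1 g2] := Mg _ Mx.
  by rewrite /generic /= !(FE _ Mx) // /flip_sign /= !mul1r.
apply: (contact_equiv_of (expr1n _ 2) oM Mq sv sz).
- apply: (@potential_independent _ M w0 (fun x => - chi x) (fun x => ratio x) v z q) => //.
  + exact: smooth_ratio.
  + apply: smooth_mapN => //; exact: smooth_map_sub MN sc.
  + by move=> x /MN /hc; exact: horizontalN.
  + exact/horizontal_grad_ratio/Mg.
- by move=> x Mx; split; [exact: Fg|rewrite extended_map_vx; exact: z0].
- move=> a mca x Mx; have [ha <-] := mcE _ _ a (Mg _ Mx) (Fg _ Mx) (FE _ Mx) mca.
  exact: pullback_horizontal oM sv sz Mx ha.
- move=> x Mx; have zx : extended_map 1 v z x 0 i_vx != 0 by rewrite extended_map_vx z0.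
  have [h [wy [h1 h2] hx]] := wE _ _ (MN _ Mx) (FE _ Mx) zx.
  rewrite (pullback_extended_map oM sv sz Mx wy h1 h2) hx w0E//.
  by rewrite extended_map_vx !(FE _ Mx) // /flip_sign /= !mul1r.
Qed.

Lemma dext_local m (N : set 'rV[R]_m) (w w' : form1 m) (q : 'rV[R]_m) : open N -> N q ->
  (forall x : 'rV[R]_m, N x -> w x = w' x) -> dext w q = dext w' q.
Proof.
move=> oN Nq E; apply/matrixP => i j; rewrite !mxE.
by congr (_ - _); apply: (partial_local _ oN Nq) => x Nx; rewrite E.
Qed.

(** The logarithmic differential of u_xxx / (u_xx v_x), the factor of dv in all solutions. *)
Definition dlog_potential x : space :=
  (x ord0 i_uxxx)^-1 *: d_ i_uxxx - (x ord0 i_uxx)^-1 *: d_ i_uxx - (x ord0 i_vx)^-1 *: d_ i_vx.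

Lemma dext_potential x w chi H : vx_nonzero x ->
  (forall y, vx_nonzero y -> w y = (y ord0 i_uxxx / (y ord0 i_uxx * y ord0 i_vx)) *: d_ i_v - chi y) ->
  has_dext chi x H -> dext w x = dlog_potential x ⋀ (w x + chi x) - H.
Proof.
move=> Dx wE dh; rewrite (dext_local (@open_vx_nonzero R) Dx wE) wE// subrK.
have [[u2 u3] v0] := Dx.
apply: has_dext_eq.
  by repeat first [dext_step|grad_step]; rewrite mulf_neq0.
congr (_ - _); apply/matrixP => i j; rewrite /dlog_potential; entries_field x.
Qed.

Lemma new_forms_triangular D w0 w1 : smooth_map D w0 -> smooth_map D w1 ->
  (forall x, D x -> [/\ w0 x 0 i_v != 0, w0 x 0 i_vx = 0 & w1 x 0 i_vx != 0]) ->
  new_forms D w0 w1.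
Proof.
move=> s0 s1 H; split => // x Dx; have [v0 vx0 w10] := H _ Dx.
by rewrite row_free_fibre vx0 mul0r subr0 mulf_neq0.
Qed.

End PotentialForm.

(** * Solutions of system 1 *)

Section Case1.
Context {R : realType}.
Notation space := 'rV[R]_(19 + 2).
Notation oneform := (@form1 R (19 + 2)).
Notation d_ i := (delta_mx ord0 i : space).
Variable k : R.
Implicit Types (x y q : space).

Let alpha x := 2^-1 *: (eta1 k x + theta22 x) + (4^-1 * Defs.invV k x) *: xi1 x
   + (16^-1 * (8 * invU x + k + 12)) *: xi3 k x.

(** For system 1 the form chi is xi^2: the terms after the first one cancel those of the system that
    contain neither omega_0 nor omega_1. *)
Lemma dext_xi2 x : generic x ->
  dext (xi2 k) x = alpha x ⋀ xi2 k x
   - theta2 x ⋀ xi3 k x + ((8^-1 * (k - 4)) *: theta0 x - theta3 k x) ⋀ xi1 x.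
Proof.
move=> [u2 u3].
apply: has_dext_eq.
  by rewrite /xi2; repeat first [dext_step | grad_step].
apply/matrixP => i j.
rewrite /alpha /eta1 /theta22 /xi1 /xi3 /xi2 /theta2 /theta0 /theta3 /vtheta22 /vtheta0 /vtheta2 /vtheta3 /Defs.invV /invU /uyy.
by entries_field x.
Qed.

(** Every form except w0 and w1 is horizontal, so only their product reaches the fibre entry. *)
Lemma system1_entry (w1 w0 : space) x :
  ((w1 + 2^-1 *: (eta1 k x + theta22 x) + (4^-1 * Defs.invV k x) *: xi1 x
         + (16^-1 * (8 * invU x + k + 12)) *: xi3 k x) ⋀ w0
        + w1 ⋀ xi2 k x + theta2 x ⋀ xi3 k x
        - ((8^-1 * (k - 4)) *: theta0 x - theta3 k x) ⋀ xi1 x) i_v i_vx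
  = (w1 ⋀ w0) i_v i_vx.
Proof.
have [e1 e2] := horizontal_eta1 k x; have [t1 t2] := horizontal_theta22 x.
have [x1 x2] := horizontal_xi1 x; have [y1 y2] := horizontal_xi2 k x.
have [z1 z2] := horizontal_xi3 k x.
etransitivity; [by repeat entry_step|rewrite wedgeE].
by rewrite e1 e2 t1 t2 x1 x2 y1 y2 z1 z2; ring.
Qed.

Lemma omega1E x : vx_nonzero x ->
  omega1 k x = (x ord0 i_uxxx / (x ord0 i_uxx * x ord0 i_vx)) *: d_ i_v - xi2 k x.
Proof.
by move=> [[u2 u3] v0]; apply/rowP => i; rewrite /omega1 /xi2; entries_field x.
Qed.

Theorem solutions_sol1 : solutions_up_to_contact (sol1 k) (mc_forms k) vx_nonzero (fun _ : unit => omega1 k).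
Proof.
split=> [_|N w0 oN Ng [w1 [[sw0 sw1 rf] E]] q Nq].
  have oD := @open_vx_nonzero R; have Dg : @vx_nonzero R `<=` generic by move=> x [].
  (* Since w0 + chi is a function times dv, its differential is a logarithmic differential times
     itself; this has to be omega_1 + alpha. *)
  pose w1 x := dlog_potential x - alpha x.
  exists w1; split.
    apply: new_forms_triangular.
    - rewrite /omega1; solve_smooth.
    - apply: smooth_mapD => //; first by rewrite /dlog_potential; solve_smooth.
      by rewrite /alpha; solve_smooth; smooth_base_form.
    - move=> x Dx; have [[u2 u3] v0] := Dx; rewrite omega1E//.
      have [y1 y2] := horizontal_xi2 k x.
      have [a1 a2] : horizontal (alpha x).
        by rewrite /alpha; do !horizontal_step; horizontal_base_form.
      move: y1 y2 a2; rewrite /w1 /dlog_potential; move: (xi2 k x) (alpha x) => b c b1 b2 c2.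
      rewrite !mxE b1 b2 c2 /= !mulr0 !mulr1 !oppr0 !addr0 !add0r.
      by split; rewrite ?oppr_eq0 ?mulf_neq0 ?invr_eq0 ?mulf_neq0.
  move=> x Dx; have gx := Dg _ Dx.
  rewrite (dext_potential Dx omega1E (smooth_has_dext (smooth_xi2 k open_generic (fun _ => id)) gx)).
  rewrite dext_xi2// /w1 /alpha.
  move: (dlog_potential x) (omega1 k x) (eta1 k x) (theta22 x) (xi1 x) (xi2 k x) (xi3 k x) (theta0 x) (theta2 x) (theta3 k x) => a1 a2 a3 a4 a5 a6 a7 a8 a9 a10.
  by apply/matrixP => i j; entries; ring.
exists tt.
have sx : smooth_map N (xi2 k) by exact: smooth_xi2.
apply: (@contact_equiv_frobenius _ _ _ _ (xi2 k) (fun x => w1 x + alpha x) N) => //.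
- by move=> x _; exact: horizontal_xi2.
- move=> x Nx; have dw := smooth_has_dext sw0 Nx; have dx := smooth_has_dext sx Nx.
  rewrite (has_dext_eq (has_dextD dw dx) erefl) E// dext_xi2; last exact: Ng.
  rewrite /alpha.
  move: (w0 x) (w1 x) (eta1 k x) (theta22 x) (xi1 x) (xi2 k x) (xi3 k x) (theta0 x) (theta2 x) (theta3 k x) => a1 a2 a3 a4 a5 a6 a7 a8 a9 a10.
  by apply/matrixP => i j; entries; ring.
- rewrite E// system1_entry wedgeE.
  by have := rf _ Nq; rewrite row_free_fibre; apply: contra => /eqP e; rewrite -oppr_eq0 -e; apply/eqP; ring.
- move=> [e1 e2]; have := rf _ Nq; rewrite row_free_fibre e1 e2 !mul0r subrr.
  by rewrite eqxx.
- move=> x y a gx gy xy; exact: flip_mc_forms (expr1n _ 2) gx xy.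
- move=> x y Nx xy v0; exists (- xi2 k y); have [u2 u3] := Ng _ Nx.
  have gy : generic y.
    by rewrite /generic /= !xy// /flip_sign /= !mul1r.
  split; first by rewrite omega1E// invfM mulrA.
    exact/horizontalN/horizontal_xi2.
  have mc2 : mc_forms k (xi2 k) by rewrite /mc_forms /=; tauto.
  by have [_ <-] := flip_mc_forms (expr1n _ 2) (conj u2 u3) xy mc2; apply: flipN.
Qed.

End Case1.

(** * Forms with a closed multiple, and system 3 *)

Section ClosedForm.
Context {R : realType}.
Notation space := 'rV[R]_(19 + 2).
Notation oneform := (@form1 R (19 + 2)).
Notation d_ i := (delta_mx ord0 i : space).
Notation ratio x := (x ord0 i_uxxx / x ord0 i_uxx).
Implicit Types (x y q : space) (N D : set space) (w : oneform).

(** The closed form is dv; solving for w0 exhibits it as a pullback, with z in the place of v_x. The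
    factor eps is there because u_xxx changes sign with the reversal. *)
Lemma contact_equiv_closed (eps : R) (mc : set oneform) D w w0 (c : oneform) (z : space -> R) N q :
  eps ^+ 2 = 1 -> open N -> N `<=` generic -> N q -> smooth_map N w0 -> smooth_map N c ->
  smooth N z -> (forall x, N x -> z x != 0) -> (forall x, N x -> horizontal (c x)) ->
  (forall x, N x -> dext (fun y => (z y * y ord0 i_uxx / (eps * y ord0 i_uxxx)) *: w0 y - c y) x = 0) ->
  (dext w0 q) i_v i_vx != 0 ->
  (forall x y a, generic x -> generic y -> flipped eps x y -> mc a ->
     horizontal (a y) /\ flip eps (a y) = a x) ->
  (forall x y, N x -> generic y -> flipped eps x y -> y 0 i_vx = z x ->
     D y /\ exists h, [/\ w y = (ratio y / y 0 i_vx) *: (d_ i_v + h),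
       horizontal h & flip eps h = c x]) ->
  contact_equiv_at mc D w q w0.
Proof.
move=> e2 oN Ng Nq sw sc sz z0 hc dpsi d0 mcE wE.
have e0 : eps != 0 by apply: contra_eq_neq e2 => ->; rewrite expr0n /= eq_sym oner_neq0.
pose psi y := (z y * y ord0 i_uxx / (eps * y ord0 i_uxxx)) *: w0 y - c y.
have er0 x : N x -> eps * x ord0 i_uxxx != 0 by move=> /Ng[_ u3]; rewrite mulf_neq0.
have spsi : smooth_map N psi.
  by rewrite /psi; repeat smooth_step => //; rewrite /prop_in1.
have [r /= r0 rN] := (nbhs_ballP _ _).1 (open_nbhs_nbhs (conj oN Nq)).
have [v sv vE] := poincare_lemma r0 (smooth_map_sub rN spsi) (fun x Bx => dpsi _ (rN _ Bx)).
set M := ball q r in sv vE rN; have oM : open M by exact: ball_open.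
have Mq : M q by exact: ballxx.
have w0E x : M x -> w0 x = (eps * ratio x / z x) *: grad v x + (eps * ratio x / z x) *: c x.
  move=> Mx; have Nx := rN _ Mx; have [u2 u3] := Ng _ Nx; have zx := z0 _ Nx.
  rewrite vE// /psi -scalerDr subrK scalerA -[LHS]scale1r; congr (_ *: _).
  by field; rewrite ?u2 ?u3 ?zx ?e0.
have Fg x : M x -> generic (extended_map eps v z x).
  move=> /rN /Ng [g1 g2]; have FE := @extended_map_flipped R eps v z x.
  by rewrite /generic /= !FE // /flip_sign /= mul1r mulf_neq0.
have sze := smooth_sub rN sz.
apply: (contact_equiv_of e2 oM Mq sv sze).
- apply: (@potential_independent _ M w0 (fun x => (eps * ratio x / z x) *: c x)
    (fun x => eps * ratio x) v z q) => //.
  + apply: smoothM => //; first exact: smooth_cst.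
    by apply: smooth_ratio => // x /rN /Ng.
  + apply: smooth_mapZ => //; last exact: smooth_map_sub rN sc.
    apply: smoothM => //; last by apply: smoothV => // x /rN /z0.
    apply: smoothM => //; first exact: smooth_cst.
    by apply: smooth_ratio => // x /rN /Ng.
  + by move=> x /rN /z0.
  + by move=> x /rN /hc; exact: horizontalZ.
  + have gq := Ng _ Nq; have [h1 h2] := horizontal_grad_ratio gq.
    have H := has_gradM (has_grad_cst eps q) (has_grad_ratio gq).
    by rewrite (grad_eq H) scaler0 addr0; repeat horizontal_step.
- move=> x Mx; have FE := @extended_map_flipped R eps v z x.
  by have [] := wE _ _ (rN _ Mx) (Fg _ Mx) FE (extended_map_vx _ _ _ _).
- move=> a mca x Mx; have FE := @extended_map_flipped R eps v z x.
  have [ha <-] := mcE _ _ a (Ng _ (rN _ Mx)) (Fg _ Mx) FE mca.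
  exact: pullback_horizontal oM sv sze Mx ha.
- move=> x Mx; have FE := @extended_map_flipped R eps v z x.
  have [_ [h [wy [h1 h2] hx]]] := wE _ _ (rN _ Mx) (Fg _ Mx) FE (extended_map_vx _ _ _ _).
  rewrite scalerDr in wy.
  have [] := horizontalZ (ratio (extended_map eps v z x) / (extended_map eps v z x) 0 i_vx) (conj h1 h2).
  move=> k1 k2; rewrite (pullback_extended_map oM sv sze Mx wy k1 k2) w0E//.
  rewrite (flipZ _ hx) extended_map_vx !FE // /flip_sign /= !mul1r.
  by rewrite !mulrA.
Qed.

End ClosedForm.

(** * Solutions of system 3 *)

Section Case3.
Context {R : realType}.
Notation space := 'rV[R]_(19 + 2).
Notation oneform := (@form1 R (19 + 2)).
Notation d_ i := (delta_mx ord0 i : space).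
Implicit Types (x y q : space).
Let k : R := - 3.

(** The terms beside dv in [omega3], with a function z for v_x: z is the coordinate v_x in the
    explicit solution and 1 / (u_xx W) for an arbitrary one. *)
Let c3 (z : space -> R) x : space :=
  (x ord0 i_u + (x ord0 i_ux ^+ 2 + x ord0 i_uy) * z x) *: d_ i_t
   - z x *: d_ i_x + (z x * x ord0 i_ux + x ord0 i_x) *: d_ i_y.

Lemma dext_psi3 (w0 w1 : oneform) (W : space -> R) x : generic x -> W x != 0 ->
  has_dext w0 x ((w1 x + 2^-1 *: (eta1 k x + theta22 x) + (4^-1 * Defs.invV k x) *: xi1 x
         + (3 / 2) *: xi2 k x
         + (16^-1 * (8 * (invU x + 2 * W x) + 9)) *: xi3 k x) ⋀ w0 x
        + ((W x + 7 / 8) *: theta0 x + theta3 k x) ⋀ xi1 x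
        + w1 x ⋀ xi2 k x + theta2 x ⋀ xi3 k x) ->
  has_grad W x (W x *: (w1 x - theta22 x - (2^-1 * Defs.invV k x) *: xi1 x
                - (invU x - W x - 1) *: xi3 k x)) ->
  let z y := (y ord0 i_uxx * W y)^-1 in
  dext (fun y => (z y * y ord0 i_uxx / (1 * y ord0 i_uxxx)) *: w0 y - c3 z y) x = 0.
Proof.
move=> [u2 u3] W0 dw dW z.
(* The differential of w0 stays an atom while the derivative is computed; its value from the system
   is substituted only afterwards. *)
have cw : has_dext w0 x (dext w0 x) by have [] := dw.
have cW := dW.
apply: has_dext_eq.
  rewrite /c3 /z; repeat first [dext_step | grad_step]; by rewrite ?mul1r ?mulf_neq0.
apply/matrixP => i j; clear cw cW; case: dw => _ ->.
rewrite /z /eta1 /theta22 /xi1 /xi3 /xi2 /theta2 /theta0 /theta3 /vtheta22 /vtheta0 /vtheta2 /vtheta3 /Defs.invV /invU /uyy /k.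
move: (w0 x) (w1 x) (W x) W0 => a0 a1 W' W0; clear - a0 a1 W' W0 u2 u3.
entries_field x.
Qed.

Lemma omega3E x : vx_nonzero x -> omega3 x =
  (x ord0 i_uxxx / x ord0 i_uxx / x ord0 i_vx) *: (d_ i_v + c3 (fun y => y ord0 i_vx) x).
Proof.
by move=> [[u2 u3] v0]; rewrite /omega3 -mulrA -invfM /c3 !addrA.
Qed.

Let W3 x := (x ord0 i_uxx * x ord0 i_vx)^-1.
(** The equation for dW solved for omega_1; the first two terms are the logarithmic differential of
    [W3]. *)
Let w3 x := - (x ord0 i_uxx)^-1 *: d_ i_uxx - (x ord0 i_vx)^-1 *: d_ i_vx + theta22 x
  + (2^-1 * Defs.invV k x) *: xi1 x + (invU x - W3 x - 1) *: xi3 k x.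

Lemma dext_omega3 x : vx_nonzero x -> dext omega3 x =
  (w3 x + 2^-1 *: (eta1 k x + theta22 x) + (4^-1 * Defs.invV k x) *: xi1 x
         + (3 / 2) *: xi2 k x
         + (16^-1 * (8 * (invU x + 2 * W3 x) + 9)) *: xi3 k x) ⋀ omega3 x
        + ((W3 x + 7 / 8) *: theta0 x + theta3 k x) ⋀ xi1 x
        + w3 x ⋀ xi2 k x + theta2 x ⋀ xi3 k x.
Proof.
move=> [[u2 u3] v0]; apply: has_dext_eq.
  by rewrite /omega3; repeat first [dext_step | grad_step]; rewrite mulf_neq0.
apply/matrixP => i j.
rewrite /w3 /W3 /omega3 /eta1 /theta22 /xi1 /xi3 /xi2 /theta2 /theta0 /theta3 /vtheta22 /vtheta0 /vtheta2 /vtheta3 /Defs.invV /invU /uyy /k.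
entries_field x.
Qed.

Lemma grad_W3 x : vx_nonzero x -> grad W3 x =
  W3 x *: (w3 x - theta22 x - (2^-1 * Defs.invV k x) *: xi1 x - (invU x - W3 x - 1) *: xi3 k x).
Proof.
move=> [[u2 u3] v0].
etransitivity; first by apply: grad_eq; rewrite /W3; repeat grad_step; rewrite mulf_neq0.
apply/rowP => i; rewrite /w3 /W3.
move: (theta22 x) (xi1 x) (xi3 k x) => a b c; entries_field x.
Qed.

Lemma system3_entry (w1 w0 : space) (W : R) x :
  ((w1 + 2^-1 *: (eta1 k x + theta22 x) + (4^-1 * Defs.invV k x) *: xi1 x
         + (3 / 2) *: xi2 k x
         + (16^-1 * (8 * (invU x + 2 * W) + 9)) *: xi3 k x) ⋀ w0
        + ((W + 7 / 8) *: theta0 x + theta3 k x) ⋀ xi1 x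
        + w1 ⋀ xi2 k x + theta2 x ⋀ xi3 k x) i_v i_vx
  = (w1 ⋀ w0) i_v i_vx.
Proof.
have [e1 e2] := horizontal_eta1 k x; have [t1 t2] := horizontal_theta22 x.
have [x1 x2] := horizontal_xi1 x; have [y1 y2] := horizontal_xi2 k x.
have [z1 z2] := horizontal_xi3 k x.
etransitivity; [by repeat entry_step|rewrite wedgeE].
by rewrite e1 e2 t1 t2 x1 x2 y1 y2 z1 z2; ring.
Qed.

Theorem solutions_sol3 :
  solutions_up_to_contact (sol3 k) (mc_forms k) vx_nonzero (fun _ : unit => @omega3 R).
Proof.
split=> [_|N w0 oN Ng [w1 [W [[sw0 sw1 rf] sW W0 E]]] q Nq].
  have oD := @open_vx_nonzero R; have Dg : @vx_nonzero R `<=` generic by move=> x [].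
  have sW : smooth vx_nonzero W3 by rewrite /W3; solve_smooth.
  exists w3, W3; split => //.
  - apply: new_forms_triangular.
    + rewrite /omega3; solve_smooth.
    + by rewrite /w3; solve_smooth; smooth_base_form.
    + move=> x Dx; have [[u2 u3] v0] := Dx; rewrite omega3E//.
      have [b1 b2] : horizontal (c3 (fun y => y ord0 i_vx) x) by rewrite /c3; repeat horizontal_step.
      move: b1 b2; rewrite /w3; move: (horizontal_theta22 x) (horizontal_xi1 x) (horizontal_xi3 k x).
      move: (c3 _ x) (theta22 x) (xi1 x) (xi3 k x) => b t x1 x3 [_ t2] [_ x12] [_ x32] b1 b2.
      rewrite !mxE b1 b2 t2 x12 x32 /= !mulr0 !mulr1 !addr0 ?mulr0 ?sub0r.
      by split; rewrite ?oppr_eq0 ?mulf_neq0 ?invr_eq0 ?mulf_neq0.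
  - by move=> x [[u2 u3] v0]; rewrite invr_eq0 mulf_neq0.
  - by move=> x Dx; split; [exact: dext_omega3|exact: grad_W3].
exists tt.
pose z x := (x ord0 i_uxx * W x)^-1.
have z0 x : N x -> z x != 0.
  by move=> Nx; have [u2 u3] := Ng _ Nx; rewrite invr_eq0 mulf_neq0 ?W0.
have sz : smooth N z.
  rewrite /z; repeat smooth_step => //.
  by move=> x Nx; have [u2 u3] := Ng _ Nx; rewrite mulf_neq0 ?W0.
apply: (@contact_equiv_closed _ 1 _ _ _ _ (c3 z) z N) => //.
- by rewrite expr1n.
- by rewrite /c3; repeat smooth_step.
- by move=> x _; rewrite /c3; repeat horizontal_step.
- move=> x Nx; have [E1 E2] := E _ Nx; have gx := Ng _ Nx.
  apply: (dext_psi3 gx (W0 _ Nx) (w1 := w1)).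
    by have := smooth_has_dext sw0 Nx; rewrite E1.
  by have := smooth_has_grad sW Nx; rewrite E2.
- have [-> _] := E _ Nq; rewrite system3_entry wedgeE.
  by have := rf _ Nq; rewrite row_free_fibre; apply: contra => /eqP e; rewrite -oppr_eq0 -e; apply/eqP; ring.
- by move=> x y a gx gy xy; exact: flip_mc_forms (expr1n _ 2) gx xy.
- move=> x y Nx gy xy yz; have zx := z0 _ Nx.
  have Dy : vx_nonzero y by split => //; rewrite yz.
  split => //; exists (c3 (fun y => y ord0 i_vx) y); split; first exact: omega3E.
    by rewrite /c3; repeat horizontal_step.
  rewrite /c3; etransitivity; [by repeat flip_step|].
  by rewrite yz !xy// /flip_sign /= !scale1r !mul1r.
Qed.
End Case3.

(** * System 2 *)

Section Case2.
Context {R : realType}.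
Notation space := 'rV[R]_(19 + 2).
Notation oneform := (@form1 R (19 + 2)).
Notation d_ i := (delta_mx ord0 i : space).
Implicit Types (x y q : space).
Variable k : R.
Hypothesis k1 : k + 1 != 0.

(** The terms beside dv in [omega2], with z for v_x, p for v_x^(kappa+1), and a, b for primitives of
    p^2 and p. Only a' = p^2 and b' = p enter the computations, so one proof covers the logarithmic
    cases too. *)
Definition potential2 (eps : R) (a b p z : space -> R) x : space :=
  (- eps * (a x - eps * x ord0 i_ux * p x * z x
     + (2^-1 * (k + 1) * x ord0 i_ux ^+ 2 - x ord0 i_uy) * z x)) *: d_ i_t
   - (eps * z x) *: d_ i_x - (b x - eps * x ord0 i_ux * z x) *: d_ i_y.

Definition system2 (w0 w1 : space) (W : R) x :=
  (w1 + 2^-1 *: (eta1 k x + theta22 x) + (4^-1 * (Defs.invV k x - 2 * W * (W - 2))) *: xi1 x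
         + (16^-1 * (8 * (invU x - W) + k + 12)) *: xi3 k x) ⋀ w0
        + (W ^+ 2 *: w1 - (8^-1 * (k - 4)) *: theta0 x + W *: theta2 x + theta3 k x) ⋀ xi1 x
        + w1 ⋀ xi2 k x + (W *: w1 + theta2 x) ⋀ xi3 k x.

Definition grad2 (w0 w1 : space) (W : R) x : space :=
  (16^-1 * W) *: (8 *: (eta1 k x - theta22 x - k *: w0 - (2 * (k + 1)) *: w1)
         - (4 * (Defs.invV k x - 2 * W * (W - 2 * (k + 1)))) *: xi1 x
         - (8 * (invU x - W) + 5 * (3 * k + 4)) *: xi3 k x).

Lemma dext_psi2 (eps : R) (w0 w1 : oneform) (W a b z : space -> R) x :
  eps ^+ 2 = 1 -> generic x -> W x != 0 ->
  has_dext w0 x (system2 (w0 x) (w1 x) (W x) x) ->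
  has_grad W x (grad2 (w0 x) (w1 x) (W x) x) ->
  let p y := eps * (W y * y ord0 i_uxx ^+ 2 / y ord0 i_uxxx) in
  (* From p = z^(kappa+1): (kappa + 1) dz / z is the logarithmic differential of W u_xx^2 /
     u_xxx. *)
  let dz := (z x / (k + 1)) *: ((W x)^-1 *: grad2 (w0 x) (w1 x) (W x) x
              + (2 / x ord0 i_uxx) *: d_ i_uxx - (x ord0 i_uxxx)^-1 *: d_ i_uxxx) in
  has_grad z x dz -> has_grad a x (p x ^+ 2 *: dz) -> has_grad b x (p x *: dz) ->
  dext (fun y => (z y * y ord0 i_uxx / (eps * y ord0 i_uxxx)) *: w0 y - potential2 eps a b p z y) x = 0.
Proof.
move=> /eqP + [u2 u3] W0 dw dW p dz gz ga gb.
rewrite sqrf_eq1 => /orP e.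
have e0 : eps != 0 by case: e => /eqP ->; rewrite ?oppr_eq0 oner_neq0.
apply: has_dext_eq.
  by rewrite /potential2 /p; repeat first [dext_step | grad_step]; rewrite ?mulf_neq0.
apply/matrixP => i j.
rewrite /p /dz /system2 /grad2 /eta1 /theta22 /xi1 /xi3 /xi2 /theta2 /theta0 /theta3 /vtheta22 /vtheta0 /vtheta2 /vtheta3 /Defs.invV /invU /uyy.
move: (w0 x) (w1 x) (W x) (a x) (b x) (z x) W0 => a0 a1 W' A B Z W0.
clear - k1 a0 a1 W' A B Z W0 u2 u3 e.
case: e => /eqP ->; entries_field x.
Qed.


Lemma system2_entry (w1 w0 : space) (W : R) x :
  (system2 w0 w1 W x) i_v i_vx = (w1 ⋀ w0) i_v i_vx.
Proof.
have [e1 e2] := horizontal_eta1 k x; have [t1 t2] := horizontal_theta22 x.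
have [x1 x2] := horizontal_xi1 x; have [y1 y2] := horizontal_xi2 k x.
have [z1 z2] := horizontal_xi3 k x.
etransitivity; [by rewrite /system2; repeat entry_step|rewrite wedgeE].
by rewrite e1 e2 t1 t2 x1 x2 y1 y2 z1 z2; ring.
Qed.

Lemma horizontal_potential2 eps a b p z x : horizontal (potential2 eps a b p z x).
Proof. rewrite /potential2; repeat horizontal_step. Qed.

Section Functions.
Variables (D : set space) (w : oneform) (p a b : R -> R).
Hypotheses (oD : open D) (Dv : D `<=` vx_nonzero).
Hypothesis wE : forall x, D x -> w x =
  (x ord0 i_uxxx / x ord0 i_uxx / x ord0 i_vx) *: (d_ i_v
    + potential2 1 (fun y => a (y ord0 i_vx)) (fun y => b (y ord0 i_vx))
        (fun y => p (y ord0 i_vx)) (fun y => y ord0 i_vx) x).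

Section Forward.
Hypotheses
  (sp : smooth D (fun x => p (x ord0 i_vx)))
  (sa : smooth D (fun x => a (x ord0 i_vx)))
  (sb : smooth D (fun x => b (x ord0 i_vx)))
  (p0 : forall x, D x -> p (x ord0 i_vx) != 0)
  (dp : forall x, D x -> is_derive (x ord0 i_vx) 1 p ((k + 1) * p (x ord0 i_vx) / x ord0 i_vx))
  (da : forall x, D x -> is_derive (x ord0 i_vx) 1 a (p (x ord0 i_vx) ^+ 2))
  (db : forall x, D x -> is_derive (x ord0 i_vx) 1 b (p (x ord0 i_vx))).

Let W2 x := x ord0 i_uxxx / x ord0 i_uxx ^+ 2 * p (x ord0 i_vx).
Let dlogW x : space := (x ord0 i_uxxx)^-1 *: d_ i_uxxx - (2 / x ord0 i_uxx) *: d_ i_uxx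
  + ((k + 1) / x ord0 i_vx) *: d_ i_vx.
(* the equation for dW, solved for omega_1 *)
Let w2 x := (2 * (k + 1))^-1 *: (eta1 k x - theta22 x - k *: w x
   - (2^-1 * (Defs.invV k x - 2 * W2 x * (W2 x - 2 * (k + 1)))) *: xi1 x
   - (8^-1 * (8 * (invU x - W2 x) + 5 * (3 * k + 4))) *: xi3 k x - 2 *: dlogW x).

Lemma dext_omega2 x : D x -> dext w x = system2 (w x) (w2 x) (W2 x) x.
Proof.
move=> Dx; have [[u2 u3] v0] := Dv Dx.
have gp := has_grad_comp1 (dp Dx) (has_grad_coord i_vx x).
have ga := has_grad_comp1 (da Dx) (has_grad_coord i_vx x).
have gb := has_grad_comp1 (db Dx) (has_grad_coord i_vx x).
rewrite (dext_local oD Dx wE) /system2 /w2 wE //.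
apply: has_dext_eq.
  by rewrite /potential2; repeat first [dext_step | grad_step].
apply/matrixP => i j.
rewrite /dlogW /W2 /potential2 /eta1 /theta22 /xi1 /xi3 /xi2 /theta2 /theta0 /theta3 /vtheta22 /vtheta0 /vtheta2 /vtheta3 /Defs.invV /invU /uyy.
move: (a (x ord0 i_vx)) (b (x ord0 i_vx)) (p (x ord0 i_vx)) => A B P.
clear - k1 u2 u3 v0 A B P.
entries_field x.
Qed.

Lemma grad_W2 x : D x -> grad W2 x = grad2 (w x) (w2 x) (W2 x) x.
Proof.
move=> Dx; have [[u2 u3] v0] := Dv Dx.
have gp := has_grad_comp1 (dp Dx) (has_grad_coord i_vx x).
etransitivity; first by apply: grad_eq; rewrite /W2; repeat grad_step; rewrite expf_neq0.
rewrite /grad2 /w2 /W2 /dlogW.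
move: (eta1 k x) (theta22 x) (w x) (xi1 x) (xi3 k x) (invU x) (Defs.invV k x) (p (x ord0 i_vx)) => e t w' x1 x3 U V P.
clear - k1 u2 u3 v0 e t w' x1 x3 U V P.
have two : 2 * (k + 1) != 0 by rewrite mulf_neq0// pnatr_eq0.
by apply/rowP => i; entries_field x.
Qed.

Lemma sol2_omega2 : sol2 k D w.
Proof.
have Dg : D `<=` generic by move=> x /Dv[].
have D0 x : D x -> [/\ x ord0 i_uxx != 0, x ord0 i_uxxx != 0 & x ord0 i_vx != 0].
  by move=> /Dv[[]].
have sW : smooth D W2.
  by rewrite /W2; repeat smooth_step => //; move=> x /D0[u2 u3 v0]; rewrite ?expf_neq0.
have sw : smooth_map D w.
  apply: (smooth_map_eq oD (w := fun x => (x ord0 i_uxxx / x ord0 i_uxx / x ord0 i_vx) *: (d_ i_v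
    + potential2 1 (fun y => a (y ord0 i_vx)) (fun y => b (y ord0 i_vx))
        (fun y => p (y ord0 i_vx)) (fun y => y ord0 i_vx) x))).
    by move=> x Dx; rewrite wE.
  by rewrite /potential2; repeat smooth_step => //; move=> x /D0[].
have sV := smooth_invV k oD Dg; have sU := smooth_invU oD Dg.
exists w2, W2; split => //.
- apply: new_forms_triangular => //.
    rewrite /w2 /dlogW; repeat smooth_step => //; try by smooth_base_form.
    all: try by move=> x /D0[].
  move=> x Dx; have [u2 u3 v0] := D0 _ Dx.
  have [p1 p2] := horizontal_potential2 1 (fun y => a (y ord0 i_vx)) (fun y => b (y ord0 i_vx))
        (fun y => p (y ord0 i_vx)) (fun y => y ord0 i_vx) x.
  have wv : w x 0 i_v = x ord0 i_uxxx / x ord0 i_uxx / x ord0 i_vx.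
    rewrite wE//; move: p1; move: (potential2 _ _ _ _ _ _) => c c1.
    by rewrite !mxE c1 /= addr0 mulr1.
  have wvx : w x 0 i_vx = 0.
    rewrite wE//; move: p2; move: (potential2 _ _ _ _ _ _) => c c1.
    by rewrite !mxE c1 /= addr0 mulr0.
  split => //; first by rewrite wv !mulf_neq0 ?invr_eq0.
  have -> : w2 x 0 i_vx = - (x ord0 i_vx)^-1.
    rewrite /w2 /dlogW; move: wvx (horizontal_eta1 k x) (horizontal_theta22 x) (horizontal_xi1 x) (horizontal_xi3 k x).
    move: (w x) (eta1 k x) (theta22 x) (xi1 x) (xi3 k x) => c c1 c2 c3 c4 h [_ h1] [_ h2] [_ h3] [_ h4].
    rewrite !mxE h h1 h2 h3 h4 /=; field.
    by rewrite v0 u2 u3 k1.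
  by rewrite oppr_eq0 invr_eq0.
- by move=> x Dx; have [u2 u3 v0] := D0 _ Dx; rewrite !mulf_neq0 ?invr_eq0 ?expf_neq0 ?p0.
- by move=> x Dx; split; [exact: dext_omega2|exact: grad_W2].
Qed.

End Forward.

Hypothesis Dpos : vx_positive `<=` D.
Hypotheses (pE : forall s : R, 0 < s -> p s = expR ((k + 1) * ln s))
  (da : forall s : R, 0 < s -> is_derive s 1 a (p s ^+ 2))
  (db : forall s : R, 0 < s -> is_derive s 1 b (p s))
  (sa : smooth vx_positive (fun x => a (x ord0 i_vx)))
  (sb : smooth vx_positive (fun x => b (x ord0 i_vx))).

Lemma smooth_pos_subset (N : set space) f q : open N -> smooth N f -> N q -> 0 < f q ->
  exists M, [/\ open M, M q, M `<=` N & forall x, M x -> 0 < f x].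
Proof.
move=> oN sf Nq f0.
have [r1 /= r10 r1N] := (nbhs_ballP _ _).1 (open_nbhs_nbhs (conj oN Nq)).
have [r2 r20 H] := (continuous_dist _ _).1 ((sf 0%N).1 q Nq) _ f0.
have r0 : 0 < Num.min r1 r2 by rewrite lt_min r10.
exists (ball q (Num.min r1 r2)); split => //; first exact: ball_open.
- exact: ballxx.
- by move=> x /ball_dist; rewrite lt_min => /andP[/ball_dist/r1N].
- move=> x /ball_dist; rewrite lt_min => /andP[_ /H /ltr_normlP[]]; lra.
Qed.

(** Here eps is the sign of W u_xx^2 / u_xxx at q. Near q the new v_x is the positive root of
    v_x^(kappa+1) = eps W u_xx^2 / u_xxx, so the map always lands in [vx_positive], whatever D
    is. *)
Lemma contact_sol2 (N : set space) w0 q : open N -> N `<=` generic -> sol2 k N w0 -> N q ->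
  contact_equiv_at (mc_forms k) D w q w0.
Proof.
move=> oN' Ng' [w1 [W [[sw0' sw1' rf'] sW' W0' E']]] Nq'.
pose P x := W x * x ord0 i_uxx ^+ 2 / x ord0 i_uxxx.
have P0 x : N x -> P x != 0.
  by move=> Nx; have [u2 u3] := Ng' _ Nx; rewrite /P !mulf_neq0 ?invr_eq0 ?expf_neq0 ?W0'.
have sP : smooth N P.
  by rewrite /P; repeat smooth_step => //; move=> x /Ng'[].
have [eps e2 eP] : exists2 eps : R, eps ^+ 2 = 1 & 0 < eps * P q.
  have [Pq|Pq|Pq] := ltgtP (P q) 0.
  - by exists (-1); rewrite ?sqrrN ?expr1n// mulN1r oppr_gt0.
  - by exists 1; rewrite ?expr1n// mul1r.
  - by move: (P0 _ Nq'); rewrite Pq eqxx.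
have sPe : smooth N (fun x => eps * P x) by apply: smoothM => //; exact: smooth_cst.
have [M [oM Mq MN MP]] := smooth_pos_subset oN' sPe Nq' eP.
pose z x := expR ((k + 1)^-1 * ln (eps * P x)).
have z0 x : 0 < z x by exact: expR_gt0.
have pz x : M x -> p (z x) = eps * P x.
  by move=> Mx; rewrite pE// /z expRK mulrA divff// mul1r lnK// posrE MP.
have sPM := smooth_sub MN sPe; have sP' := smooth_sub MN sP.
have sz : smooth M z.
  move=> n; apply: class_C_expR => //; apply: (smoothM oM) n; first exact: smooth_cst.
  by move=> n; exact: class_C_ln.
(* Smoothness of a and b is known on the extended space; a(z) and b(z) are obtained by composing
   with the map that puts z in place of v_x. *)
have sG : smooth_map M (fun x => setc i_vx x (z x)).
  move=> j; have [->|jv] := eqVneq j i_vx.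
    by rewrite (_ : (fun x => setc i_vx x (z x) 0 i_vx) = z)//; apply/funext => x; rewrite setcE.
  rewrite (_ : (fun x => setc i_vx x (z x) 0 j) = fun x => x 0 j); first exact: smooth_coord.
  by apply/funext => x; rewrite mxE (negPf jv).
have Ng x : M x -> generic x by move=> /MN/Ng'.
have GM x : M x -> vx_positive (setc i_vx x (z x)).
  by move=> /Ng[u2 u3]; split; rewrite ?setcE// /generic /= !mxE.
have saz : smooth M (fun x => a (z x)).
  rewrite (_ : (fun x => _) = fun x => a (setc i_vx x (z x) 0 i_vx)).
    exact: smooth_comp oM (@open_vx_positive R) GM sG sa.
  by apply/funext => x; rewrite setcE.
have sbz : smooth M (fun x => b (z x)).
  rewrite (_ : (fun x => _) = fun x => b (setc i_vx x (z x) 0 i_vx)).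
    exact: smooth_comp oM (@open_vx_positive R) GM sG sb.
  by apply/funext => x; rewrite setcE.
have e0 : eps != 0 by apply: contra_eq_neq e2 => ->; rewrite expr0n /= eq_sym oner_neq0.
pose pot := potential2 eps (fun x => a (z x)) (fun x => b (z x)) (fun x => eps * P x) z.
apply: (@contact_equiv_closed _ eps _ _ _ _ pot z M) => //.
- exact: smooth_map_sub MN sw0'.
- by rewrite /pot /potential2; repeat smooth_step.
- by move=> x _; exact: lt0r_neq0.
- by move=> x _; exact: horizontal_potential2.
- move=> x Mx; have [E1 E2] := E' _ (MN _ Mx).
  have gW : has_grad W x (grad2 (w0 x) (w1 x) (W x) x).
    by have := smooth_has_grad sW' (MN _ Mx); rewrite E2.
  have W0 := W0' _ (MN _ Mx); have [u2 u3] := Ng _ Mx.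
  have gz : has_grad z x ((z x / (k + 1)) *: ((W x)^-1 *: grad2 (w0 x) (w1 x) (W x) x
              + (2 / x ord0 i_uxx) *: d_ i_uxx - (x ord0 i_uxxx)^-1 *: d_ i_uxxx)).
    have gP : has_grad (fun x => eps * P x) x _ :=
      has_gradM (has_grad_cst eps x) (has_gradM (has_gradM gW (has_gradX 2 (has_grad_coord i_uxx x)))
        (has_gradV u3 (has_grad_coord i_uxxx x))).
    have gl := has_grad_comp1 (is_derive1_ln (MP _ Mx)) gP.
    have ge := has_grad_comp1 (is_derive_expR _) (has_gradM (has_grad_cst (k + 1)^-1 x) gl).
    have := ge; rewrite -/(z x); congr (has_grad _ _ _).
    rewrite scaler0 addr0 /P; move: (W x) W0 (z x) (grad2 _ _ _ _) => W' W0 Z g.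
    clear - k1 e0 u2 u3 W0.
    by apply/rowP => i; entries_field x.
  have ga := has_grad_comp1 (da (z0 x)) gz; have gb := has_grad_comp1 (db (z0 x)) gz.
  rewrite (pz _ Mx) in ga gb.
  apply: (dext_psi2 (w1 := w1) e2 (Ng _ Mx) W0) => //.
  by have := smooth_has_dext sw0' (MN _ Mx); rewrite E1.
- have [-> _] := E' _ Nq'; rewrite -/(system2 _ _ _ _) system2_entry wedgeE.
  by have := rf' _ Nq'; rewrite row_free_fibre; apply: contra => /eqP e; rewrite -oppr_eq0 -e; apply/eqP; ring.
- by move=> x y c gx gy xy; exact: flip_mc_forms e2 gx xy.
- move=> x y Mx gy xy yz.
  have Dy : D y by apply: Dpos; split => //; rewrite yz.
  split => //; eexists; split; [exact: wE|exact: horizontal_potential2|].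
  rewrite /pot /potential2; etransitivity; [by repeat flip_step|].
  rewrite yz (pz _ Mx) !xy// /flip_sign /=; move: (P x) (z x) => Q Z.
  move: (a Z) (b Z) => A B; move/eqP: e2; rewrite sqrf_eq1 => /orP e.
  by case: e => /eqP ->; apply/rowP => i; entries_field x.
Qed.

End Functions.
End Case2.

(** * Real powers on half-lines *)

Section RealPowers.
Context {R : realType}.
Notation space := 'rV[R]_(19 + 2).
Implicit Types (r s e : R).

(** One closed form on the half-line e s > 0 for both signs e: the constant c is 1, or (-1)^n for s
    < 0 and r = n an integer. *)
Lemma rpow_expR r e : e ^+ 2 = 1 -> e = 1 \/ r \is a Num.int ->
  exists2 c : R, c ^+ 2 = 1 & forall s, 0 < e * s -> rpow s r = c * expR (r * ln (e * s)).
Proof.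
move=> e2 er.
have pos s : 0 < s -> rpow s r = 1 * expR (r * ln s).
  by move=> s0; rewrite /rpow s0 /powR gt_eqF// mul1r.
have [e1|e1] : e = 1 \/ e = -1.
- by move/eqP: e2; rewrite sqrf_eq1 => /orP[/eqP|/eqP]; [left|right].
- by exists 1; rewrite ?expr1n// => s; rewrite e1 mul1r; exact: pos.
case: er => [e1'|/intrP[n ->]].
  by exists 1; rewrite ?expr1n// => s; rewrite e1' mul1r; exact: pos.
exists ((-1) ^ n).
  by rewrite expr2 -expfzMl mulrNN mulr1 exp1rz.
move=> s; rewrite e1 mulN1r => s0; rewrite /rpow ltNge ltW ?oppr_gt0 -?oppr_gt0//=.
rewrite intrKfloor (_ : s ^ n = (-1) ^ n * (- s) ^ n); last by rewrite -expfzMl mulN1r opprK.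
by congr (_ * _); rewrite -powR_intmul ?ltW// /powR gt_eqF.
Qed.

Lemma rpow_double r s : 0 < s \/ r \is a Num.int -> s != 0 -> rpow s (2 * r) = rpow s r ^+ 2.
Proof.
move=> H s0; have [sp|sn] := ltP 0 s.
  rewrite /rpow sp /powR gt_eqF// -expRM_natl.
  by rewrite mulrA.
case: H => [|/intrP[n ->]]; first by rewrite ltNge sn.
have -> : 2 * n%:~R = (n * 2)%:~R :> R by rewrite intrM mulrC.
by rewrite /rpow ltNge sn /= !intrKfloor -exprz_exp.
Qed.

Lemma open_half_line e : open [set s : R | 0 < e * s].
Proof.
rewrite (_ : [set _ | _] = (fun s => e * s) @^-1` [set t | 0 < t])//.
apply: open_comp => [s _|]; last exact: open_gt.
by apply: continuousM => //; exact: cst_continuous.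
Qed.

Lemma is_derive_half_line (f g : R -> R) (s d e : R) : 0 < e * s ->
  (forall t, 0 < e * t -> f t = g t) -> is_derive s 1 f d -> is_derive s 1 g d.
Proof.
move=> es fg; apply: near_eq_is_derive.
have := open_nbhs_nbhs (conj (@open_half_line e) (es : [set t | 0 < e * t] s)).
by apply: filterS => t; exact: fg.
Qed.

Lemma is_derive_scaled_exp r e s c : 0 < e * s -> e ^+ 2 = 1 ->
  is_derive s 1 (fun t => c * expR (r * ln (e * t))) (r * (c * expR (r * ln (e * s))) / s).
Proof.
move=> es e2; have s0 : s != 0 by apply: contraL es => /eqP ->; rewrite mulr0 ltxx.
have e0 : e != 0 by apply: contraL es => /eqP ->; rewrite mul0r ltxx.
have D1 : is_derive s 1 (fun t : R => e * t) e.
  by have := is_deriveZ e (is_derive_id s (1 : R)); rewrite -[e *: 1]/(e * 1) mulr1.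
have D2 : is_derive s 1 (fun t : R => r * ln (e * t)) (r * ((e * s)^-1 * e)).
  have := is_deriveZ r (is_derive1_comp (is_derive1_ln es) D1).
  by move=> H; exact: H.
have := is_deriveZ c (is_derive1_comp (is_derive_expR _) D2).
move=> H; apply: is_derive_eq H _; rewrite /GRing.scale /=; move: (expR _) => E.
by field; rewrite s0 e0.
Qed.

Lemma is_derive_rpow r s : 0 < s \/ s < 0 /\ r \is a Num.int ->
  is_derive s 1 (fun t => rpow t r) (r * rpow s r / s).
Proof.
move=> H; have [e e2 [es er]] : exists2 e, e ^+ 2 = 1 & 0 < e * s /\ (e = 1 \/ r \is a Num.int).
  case: H => [s0|[s0 ri]]; first by exists 1; rewrite ?expr1n ?mul1r//; split => //; left.
  by exists (-1); rewrite ?sqrrN ?expr1n ?mulN1r ?oppr_gt0//; split => //; right.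
have [c _ cE] := rpow_expR e2 er.
rewrite cE//; apply: (is_derive_half_line es) (is_derive_scaled_exp r c es e2) => t et.
by rewrite cE.
Qed.

Lemma smooth_expR (N : set space) f : open N -> smooth N f -> smooth N (fun x => expR (f x)).
Proof. by move=> oN sf n; exact: class_C_expR. Qed.

Lemma smooth_ln (N : set space) f : open N -> (forall x, N x -> 0 < f x) -> smooth N f ->
  smooth N (fun x => ln (f x)).
Proof. by move=> oN f0 sf n; exact: class_C_ln. Qed.

Lemma smooth_rpow r (k : R) (D : set space) : open D -> D `<=` vx_powers k ->
  (k \is a Num.int -> r \is a Num.int) -> smooth D (fun x => rpow (x ord0 i_vx) r).
Proof.
move=> oD Dk kr n; apply: class_C_local => x Dx.
have [e e2 [es er]] : exists2 e, e ^+ 2 = 1 & 0 < e * x ord0 i_vx /\ (e = 1 \/ r \is a Num.int).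
  have [_ [s0|[s0 /kr ri]]] := Dk _ Dx.
    by exists 1; rewrite ?expr1n ?mul1r//; split => //; left.
  by exists (-1); rewrite ?sqrrN ?expr1n ?mulN1r ?oppr_gt0//; split => //; right.
have [c _ cE] := rpow_expR e2 er.
pose M := [set y : space | 0 < e * y ord0 i_vx].
have oM : open M.
  rewrite (_ : M = (fun y : space => y ord0 i_vx) @^-1` [set s | 0 < e * s])//.
  apply: open_comp => [y _|]; first exact: coord_continuous.
  exact: open_half_line.
exists M; split => //.
apply: (class_C_eq oM (f := fun y => c * expR (r * ln (e * y ord0 i_vx)))).
  by move=> y My; rewrite cE.
have sv : smooth M (fun y : space => y ord0 i_vx) by exact: smooth_coord.
have : smooth M (fun y : space => c * expR (r * ln (e * y ord0 i_vx))); last exact.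
apply: smoothM => //; first exact: smooth_cst.
apply: smooth_expR => //; apply: smoothM => //; first exact: smooth_cst.
by apply: smooth_ln => //; apply: smoothM => //; exact: smooth_cst.
Qed.

End RealPowers.

(** * The three ranges of kappa in system 2 *)

Section Case2Solutions.
Context {R : realType}.
Notation space := 'rV[R]_(19 + 2).
Notation oneform := (@form1 R (19 + 2)).
Notation d_ i := (delta_mx ord0 i : space).
Implicit Types (x y : space) (k : R).

Lemma solutions_omega2 k : k != -1 -> k != -2 -> k != - (3 / 2) ->
  solutions_up_to_contact (sol2 k) (mc_forms k) (vx_powers k) (fun _ : unit => omega2 k).
Proof.
move=> k1 k2 k3.
have k1' : k + 1 != 0 by apply: contra k1 => /eqP e; apply/eqP; lra.
have k2' : k + 2 != 0 by apply: contra k2 => /eqP e; apply/eqP; lra.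
have k3' : 2 * k + 3 != 0 by apply: contra k3 => /eqP e; apply/eqP; lra.
have oD := @open_vx_powers R k.
have ki : k \is a Num.int -> k + 1 \is a Num.int by move=> h; rewrite rpredD ?rpred1.
have ki2 : k \is a Num.int -> 2 * (k + 1) \is a Num.int.
  by move=> /ki h; rewrite rpredM// rpredMn ?rpred1.
pose p s := rpow s (k + 1); pose a s := (2 * k + 3)^-1 * rpow s (2 * (k + 1)) * s.
pose b s := (k + 2)^-1 * rpow s (k + 1) * s.
have wE x : vx_powers k x -> omega2 k x =
  (x ord0 i_uxxx / x ord0 i_uxx / x ord0 i_vx) *: (d_ i_v
    + potential2 k 1 (fun y => a (y ord0 i_vx)) (fun y => b (y ord0 i_vx))
        (fun y => p (y ord0 i_vx)) (fun y => y ord0 i_vx) x).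
  move=> Dx; have [[u2 u3] v0] := vx_powers_nonzero Dx.
  apply/rowP => i; rewrite /omega2 /potential2 /a /b /p.
  move: (rpow _ (k + 1)) (rpow _ (2 * _)) => P A; entries_field x.
have dab (s : R) : s != 0 -> (0 < s \/ s < 0 /\ k \is a Num.int) ->
    is_derive s 1 a (p s ^+ 2) /\ is_derive s 1 b (p s).
  move=> s0 H.
  have D r : (k \is a Num.int -> r \is a Num.int) -> forall c,
      is_derive s 1 (fun t => c * rpow t r * t) (c * (r + 1) * rpow s r).
    move=> kr c; have H' : 0 < s \/ s < 0 /\ r \is a Num.int by case: H => [|[? /kr]]; [left|right].
    have := is_deriveM (is_deriveZ c (is_derive_rpow H')) (is_derive_id s (1 : R)).
    move=> h; apply: is_derive_eq h _; rewrite /GRing.scale /=; move: (rpow _ _) => E.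
    by rewrite -[c *: E]/(c * E); field.
  split.
    apply: is_derive_eq (D _ ki2 _) _.
    rewrite rpow_double//; last by case: H => [|[_ /ki]]; [left|right].
    rewrite /p; move: (rpow _ _) => E; by field; rewrite k3'.
  apply: is_derive_eq (D _ ki _) _; rewrite /p; move: (rpow _ _) => E.
  by field; rewrite k2'.
have sab (D : set space) : open D -> D `<=` vx_powers k ->
  smooth D (fun x => a (x ord0 i_vx)) /\ smooth D (fun x => b (x ord0 i_vx)).
  move=> oD' Dk; have s1 := smooth_rpow oD' Dk ki; have s2 := smooth_rpow oD' Dk ki2.
  by split; rewrite /a /b; repeat smooth_step.
have H x : vx_powers k x -> 0 < x ord0 i_vx \/ x ord0 i_vx < 0 /\ k \is a Num.int.
  by case.
have nz x : vx_powers k x -> x ord0 i_vx != 0 by move=> /vx_powers_nonzero[].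
have pos_sub : vx_positive `<=` vx_powers k by move=> x [gx v0]; split => //; left.
have [sa sb] := sab _ oD (fun _ => id).
have [sa' sb'] := sab _ (@open_vx_positive R) pos_sub.
split=> [_|N w0 oN Ng sol q Nq].
  apply: (sol2_omega2 k1' oD _ wE (smooth_rpow oD (fun _ => id) ki) sa sb).
  - by move=> x; exact: vx_powers_nonzero.
  - move=> x Dx; have [e e2 [es er]] : exists2 e : R, e ^+ 2 = 1 & 0 < e * x ord0 i_vx /\ (e = 1 \/ k + 1 \is a Num.int).
      have [s0|[s0 /ki ri]] := H _ Dx.
        by exists 1; rewrite ?expr1n ?mul1r//; split => //; left.
      by exists (-1); rewrite ?sqrrN ?expr1n ?mulN1r ?oppr_gt0//; split => //; right.
    have [c c2 cE] := rpow_expR e2 er; rewrite /p cE// mulf_neq0 ?expR_eq0//.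
    by apply: contra_eq_neq c2 => ->; rewrite expr0n /= eq_sym oner_neq0.
  - by move=> x Dx; apply: is_derive_rpow; have [|[? /ki]] := H _ Dx; [left|right].
  - by move=> x Dx; have [] := dab _ (nz _ Dx) (H _ Dx).
  - by move=> x Dx; have [] := dab _ (nz _ Dx) (H _ Dx).
exists tt; apply: (contact_sol2 k1' wE pos_sub _ _ _ sa' sb' oN Ng sol Nq).
- by move=> s s0; rewrite /p /rpow s0 /powR gt_eqF.
- by move=> s s0; have [] := dab s (lt0r_neq0 s0) (or_introl s0).
- by move=> s s0; have [] := dab s (lt0r_neq0 s0) (or_introl s0).
Qed.

(** Trades the absolute value for a square, so that derivatives need no distinction of sign. At s =
    0 both sides are 0 by the default value of [ln]. *)
Lemma ln_abs (s : R) : ln `|s| = 2^-1 * ln (s ^+ 2).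
Proof.
have [->|s0] := eqVneq s 0; first by rewrite normr0 expr0n /= ln0// mulr0.
by rewrite -[s ^+ 2]real_normK ?num_real// lnXn ?normr_gt0// -[X in _ * X]mulr_natl mulrA mulVf ?mul1r// pnatr_eq0.
Qed.

Lemma is_derive_ln_abs (s : R) : s != 0 -> is_derive s 1 (fun t : R => ln `|t|) s^-1.
Proof.
move=> s0; rewrite (_ : (fun t : R => ln `|t|) = fun t => 2^-1 * ln (t ^+ 2)); last first.
  by apply/funext => t; rewrite ln_abs.
have s2 : 0 < s ^+ 2 by rewrite lt_def sqrf_eq0 s0 sqr_ge0.
have D : is_derive s 1 (fun t : R => t ^+ 2) (2 * s).
  rewrite (_ : (fun t => t ^+ 2) = (fun t : R => t * t)); last first.
    by apply/funext => t; rewrite expr2.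
  have h := is_deriveM (is_derive_id s (1 : R)) (is_derive_id s (1 : R)).
  by apply: is_derive_eq h _; rewrite /GRing.scale /=; ring.
have := is_deriveZ 2^-1 (@is_derive1_comp R (@ln R) (fun t => t ^+ 2) s _ _ (is_derive1_ln s2) D).
by move=> h; apply: is_derive_eq h _; rewrite /GRing.scale /=; field.
Qed.

Lemma smooth_ln_abs (D : set space) : open D -> D `<=` vx_nonzero ->
  smooth D (fun x => ln `|x ord0 i_vx|).
Proof.
move=> oD Dv; rewrite (_ : (fun x => _) = fun x : space => 2^-1 * ln (x ord0 i_vx ^+ 2)); last first.
  by apply/funext => x; rewrite ln_abs.
apply: smoothM => //; first exact: smooth_cst.
apply: smooth_ln => //; last by apply: smoothX => //; exact: smooth_coord.
by move=> x /Dv[_ v0]; rewrite lt_def sqrf_eq0 v0 sqr_ge0.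
Qed.

Lemma solutions_omega2_m2 :
  solutions_up_to_contact (sol2 (-2)) (mc_forms (-2)) vx_nonzero (fun _ : unit => @omega2_m2 R).
Proof.
have k1' : -2 + 1 != 0 :> R by apply/eqP => h; lra.
have oD := @open_vx_nonzero R.
(* Here v_x^(kappa+1) = 1 / v_x, and ln |v_x| is a primitive of it on both half-lines. *)
pose p (s : R) := s^-1; pose a (s : R) := - s^-1; pose b (s : R) := ln `|s|.
have dV (s : R) : s != 0 -> is_derive s 1 (fun t : R => t^-1) (- s ^- 2).
  move=> s0; have := is_deriveV s0 (is_derive_id s (1 : R)).
  by move=> h; apply: is_derive_eq h _; rewrite -[_ *: 1]/(_ * 1) mulr1.
have da (s : R) : s != 0 -> is_derive s 1 a (p s ^+ 2).
  by move=> /dV h; apply: is_derive_eq (is_deriveN h) _; rewrite opprK exprVn.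
have sa (D : set space) : open D -> D `<=` vx_nonzero -> smooth D (fun x => (x ord0 i_vx)^-1).
  by move=> oD' Dv; repeat smooth_step; move=> x /Dv[].
have sa' (D : set space) : open D -> D `<=` vx_nonzero -> smooth D (fun x => a (x ord0 i_vx)).
  by move=> oD' Dv; apply: smoothN => //; exact: sa.
have wE x : vx_nonzero x -> @omega2_m2 R x =
  (x ord0 i_uxxx / x ord0 i_uxx / x ord0 i_vx) *: (d_ i_v
    + potential2 (-2) 1 (fun y => a (y ord0 i_vx)) (fun y => b (y ord0 i_vx))
        (fun y => p (y ord0 i_vx)) (fun y => y ord0 i_vx) x).
  move=> [[u2 u3] v0]; apply/rowP => i; rewrite /omega2_m2 /potential2 /a /b /p.
  move: (ln _) => L; entries_field x.
have pv : vx_positive `<=` @vx_nonzero R by move=> x /vx_positive_nonzero.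
split=> [_|N w0 oN Ng sol q Nq].
  apply: (@sol2_omega2 R (-2) k1' vx_nonzero _ p a b) => //; try by move=> x [_ v0].
  - exact: sa.
  - exact: sa'.
  - exact: smooth_ln_abs.
  - by move=> x [_ v0]; rewrite invr_eq0.
  - by move=> x [_ v0]; apply: is_derive_eq (dV _ v0) _; rewrite /p; field.
  - by move=> x [_ v0]; exact: da.
  - by move=> x [_ v0]; exact: is_derive_ln_abs.
exists tt; apply: (contact_sol2 k1' wE pv _ _ _ _ _ oN Ng sol Nq) => //.
- move=> s s0; rewrite /p (_ : -2 + 1 = -1); last lra.
  by rewrite mulN1r expRN lnK.
- by move=> s /lt0r_neq0; exact: da.
- by move=> s /lt0r_neq0; exact: is_derive_ln_abs.
- by apply: sa' => //; exact: open_vx_positive.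
- by apply: smooth_ln_abs => //; exact: open_vx_positive.
Qed.

Lemma sqrt_abs_expR (s : R) : 0 < s -> Num.sqrt `|s| = expR (2^-1 * ln s).
Proof. by move=> s0; rewrite gtr0_norm// -powR12_sqrt ?ltW// /powR gt_eqF. Qed.

Lemma solutions_omega2_m32 :
  solutions_up_to_contact (sol2 (- (3 / 2))) (mc_forms (- (3 / 2))) vx_positive
    (fun _ : unit => @omega2_m32 R).
Proof.
have k1' : - (3 / 2) + 1 != 0 :> R by apply/eqP => h; lra.
have oD := @open_vx_positive R.
have ke : - (3 / 2) + 1 = - 2^-1 :> R by lra.
(* The power s^(-1/2), in the form of [is_derive_scaled_exp] with c = e = 1; its square 1 / s has
   the logarithm as primitive. *)
pose p (s : R) := 1 * expR (- 2^-1 * ln (1 * s)).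
pose a (s : R) := ln `|s|; pose b (s : R) := 2 * Num.sqrt `|s|.
have one (s : R) : 0 < s -> 0 < 1 * s by rewrite mul1r.
have dp (s : R) : 0 < s -> is_derive s 1 p ((- (3 / 2) + 1) * p s / s).
  by move=> s0; rewrite ke; apply: is_derive_scaled_exp; rewrite ?expr1n ?mul1r.
have p2 (s : R) : 0 < s -> p s ^+ 2 = s^-1.
  move=> s0; rewrite /p !mul1r -expRM_natl mulrA mulrN mulfV ?pnatr_eq0// mulN1r expRN lnK//.
have da (s : R) : 0 < s -> is_derive s 1 a (p s ^+ 2).
  by move=> s0; rewrite p2//; apply: is_derive_ln_abs; exact: lt0r_neq0.
have ps (s : R) : 0 < s -> p s * s = Num.sqrt `|s|.
  move=> s0; rewrite sqrt_abs_expR// /p !mul1r -[X in _ * X = _](lnK (x := s)) // -expRD.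
  by congr expR; move: (ln s) => L; lra.
have db (s : R) : 0 < s -> is_derive s 1 b (p s).
  move=> s0; have := @is_derive_scaled_exp R 2^-1 1 s 2 (one _ s0) (expr1n _ 2).
  rewrite mul1r -sqrt_abs_expR// -ps// => h.
  have E (t : R) : 0 < 1 * t -> 2 * expR (2^-1 * ln (1 * t)) = b t.
    by rewrite mul1r => t0; rewrite /b sqrt_abs_expR.
  apply: is_derive_eq (is_derive_half_line (one _ s0) E h) _.
  by move: (p s) => P; field; exact: lt0r_neq0.
have gt0 x : @vx_positive R x -> 0 < x ord0 i_vx by case.
have sexp (r c : R) : smooth vx_positive (fun x : space => c * expR (r * ln (1 * x ord0 i_vx))).
  apply: smoothM => //; first exact: smooth_cst.
  apply: smooth_expR => //; apply: smoothM => //; first exact: smooth_cst.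
  apply: smooth_ln => //; first by move=> x /gt0; exact: one.
  by apply: smoothM => //; [exact: smooth_cst|exact: smooth_coord].
have sa : smooth vx_positive (fun x => a (x ord0 i_vx)).
  by apply: smooth_ln_abs => // x /vx_positive_nonzero.
have sb : smooth vx_positive (fun x => b (x ord0 i_vx)).
  apply: (smooth_eq oD _ (sexp 2^-1 2)) => x /gt0 s0.
  by rewrite mul1r /b sqrt_abs_expR.
have wE x : vx_positive x -> @omega2_m32 R x =
  (x ord0 i_uxxx / x ord0 i_uxx / x ord0 i_vx) *: (d_ i_v
    + potential2 (- (3 / 2)) 1 (fun y => a (y ord0 i_vx)) (fun y => b (y ord0 i_vx))
        (fun y => p (y ord0 i_vx)) (fun y => y ord0 i_vx) x).
  move=> [[u2 u3] v0]; apply/rowP => i; rewrite /omega2_m32 /potential2 /a /b -ps//.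
  have v0' := lt0r_neq0 v0; clear v0; move: (p _) (ln _) => P L; entries_field x.
split=> [_|N w0 oN Ng sol q Nq].
  apply: (sol2_omega2 k1' oD _ wE (sexp _ _) sa sb).
  - by move=> x /vx_positive_nonzero.
  - by move=> x _; rewrite /p mul1r expR_eq0.
  - by move=> x /gt0; exact: dp.
  - by move=> x /gt0; exact: da.
  - by move=> x /gt0; exact: db.
exists tt; apply: (contact_sol2 k1' wE (fun _ => id) _ _ _ _ _ oN Ng sol Nq) => //.
by move=> s s0; rewrite /p ke !mul1r.
Qed.

End Case2Solutions.

(** * System 4 *)

Section Case4.
Context {R : realType}.
Notation space := 'rV[R]_(19 + 2).
Notation oneform := (@form1 R (19 + 2)).
Notation d_ i := (delta_mx ord0 i : space).
Implicit Types (x y q : space) (lam : R).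

Lemma has_grad_cast (f : space -> R) x u v : has_grad f x u -> u = v -> has_grad f x v.
Proof. by move=> H <-. Qed.

(* W along [omega4 0]; along [omega4 lambda] it is [Wlam lambda]. *)
Definition W0 x := - (x ord0 i_ux * x ord0 i_uxxx + x ord0 i_uxxy) / x ord0 i_uxx ^+ 2 + 3 / 8.

Definition dW0 : oneform := fun x =>
  - (x ord0 i_uxx ^+ 2)^-1 *: (x ord0 i_uxxx *: d_ i_ux + x ord0 i_ux *: d_ i_uxxx + d_ i_uxxy)
  + (2 * (x ord0 i_ux * x ord0 i_uxxx + x ord0 i_uxxy) / x ord0 i_uxx ^+ 3) *: d_ i_uxx.

(* the equation for dW at lambda = 0, solved for eta_2 *)
Definition eta2_form : oneform := fun x =>
  dW0 x - (invU' x * W0 x) *: xi1 x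
  - 2^-1 *: (W0 x *: (eta1' x - theta22 x) - (W0 x + 1) *: xi2' x
             + (2 * invU' x - W0 x) *: xi3' x).

Definition Wlam lam x := lam * (x ord0 i_uxxx / x ord0 i_uxx ^+ 2) + W0 x.

(** Closed form of xi^2 + W xi^3 + W^2 xi^1 at W = [Wlam lam], in which u_xxy has cancelled. *)
Definition chi4 lam : oneform := fun x =>
  (x ord0 i_uxxx / x ord0 i_uxx) *:
  (- (x ord0 i_uy + lam * x ord0 i_ux - lam ^+ 2) *: d_ i_t + d_ i_x - (x ord0 i_ux - lam) *: d_ i_y).

Lemma has_grad_W0 x : generic x -> has_grad W0 x (dW0 x).
Proof.
move=> [u2 u3]; have -> : dW0 x = ((- (x ord0 i_ux * x ord0 i_uxxx + x ord0 i_uxxy)) *: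
   (- ((x ord0 i_uxx ^+ 2) ^- 2) *: ((2 * x ord0 i_uxx) *: d_ i_uxx)) +
   (x ord0 i_uxx ^+ 2)^-1 *: - ((x ord0 i_ux *: d_ i_uxxx + x ord0 i_uxxx *: d_ i_ux) + d_ i_uxxy)) + 0.
  by apply/rowP => i; rewrite /dW0; entries_field x.
by rewrite /W0; repeat grad_step; rewrite expf_neq0.
Qed.

Lemma chi4E lam x : generic x ->
  chi4 lam x = xi2' x + Wlam lam x *: xi3' x + (Wlam lam x ^+ 2) *: xi1 x.
Proof.
move=> [u2 u3]; apply/rowP => i; rewrite /chi4 /Wlam /W0 /xi2' /xi3' /xi1; entries_field x.
Qed.

(** The left side is the factor of W in the equation for dW, the right side the logarithmic
    differential of u_xxx / u_xx^2. Hence two solutions W differ by a locally constant multiple of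
    u_xxx / u_xx^2. *)
Lemma dlog_identity x : generic x ->
  invU' x *: xi1 x + 2^-1 *: (eta1' x - theta22 x - xi2' x - xi3' x) =
  (x ord0 i_uxxx)^-1 *: d_ i_uxxx - (2 / x ord0 i_uxx) *: d_ i_uxx.
Proof.
move=> [u2 u3]; apply/rowP => i; rewrite /eta1' /theta22 /vtheta22 /xi2' /xi3' /xi1 /invU'; entries_field x.
Qed.

Lemma dext_xi2' x : generic x -> dext xi2' x =
      - (8^-1 *: ((5 *: theta0 x + 8 *: theta3' x) ⋀ xi1 x))
      + 8^-1 *: ((4 *: (eta1' x + theta22 x) + 3 *: xi3' x) ⋀ xi2' x)
      - (eta2_form x + theta2 x) ⋀ xi3' x.
Proof.
move=> [u2 u3]; apply: has_dext_eq.
  by rewrite /xi2'; repeat first [dext_step | grad_step]; rewrite ?mulf_neq0 ?pnatr_eq0.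
apply/matrixP => i j.
rewrite /eta2_form /dW0 /W0 /eta1' /theta22 /xi1 /xi3' /xi2' /theta2 /theta0 /theta3' /vtheta22 /vtheta0 /vtheta2 /vtheta3 /invU' /uyy.
by entries_field x.
Qed.

Lemma dext_xi3' x : generic x -> dext xi3' x =
      - ((2 *: eta2_form x + theta2 x) ⋀ xi1 x)
      + (theta22 x + invU' x *: xi1 x + xi2' x) ⋀ xi3' x.
Proof.
move=> [u2 u3]; apply: has_dext_eq.
  by rewrite /xi3'; repeat first [dext_step | grad_step]; rewrite mulf_neq0.
apply/matrixP => i j.
rewrite /eta2_form /dW0 /W0 /eta1' /theta22 /xi1 /xi3' /xi2' /theta2 /theta0 /theta3' /vtheta22 /vtheta0 /vtheta2 /vtheta3 /invU' /uyy.
by entries_field x.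
Qed.

Let alpha (W : R) x := 2^-1 *: (eta1' x + theta22 x - (W * (W - 2)) *: xi1 x)
         - (8^-1 * (4 * W - 7)) *: xi3' x.

Lemma dext_chi4 lam x : generic x -> let W := Wlam lam x in
  dext (chi4 lam) x = alpha W x ⋀ chi4 lam x
    - ((5 / 8) *: theta0 x + W *: theta2 x + theta3' x) ⋀ xi1 x - theta2 x ⋀ xi3' x.
Proof.
move=> [u2 u3] W; apply: has_dext_eq.
  by rewrite /chi4; repeat first [dext_step | grad_step].
apply/matrixP => i j.
rewrite /W /alpha /chi4 /Wlam /W0 /eta1' /theta22 /xi1 /xi3' /xi2' /theta2 /theta0 /theta3' /vtheta22 /vtheta0 /vtheta2 /vtheta3 /invU' /uyy.
by entries_field x.
Qed.


Lemma smooth_W0 (N : set space) : open N -> N `<=` generic -> smooth N W0.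
Proof. move=> oN Ng; rewrite /W0; solve_smooth. Qed.

Lemma smooth_eta2_form : smooth_map generic eta2_form.
Proof.
have oN := @open_generic R; have Ng : @generic R `<=` generic by [].
have sW := smooth_W0 oN Ng; have sU := smooth_invU' oN Ng.
rewrite /eta2_form /dW0; solve_smooth; smooth_base_form.
Qed.

Lemma is_eta2_eta2_form : is_eta2 eta2_form.
Proof.
split; first exact: smooth_eta2_form.
by move=> q gq; split; [exact: dext_xi2'|exact: dext_xi3'].
Qed.

Lemma is_eta2_unique (e2 : oneform) x : is_eta2 e2 -> generic x -> e2 x = eta2_form x.
Proof.
move=> [_ H] gx; have [E2 E3] := H _ gx; have [u2 u3] := gx.
have {E2} : (e2 x - eta2_form x) ⋀ xi3' x = 0.
  move: E2; rewrite dext_xi2'//.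
  move: (eta2_form x) (e2 x) (theta2 x) (xi3' x) (_ + 8^-1 *: _) => a b c d M E.
  apply/matrixP => i j; have := congr1 (fun A : 'M[R]_(19 + 2) => A i j) E.
  rewrite /= !mxE !big_ord1 !mxE => /eqP; rewrite -subr_eq0 => /eqP h.
  by rewrite -[RHS]h; ring.
have {E3 H} : (e2 x - eta2_form x) ⋀ xi1 x = 0.
  move: E3; rewrite dext_xi3'//.
  move: (eta2_form x) (e2 x) (theta2 x) (xi1 x) ((_ + _) ⋀ _) => a b c d M E.
  apply/matrixP => i j; have := congr1 (fun A : 'M[R]_(19 + 2) => A i j) E.
  rewrite /= !mxE !big_ord1 !mxE => /eqP; rewrite -subr_eq0 => /eqP h.
  have two : 2 != 0 :> R by rewrite pnatr_eq0.
  by apply: (mulfI two); rewrite mulr0 -[RHS]h; ring.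
move=> F1 F3; apply/eqP; rewrite -subr_eq0; apply/eqP.
move: (e2 x - eta2_form x) F1 F3 => c F1 F3.
have X1 i : xi1 x 0 i = x ord0 i_uxx ^+ 3 / x ord0 i_uxxx * (i == i_t)%:R by rewrite /xi1 !mxE.
have c0 : x ord0 i_uxx ^+ 3 / x ord0 i_uxxx != 0 by rewrite mulf_neq0 ?invr_eq0 ?expf_neq0.
(* The vanishing product with xi^1 leaves c only a dt component, which the dt, dy entry of the
   product with xi^3 removes. *)
have G i : i != i_t -> c 0 i = 0.
  move=> it; have := congr1 (fun A : 'M[R]_(19 + 2) => A i i_t) F1.
  rewrite /= wedgeE mx_entry0 !X1 eqxx (negPf it) mulr0 mul0r subr0 mulr1 => /eqP.
  by rewrite mulf_eq0 (negPf c0) orbF => /eqP.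
have Gt : c 0 i_t = 0.
  have := congr1 (fun A : 'M[R]_(19 + 2) => A i_t i_y) F3.
  rewrite /= wedgeE mx_entry0 (G i_y)// mulr0 subr0 => /eqP; rewrite mulf_eq0 => /orP[/eqP//|].
  by rewrite !mxE /= mulr0 add0r mulr1 (negPf u2).
by apply/rowP => i; rewrite [RHS]mxE; have [->|] := eqVneq i i_t; [|exact: G].
Qed.

Lemma grad_Wlam lam x : generic x -> has_grad (Wlam lam) x
   (eta2_form x + (invU' x * Wlam lam x) *: xi1 x
        + 2^-1 *: (Wlam lam x *: (eta1' x - theta22 x) - (Wlam lam x + 1) *: xi2' x
                   + (2 * invU' x - Wlam lam x) *: xi3' x)).
Proof.
move=> gx; have [u2 u3] := gx; set g := (X in has_grad _ _ X).
have -> : g = dW0 x + (lam * (x ord0 i_uxxx / x ord0 i_uxx ^+ 2)) *: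
    (invU' x *: xi1 x + 2^-1 *: (eta1' x - theta22 x - xi2' x - xi3' x)).
  rewrite /g /eta2_form /Wlam; move: (dW0 x) (invU' x) (W0 x) (xi1 x) (eta1' x) (theta22 x) (xi2' x) (xi3' x).
  move=> a b c d e f h l; apply/rowP => i; entries_field x.
rewrite dlog_identity// addrC.
apply: has_gradD; last exact: has_grad_W0.
set h := (X in has_grad _ _ X).
have -> : h = lam *: (x ord0 i_uxxx *: (- ((x ord0 i_uxx ^+ 2) ^- 2) *: ((2 * x ord0 i_uxx) *: d_ i_uxx)) +
     (x ord0 i_uxx ^+ 2)^-1 *: d_ i_uxxx) + (x ord0 i_uxxx / x ord0 i_uxx ^+ 2) *: 0.
  by apply/rowP => i; rewrite /h; entries_field x.
by repeat grad_step; rewrite expf_neq0.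
Qed.

Lemma horizontal_chi4 lam x : horizontal (chi4 lam x).
Proof. rewrite /chi4; repeat horizontal_step. Qed.

Lemma horizontal_eta2_form x : horizontal (eta2_form x).
Proof.
rewrite /eta2_form /dW0 /eta1' /theta22 /vtheta22 /xi1 /xi2' /xi3'; repeat horizontal_step.
Qed.

Lemma flip_eta2_form x y : generic x -> flipped 1 x y -> flip 1 (eta2_form y) = eta2_form x.
Proof.
move=> [u2 u3] E.
flip_coordinates E.
rewrite /eta2_form /dW0 /W0 /eta1' /theta22 /vtheta22 /xi1 /xi2' /xi3' /invU'.
solve_flip x.
Qed.

Lemma flip_chi4 lam x y : generic x -> flipped 1 x y -> flip 1 (chi4 lam y) = chi4 lam x.
Proof.
move=> [u2 u3] E.
flip_coordinates E.
rewrite /chi4.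
solve_flip x.
Qed.

Lemma omega4E lam x : vx_nonzero x -> omega4 lam x =
  (x ord0 i_uxxx / (x ord0 i_uxx * x ord0 i_vx)) *: d_ i_v - chi4 lam x.
Proof.
by move=> [[u2 u3] v0]; apply/rowP => i; rewrite /omega4 /chi4; entries_field x.
Qed.

Lemma smooth_chi4 lam (N : set space) : open N -> N `<=` generic -> smooth_map N (chi4 lam).
Proof. move=> oN Ng; rewrite /chi4; solve_smooth. Qed.

Lemma sol4_omega4 (e2 : oneform) lam : is_eta2 e2 -> sol4 e2 vx_nonzero (omega4 lam).
Proof.
move=> He2; have oD := @open_vx_nonzero R; have Dg : @vx_nonzero R `<=` generic by move=> x [].
have sW : smooth vx_nonzero (Wlam lam).
  have s0 := smooth_W0 oD Dg; rewrite /Wlam; solve_smooth.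
pose w1 x := dlog_potential x - alpha (Wlam lam x) x.
exists w1, (Wlam lam); split => //.
  apply: new_forms_triangular.
  - rewrite /omega4; solve_smooth.
  - apply: smooth_mapD => //; first by rewrite /dlog_potential; solve_smooth.
    by rewrite /alpha; solve_smooth; smooth_base_form.
  - move=> x Dx; have [[u2 u3] v0] := Dx; rewrite omega4E//.
    have [y1 y2] := horizontal_chi4 lam x.
    have [a1 a2] : horizontal (alpha (Wlam lam x) x).
      by rewrite /alpha; do !horizontal_step; horizontal_base_form.
    move: y1 y2 a2; rewrite /w1 /dlog_potential; move: (chi4 lam x) (alpha _ x) => b c b1 b2 c2.
    rewrite !mxE b1 b2 c2 /= !mulr0 !mulr1 !oppr0 !addr0 !add0r.
    by split; rewrite ?oppr_eq0 ?mulf_neq0 ?invr_eq0 ?mulf_neq0.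
move=> x Dx; have gx := Dg _ Dx; split; last first.
  by rewrite (is_eta2_unique He2 gx) (grad_eq (grad_Wlam lam gx)).
have oG := @open_generic R.
rewrite (dext_potential Dx (@omega4E lam) (smooth_has_dext (smooth_chi4 lam oG (fun _ => id)) gx)).
rewrite dext_chi4//= (chi4E lam gx) /w1 /alpha.
move: (dlog_potential x) (omega4 lam x) (eta1' x) (theta22 x) (xi1 x) (xi2' x) (xi3' x) (theta0 x) (theta2 x) (theta3' x) (Wlam lam x) => a1 a2 a3 a4 a5 a6 a7 a8 a9 a10 W.
by apply/matrixP => i j; entries; ring.
Qed.

Lemma system4_entry (w1 w0 : space) (W : R) x :
  ((w1 + 2^-1 *: (eta1' x + theta22 x - (W * (W - 2)) *: xi1 x)
         - (8^-1 * (4 * W - 7)) *: xi3' x) ⋀ w0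
        + (W ^+ 2 *: w1 + (5 / 8) *: theta0 x + W *: theta2 x + theta3' x) ⋀ xi1 x
        + w1 ⋀ xi2' x + (W *: w1 + theta2 x) ⋀ xi3' x) i_v i_vx
  = (w1 ⋀ w0) i_v i_vx.
Proof.
have [e1 e2] := horizontal_eta1' x; have [t1 t2] := horizontal_theta22 x.
have [x1 x2] := horizontal_xi1 x; have [y1 y2] := horizontal_xi2' x.
have [z1 z2] := horizontal_xi3' x.
etransitivity; [by repeat entry_step|rewrite wedgeE].
by rewrite e1 e2 t1 t2 x1 x2 y1 y2 z1 z2; ring.
Qed.

(* lambda = (W - W0) u_xx^2 / u_xxx has zero differential. *)
Lemma Wlam_of_grad (N : set space) (W : space -> R) q : open N -> N `<=` generic -> N q -> smooth N W ->
  (forall x, N x -> grad W x = eta2_form x + (invU' x * W x) *: xi1 x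
        + 2^-1 *: (W x *: (eta1' x - theta22 x) - (W x + 1) *: xi2' x
                   + (2 * invU' x - W x) *: xi3' x)) ->
  exists lam M, [/\ open M, M q, M `<=` N & forall x, M x -> W x = Wlam lam x].
Proof.
move=> oN Ng Nq sW gW.
have [r /= r0 rN] := (nbhs_ballP _ _).1 (open_nbhs_nbhs (conj oN Nq)).
pose L x := (W x - W0 x) * (x ord0 i_uxx ^+ 2 / x ord0 i_uxxx).
have gL x : N x -> has_grad L x 0.
  move=> Nx; have gx := Ng _ Nx; have [u2 u3] := gx.
  have h1 := smooth_has_grad sW Nx; rewrite gW// in h1.
  have h2 := has_grad_W0 gx.
  apply: (has_grad_cast (has_gradM (has_gradD h1 (has_gradN h2))
    (has_gradM (has_gradX 2 (has_grad_coord i_uxx x)) (has_gradV u3 (has_grad_coord i_uxxx x))))).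
  have D := dlog_identity gx.
  have -> : eta2_form x + (invU' x * W x) *: xi1 x + 2^-1 *: (W x *: (eta1' x - theta22 x) - (W x + 1) *: xi2' x
                   + (2 * invU' x - W x) *: xi3' x) - dW0 x = (W x - W0 x) *:
     ((x ord0 i_uxxx)^-1 *: d_ i_uxxx - (2 / x ord0 i_uxx) *: d_ i_uxx).
    rewrite -D /eta2_form; move: (dW0 x) (invU' x) (W0 x) (W x) (xi1 x) (eta1' x) (theta22 x) (xi2' x) (xi3' x).
    by move=> a b c d e f g h l; apply/rowP => i; entries_field x.
  by move: (W x) (W0 x) => w w'; apply/rowP => i; entries_field x.
exists (L q), (ball q r); split => //; [exact: ball_open|exact: ballxx|].
move=> x Bx; have Lx : L x = L q.
  have dL y : `|y - q| <= `|x - q| -> forall i, derivable L y (delta_mx 0 i).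
    move=> yq i; have Ny : N y by apply/rN/ball_dist; apply: le_lt_trans yq _; exact/ball_dist.
    by have [] := gL _ Ny i.
  have [xi [xiq E]] := increment_telescope dL.
  apply/eqP; rewrite -subr_eq0; rewrite [q + _]addrC subrK in E; rewrite E.
  rewrite big1// => i _; have Ny : N (xi i).
    by apply/rN/ball_dist; apply: le_lt_trans (xiq i) _; exact/ball_dist.
  by have [_] := gL _ Ny i; rewrite /partial mxE => ->; rewrite mulr0.
have [u2 u3] := Ng _ (rN _ Bx).
by rewrite -Lx /Wlam /L; move: (W0 x) (W x) => a b; field; rewrite u2 u3.
Qed.

Lemma contact_sol4 (e2 : oneform) (N : set space) w0 q : is_eta2 e2 -> open N -> N `<=` generic ->
  sol4 e2 N w0 -> N q ->
  exists lam, contact_equiv_at (mc_forms' e2) vx_nonzero (omega4 lam) q w0.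
Proof.
move=> He2 oN Ng [w1 [W [[sw0 sw1 rf] sW E]]] Nq.
have gW x : N x -> grad W x = eta2_form x + (invU' x * W x) *: xi1 x
        + 2^-1 *: (W x *: (eta1' x - theta22 x) - (W x + 1) *: xi2' x
                   + (2 * invU' x - W x) *: xi3' x).
  by move=> Nx; have [_ ->] := E _ Nx; rewrite (is_eta2_unique He2 (Ng _ Nx)).
have [lam [M [oM Mq MN WE]]] := Wlam_of_grad oN Ng Nq sW gW.
exists lam; have Mg : M `<=` generic by move=> x /MN /Ng.
have sc := smooth_chi4 lam oM Mg; have sw0' := smooth_map_sub MN sw0.
apply: (@contact_equiv_frobenius _ _ _ _ (chi4 lam) (fun x => w1 x + alpha (W x) x) M) => //.
- by move=> x _; exact: horizontal_chi4.
- move=> x Mx; have gx := Mg _ Mx.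
  have dw := smooth_has_dext sw0' Mx; have dc := smooth_has_dext sc Mx.
  rewrite (has_dext_eq (has_dextD dw dc) erefl); have [-> _] := E _ (MN _ Mx).
  rewrite dext_chi4//= (chi4E lam gx) (WE _ Mx) /alpha.
  move: (w0 x) (w1 x) (eta1' x) (theta22 x) (xi1 x) (xi2' x) (xi3' x) (theta0 x) (theta2 x) (theta3' x) (Wlam lam x) => a1 a2 a3 a4 a5 a6 a7 a8 a9 a10 V.
  by apply/matrixP => i j; entries; ring.
- have [-> _] := E _ Nq; rewrite system4_entry wedgeE.
  by have := rf _ Nq; rewrite row_free_fibre; apply: contra => /eqP e; rewrite -oppr_eq0 -e; apply/eqP; ring.
- move=> [h1 h2]; have := rf _ Nq; rewrite row_free_fibre h1 h2 !mul0r subrr.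
  by rewrite eqxx.
- move=> x y a gx gy xy [mca|->]; first exact: (flip_mc_forms' gx xy mca).
  by rewrite !(is_eta2_unique He2)//; split; [exact: horizontal_eta2_form|exact: flip_eta2_form].
- move=> x y Mx xy v0; have gx := Mg _ Mx; have [u2 u3] := gx.
  exists (- chi4 lam y).
  have gy : generic y by rewrite /generic /= !xy// /flip_sign /= !mul1r.
  split; first by rewrite omega4E// invfM mulrA.
    exact/horizontalN/horizontal_chi4.
  exact/flipN/flip_chi4.
Qed.

End Case4.

Theorem theorem4 (R : realType) (kappa : R) :
  [/\ (kappa != -1 ->
         solutions_up_to_contact (sol1 kappa) (mc_forms kappa)
           vx_nonzero (fun _ : unit => omega1 kappa)),
      (kappa != -1 ->
         [/\ (kappa != -2 -> kappa != - (3 / 2) ->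
                solutions_up_to_contact (sol2 kappa) (mc_forms kappa)
                  (vx_powers kappa) (fun _ : unit => omega2 kappa)),
             (kappa = -2 ->
                solutions_up_to_contact (sol2 kappa) (mc_forms kappa)
                  vx_nonzero (fun _ : unit => omega2_m2)) &
             (kappa = - (3 / 2) ->
                solutions_up_to_contact (sol2 kappa) (mc_forms kappa)
                  vx_positive (fun _ : unit => omega2_m32))]),
      (kappa = -3 ->
         solutions_up_to_contact (sol3 kappa) (mc_forms kappa)
           vx_nonzero (fun _ : unit => omega3)) &
      (kappa = -1 ->
         (exists eta2 : form1 (19 + 2), @is_eta2 R eta2) /\
         forall eta2 : form1 (19 + 2), @is_eta2 R eta2 ->
           solutions_up_to_contact (sol4 eta2) (mc_forms' eta2)
             vx_nonzero omega4)].
Proof.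
split.
- by move=> _; exact: solutions_sol1.
- move=> k1; split.
  + by move=> k2 k3; exact: solutions_omega2.
  + by move=> ->; exact: solutions_omega2_m2.
  + by move=> ->; exact: solutions_omega2_m32.
- by move=> ->; exact: solutions_sol3.
- move=> _; split; first by exists eta2_form; exact: is_eta2_eta2_form.
  move=> eta2 He; split; first by move=> lambda; exact: sol4_omega4.
  by move=> N w0 oN Ng sol q Nq; exact: (contact_sol4 He oN Ng sol Nq).
Qed.
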